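(* Let $\tau>\frac{N}{2}$ and $\varphi\in L_2^{\tau}(\mathbb{R}^N)$, and let $\rho\in(0,1)$, $T>0$. Then the forward problem $$D_t^\rho u(x,t)+A(D)u(x,t)=0,\quad x\in\mathbb{R}^N,\ 0<t\le T,$$ $$\lim_{|x|\to\infty}D^\alpha u(x,t)=0,\quad |\alpha|\le l-1,\ 0<t\le T,$$ $$u(x,0)=\varphi(x),\quad x\in\mathbb{R}^N,$$ has a (classical) solution, given by $$u(x,t)=\int_{\mathbb{R}^N}E_\rho\big(-A(\xi)t^\rho\big)\,\hat\varphi(\xi)\,e^{ix\xi}\,d\xi ,$$ where the integral converges uniformly with respect to $x\in\mathbb{R}^N$ for each $t\in(0,T]$.
   Context: $A(D)=\sum_{|\alpha|=m}a_\alpha D^\alpha$ is a homogeneous symmetric elliptic differential expression of even order $m=2l$ with constant coefficients, where $\alpha=(\alpha_1,\dots,\alpha_N)$ is a multi-index, $D=(D_1,\dots,D_N)$, $D_j=\partial/\partial x_j$; its symbol $A(\xi)=\sum_{|\alpha|=m}a_\alpha\xi^\alpha$ satisfies $A(\xi)>0$ for all $\xi\neq0$. For $\rho<0$ the Riemann–Liouville fractional integral is $\partial_t^\rho h(t)=\frac{1}{\Gamma(-\rho)}\int_0^t\frac{h(s)}{(t-s)^{\rho+1}}ds$, and for $0<\rho<1$ the Caputo derivative is $D_t^\rho h(t)=\partial_t^{\rho-1}\frac{d}{dt}h(t)$. $E_\rho(z)=\sum_{k\ge0}\frac{z^k}{\Gamma(\rho k+1)}$ is the Mittag-Leffler function.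 The Fourier transform is $\hat f(\xi)=(2\pi)^{-N}\int_{\mathbb{R}^N}f(x)e^{-ix\xi}dx$. The Sobolev class $L_2^a(\mathbb{R}^N)$, $a>0$, consists of $f\in L_2(\mathbb{R}^N)$ with $\|f\|^2_{L_2^a}=\int_{\mathbb{R}^N}(1+|\xi|^2)^a|\hat f(\xi)|^2d\xi<\infty$. A (classical) solution of the forward problem is a function $u(x,t)$ with $D_t^\rho u$ and $A(D)u$ in $C(\mathbb{R}^N\times(0,T])$ satisfying the equation, the boundary condition at infinity, and the initial condition above.
   Formalization: A(D) is taken as (-1)^l times the sum of a_α ∂^α, so that A(D)e^{ixξ}=A(ξ)e^{ixξ}; with D_j=∂/∂x_j literally the formula fails for odd l (e.g. A(D)=Δ). The initial condition u(x,0)=φ(x) is stated for almost every x, as φ is an L_2 class. *)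

(* Defs.v *)
From HB Require Import structures.
From mathcomp Require Import all_boot all_order all_algebra.
From mathcomp Require Import all_classical all_reals all_analysis.
From mathcomp Require Import complex.

Set Implicit Arguments.
Unset Strict Implicit.
Unset Printing Implicit Defensive.

Import Order.TTheory GRing.Theory Num.Theory.
Import numFieldNormedType.Exports.

Local Open Scope classical_set_scope.
Local Open Scope ring_scope.

Section Defs.
Context {R : realType}.

Definition cre (z : R[i]) : R := complex.Re z.
Definition cim (z : R[i]) : R := complex.Im z.
Definition rc (x : R) : R[i] := real_complex R x.
Definition cmod (z : R[i]) : R := Num.sqrt (cre z ^+ 2 + cim z ^+ 2).
Definition cexpi (th : R) : R[i] := Complex (cos th) (sin th).

Definition dotp (N : nat) (x y : N.-tuple R) : R :=
  \sum_(i < N) tnth x i * tnth y i.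
Definition enorm (N : nat) (x : N.-tuple R) : R := Num.sqrt (dotp x x).
Definition edist (N : nat) (x y : N.-tuple R) : R :=
  enorm [tuple tnth x i - tnth y i | i < N].
Definition zero_pt (N : nat) : N.-tuple R := [tuple (0 : R) | i < N].

(* Integral over R^N of a nonnegative function, computed as the iterated
   one-dimensional Lebesgue integral (equal to the N-dimensional Lebesgue
   integral for Borel functions, by Tonelli). *)
Definition upd (x : nat -> R) (k : nat) (y : R) : nat -> R :=
  fun i => if i == k then y else x i.
Fixpoint iter_int (k : nat) (g : (nat -> R) -> \bar R) (x : nat -> R)
  : \bar R :=
  match k with
  | 0 => g x
  | k'.+1 => (\int[@lebesgue_measure R]_y iter_int k' g (upd x k' y))%E
  end.
Definition nnintN (N : nat) (f : N.-tuple R -> \bar R) : \bar R :=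
  iter_int N (fun x => f [tuple x i | i < N]) (fun _ => 0).

(* Borel measurability of complex functions on R^N (product sigma-algebra). *)
Definition cmeasurable (N : nat) (f : N.-tuple R -> R[i]) : Prop :=
  measurable_fun setT (fun x => cre (f x)) /\
  measurable_fun setT (fun x => cim (f x)).

Definition rintN (N : nat) (f : N.-tuple R -> R) : R :=
  fine (nnintN (fun x => (Num.max (f x) 0)%:E)) -
  fine (nnintN (fun x => (Num.max (- f x) 0)%:E)).
Definition cintN (N : nat) (f : N.-tuple R -> R[i]) : R[i] :=
  Complex (rintN (fun x => cre (f x))) (rintN (fun x => cim (f x))).

Definition L2 (N : nat) (f : N.-tuple R -> R[i]) : Prop :=
  cmeasurable f /\ (nnintN (fun x => (cmod (f x) ^+ 2)%:E) < +oo)%E.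

Definition ae_eqN (N : nat) (f g : N.-tuple R -> R[i]) : Prop :=
  nnintN (fun x => (\1_[set y | f y != g y] x)%:E) = 0%E.

Definition ball_ind (N : nat) (r : R) (x : N.-tuple R) : R :=
  if enorm x < r then 1 else 0.

Definition trunc_FT (N : nat) (f : N.-tuple R -> R[i]) (r : R)
  (xi : N.-tuple R) : R[i] :=
  rc ((2 * pi) ^- N) *
  cintN (fun x => rc (ball_ind r x) * f x * cexpi (- dotp x xi)).

(* g is (a measurable representative of) the Fourier transform of f in the
   L_2 (Plancherel) sense: the L_2-limit of the transforms of the
   truncations f 1_{|x|<r} as r -> +oo. *)
Definition is_L2_fourier (N : nat) (f g : N.-tuple R -> R[i]) : Prop :=
  cmeasurable g /\
  ((fun r : R => nnintN (fun xi => (cmod (trunc_FT f r xi - g xi) ^+ 2)%:E))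
     r @[r --> +oo] --> 0%E).

Definition sobolev_L2 (N : nat) (a : R) (f : N.-tuple R -> R[i]) : Prop :=
  L2 f /\ exists g, is_L2_fourier f g /\
    (nnintN (fun xi => ((1 + enorm xi ^+ 2) `^ a * cmod (g xi) ^+ 2)%:E)
      < +oo)%E.

Definition Gamma (s : R) : R :=
  \int[@lebesgue_measure R]_(x in `]0, +oo[%classic) (x `^ (s - 1) * expR (- x)).

Definition mittag_leffler (rho z : R) : R :=
  limn (series (fun k : nat => z ^+ k / Gamma (rho * k%:R + 1))).

Definition caputo_exists (rho : R) (h : R -> R) (t : R) : Prop :=
  (forall s, 0 < s < t -> derivable h s 1) /\
  (@lebesgue_measure R).-integrable `]0, t[%classic
     (fun s => (derive1 h s * (t - s) `^ (- rho))%:E).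
Definition caputo (rho : R) (h : R -> R) (t : R) : R :=
  (Gamma (1 - rho))^-1 *
  \int[@lebesgue_measure R]_(s in `]0, t[%classic) (derive1 h s * (t - s) `^ (- rho)).
Definition ccaputo_exists (rho : R) (h : R -> R[i]) (t : R) : Prop :=
  caputo_exists rho (fun s => cre (h s)) t /\
  caputo_exists rho (fun s => cim (h s)) t.
Definition ccaputo (rho : R) (h : R -> R[i]) (t : R) : R[i] :=
  Complex (caputo rho (fun s => cre (h s)) t) (caputo rho (fun s => cim (h s)) t).

Definition shift (N : nat) (x : N.-tuple R) (j : 'I_N) (s : R) : N.-tuple R :=
  [tuple tnth x i + (if i == j then s else 0) | i < N].
Definition pderivable (N : nat) (j : 'I_N) (f : N.-tuple R -> R[i])
  (x : N.-tuple R) : Prop :=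
  derivable (fun s => cre (f (shift x j s))) 0 1 /\
  derivable (fun s => cim (f (shift x j s))) 0 1.
Definition pderiv (N : nat) (j : 'I_N) (f : N.-tuple R -> R[i])
  (x : N.-tuple R) : R[i] :=
  Complex (derive1 (fun s => cre (f (shift x j s))) 0)
  (derive1 (fun s => cim (f (shift x j s))) 0).

Fixpoint pd_seq (N : nat) (s : seq 'I_N) (f : N.-tuple R -> R[i])
  : N.-tuple R -> R[i] :=
  match s with
  | [::] => f
  | j :: s' => pderiv j (pd_seq s' f)
  end.
Fixpoint pd_seq_ok (N : nat) (s : seq 'I_N) (f : N.-tuple R -> R[i]) : Prop :=
  match s with
  | [::] => True
  | j :: s' => pd_seq_ok s' f /\ forall x, pderivable j (pd_seq s' f) x
  end.

Definition mi_order (N : nat) (alpha : 'I_N -> nat) : nat :=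
  (\sum_(j < N) alpha j)%N.
Definition dirs (N : nat) (alpha : 'I_N -> nat) : seq 'I_N :=
  flatten [seq nseq (alpha j) j | j <- enum 'I_N].
Definition Dalpha (N : nat) (alpha : 'I_N -> nat) (f : N.-tuple R -> R[i]) :=
  pd_seq (dirs alpha) f.
Definition Dalpha_exists (N : nat) (alpha : 'I_N -> nat)
  (f : N.-tuple R -> R[i]) : Prop :=
  pd_seq_ok (dirs alpha) f.

(* Coefficients a_alpha, |alpha| = m; multi-indices of order m have all
   entries <= m, so they are indexed by {ffun 'I_N -> 'I_m.+1}. *)
Definition symbol (N m : nat) (a : {ffun 'I_N -> 'I_m.+1} -> R)
  (xi : N.-tuple R) : R :=
  \sum_(alpha : {ffun 'I_N -> 'I_m.+1} | mi_order (fun j => nat_of_ord (alpha j)) == m)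
     a alpha * \prod_(j < N) tnth xi j ^+ alpha j.

(* A(D) u, with the sign convention making A(D) e^{ix xi} = A(xi) e^{ix xi}: A(D) = (-1)^l \sum_{|alpha|=2l} a_alpha d^alpha. *)
Definition AD (N l : nat) (a : {ffun 'I_N -> 'I_(2 * l).+1} -> R)
  (f : N.-tuple R -> R[i]) (x : N.-tuple R) : R[i] :=
  rc ((-1) ^+ l) *
  \sum_(alpha : {ffun 'I_N -> 'I_(2 * l).+1} | mi_order (fun j => nat_of_ord (alpha j)) == (2 * l)%N)
     rc (a alpha) * Dalpha (fun j => nat_of_ord (alpha j)) f x.

Definition cont_strip (N : nat) (T : R) (F : N.-tuple R -> R -> R[i]) : Prop :=
  forall x t, 0 < t <= T -> forall e, 0 < e ->
    exists2 d, 0 < d & forall y s, 0 < s <= T ->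
      edist y x < d -> `|s - t| < d -> cmod (F y s - F x t) < e.

(* (classical) solution of the forward problem
     D_t^rho u + A(D) u = 0            (x in R^N, 0 < t <= T)
     lim_{|x|->oo} D^alpha u(x,t) = 0  (|alpha| <= l-1, 0 < t <= T)
     u(x,0) = phi(x)                   (a.e. x in R^N, phi being in L_2) *)
Definition classical_solution (N l : nat) (a : {ffun 'I_N -> 'I_(2 * l).+1} -> R)
  (rho T : R) (phi : N.-tuple R -> R[i]) (u : N.-tuple R -> R -> R[i]) : Prop :=
  [/\
      (forall t, 0 < t <= T -> forall alpha : {ffun 'I_N -> 'I_(2 * l).+1},
         mi_order (fun j => nat_of_ord (alpha j)) = (2 * l)%N ->
         Dalpha_exists (fun j => nat_of_ord (alpha j)) (fun y => u y t)),
      (forall x t, 0 < t <= T -> ccaputo_exists rho (u x) t) /\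
      cont_strip T (fun x t => ccaputo rho (u x) t) /\
      cont_strip T (fun x t => AD a (fun y => u y t) x),
      (forall x t, 0 < t <= T ->
         ccaputo rho (u x) t + AD a (fun y => u y t) x = 0),
      (forall (alpha : 'I_N -> nat), (mi_order alpha <= l.-1)%N ->
         forall t, 0 < t <= T ->
           Dalpha_exists alpha (fun y => u y t) /\
           forall e, 0 < e -> exists M, forall x, M < enorm x ->
             cmod (Dalpha alpha (fun y => u y t) x) < e) &
      ae_eqN (fun x => u x 0) phi].

Definition U_trunc (N l : nat) (a : {ffun 'I_N -> 'I_(2 * l).+1} -> R)
  (rho : R) (phihat : N.-tuple R -> R[i]) (r : R) (x : N.-tuple R) (t : R)
  : R[i] :=
  cintN (fun xi => rc (ball_ind r xi *
                    mittag_leffler rho (- symbol a xi * t `^ rho)) *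
                   phihat xi * cexpi (dotp x xi)).

End Defs.

(* Main.v *)
Require Import Defs.
From HB Require Import structures.
From mathcomp Require Import all_boot all_order all_algebra.
From mathcomp Require Import all_classical all_reals all_analysis.
From mathcomp Require Import measurable_realfun complex ring lra.
Set Implicit Arguments.
Unset Strict Implicit.
Unset Printing Implicit Defensive.
Import Order.TTheory GRing.Theory Num.Theory.
Import numFieldNormedType.Exports.
Local Open Scope classical_set_scope.
Local Open Scope ring_scope.

(** Write [A] for the symbol and [E_rho] for the Mittag-Leffler function. The candidate is
    [u(x, t) = \int E_rho(- A(xi) t^rho) phihat(xi) e^{i x xi} dxi].

    For [lam >= 0] put [y(t) = E_rho(- lam t^rho)] and [w(t) = t^{rho-1} E_{rho,rho}(- lam t^rho)],
    so that [y' = - lam w]. Term by term convolution with the kernels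
    [k_a(t) = t^{a-1} / Gamma(a)] gives [w = k_rho - lam k_rho * w], [y = k_{1-rho} * w] and
    [y = 1 - lam k_rho * y]. Log-convexity of [k_rho] forces [w >= 0]: at a first zero the Volterra
    equation for [w] would be violated. Hence [0 <= y <= 1], [lam t^rho y <= Gamma(1 + rho)] and
    [lam t w <= rho]. These bounds justify differentiating [u] under the integral, in [x] up to
    order [2l] (as [|xi|^{2l} <= C A(xi)] by ellipticity) and in [t > 0]; Fubini and
    [y = k_{1-rho} * w] then identify the Caputo derivative with [- A(D) u].

    [phihat] is integrable because [2 tau > N] makes [(1 + |xi|^2)^{- tau}] integrable. Decay at
    infinity is the Riemann-Lebesgue lemma. For the initial condition, [phihat] is tested against the
    transform of a box damped by [e^{- eps |xi_j|}]; the multiplication formula turns this into the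
    Poisson smoothing of the box tested against [phi], and [eps --> 0] shows that [u(., 0)] and
    [phi] have the same integral over every box. *)

(** * The Gamma function and the Riemann-Liouville kernels *)

(** [phihat] is given only as an L2 limit of transforms of truncations, so inversion must pair that
    limit with a function that is both integrable and square integrable and has an explicit
    transform. The transform of a box fails, decaying only like 1/|xi_j|. Damping repairs this, and
    on the space side it yields differences of arctangents with an integrable majorant uniform in
    the damping. The alternating series of E_rho(- lam t^rho) shows neither sign nor decay, hence
    the detour through Volterra equations: once w >= 0, all bounds follow by comparing convolution
    integrands. The bounds on lam t^rho y and lam t w do not depend on lam. This is why
    integrability of [phihat], without any weight, carries derivatives of order 2l and the Caputo
    derivative. The resulting bound rho / t on lam w is not integrable at t = 0, so absolute
    convergence of the double integral for the Caputo derivative comes from integrating in time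
    first. [nnintN] is an iterated integral of functions, while limit theorems and Fubini need a
    measure; one that represents it is built on tuples. *)

Section LebesgueChangeOfVariables.
Context {R : realType}.
Local Notation mu := (@lebesgue_measure R).

(** Uniqueness of Lebesgue measure: the pushforward has the right value on half-open intervals.
    Scaling below is treated in the same way. *)
Lemma lebesgue_measure_addr (c : R) (A : set R) : measurable A ->
  pushforward mu ((fun x => x + c) : measurableTypeR R -> measurableTypeR R) A = mu A.
Proof.
move=> mA; have mp : measurable_fun setT ((fun x => x + c) : measurableTypeR R -> measurableTypeR R).
  exact: measurable_funD.
apply/esym/(@lebesgue_measure_unique R (pushforward mu _)) => //= _ [[a b]] _ <-.
rewrite /pushforward.
rewrite (_ : _ @^-1` _ = `]a - c, b - c]%classic); last first.
  by apply/seteqP; split=> x /=; rewrite !in_itv/= ltrBlDr lerBrDr.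
rewrite !lebesgue_measure_itv/= !lte_fin ltrD2r; case: ifP => // _.
by rewrite -!EFinB opprB addrA subrK.
Qed.

Lemma ge0_integral_addr (c : R) (f : R -> \bar R) :
  measurable_fun setT f -> (forall x, 0 <= f x)%E ->
  (\int[mu]_x f (x + c)%R = \int[mu]_x f x)%E.
Proof.
move=> mf f0.
have mp : measurable_fun setT ((fun x => x + c) : measurableTypeR R -> measurableTypeR R).
  exact: measurable_funD.
rewrite -[LHS](ge0_integral_pushforward mp mu measurableT mf)//.
by apply: eq_measure_integral => A mA _; exact: lebesgue_measure_addr.
Qed.

Lemma ge0_integral_opp (f : R -> \bar R) :
  measurable_fun setT f -> (forall x, 0 <= f x)%E ->
  (\int[mu]_x f (- x)%R = \int[mu]_x f x)%E.
Proof.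
move=> mf f0.
have mp : measurable_fun setT (-%R : measurableTypeR R -> measurableTypeR R).
  exact: measurable_funN.
rewrite -[LHS](ge0_integral_pushforward mp mu measurableT mf)//.
by apply: eq_measure_integral => A mA _; exact: lebesgue_measureN.
Qed.

Lemma lebesgue_measure_scale (c : R) (A : set R) : 0 < c -> measurable A ->
  (c%:E * pushforward mu ((fun x => c * x)%R : measurableTypeR R -> measurableTypeR R) A = mu A)%E.
Proof.
move=> c0 mA; have mp : measurable_fun setT ((fun x => c * x) : measurableTypeR R -> measurableTypeR R).
  exact: measurable_funM.
pose c' := NngNum (ltW c0).
apply/esym/(@lebesgue_measure_unique R (mscale c' (pushforward mu _))) => //= _ [[a b]] _ <-.
rewrite /mscale/= /pushforward.
rewrite (_ : _ @^-1` _ = `]a / c, b / c]%classic); last first.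
  by apply/seteqP; split=> x /=; rewrite !in_itv/= ltr_pdivrMr// ler_pdivlMr// (mulrC c).
rewrite !lebesgue_measure_itv/= !lte_fin ltr_pM2r ?invr_gt0//; case: ifP => _; last by rewrite mule0.
rewrite -!EFinB -EFinM -mulrBl; congr _%:E; field.
by rewrite gt_eqF.
Qed.

Lemma ge0_integral_scale (c : R) (f : R -> \bar R) : 0 < c ->
  measurable_fun setT f -> (forall x, 0 <= f x)%E ->
  (\int[mu]_x f (c * x)%R = c^-1%:E * \int[mu]_x f x)%E.
Proof.
move=> c0 mf f0.
have mp : measurable_fun setT ((fun x => c * x) : measurableTypeR R -> measurableTypeR R).
  exact: measurable_funM.
pose c' := NngNum (ltW c0).
rewrite -[LHS](ge0_integral_pushforward mp mu measurableT mf)//.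
transitivity (c^-1%:E * (c%:E * \int[pushforward mu ((fun x => c * x)%R : measurableTypeR R -> measurableTypeR R)]_x f x))%E.
  by rewrite muleA -EFinM mulVf ?gt_eqF// mul1e.
congr (_ * _)%E; rewrite -[LHS](ge0_integral_mscale _ _ c')//.
by apply: eq_measure_integral => A mA _; exact: lebesgue_measure_scale.
Qed.

End LebesgueChangeOfVariables.

Section FTC.
Context {R : realType}.
Local Notation mu := (@lebesgue_measure R).

Lemma FTC2_is_derive (f F : R -> R) (a b : R) : a < b ->
  (forall x, a <= x <= b -> {for x, continuous f}) ->
  (forall x, a <= x <= b -> is_derive x 1 F (f x)) ->
  (\int[mu]_(x in `[a, b]) (f x)%:E = (F b - F a)%:E)%E.
Proof.
move=> ab cf dF.
have cF x : a <= x <= b -> {for x, continuous F}.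
  move=> xab; have [dFx _] := dF _ xab.
  exact/differentiable_continuous/derivable1_diffP.
rewrite EFinB; apply: continuous_FTC2 => //.
- apply: continuous_in_subspaceT => x /[!inE]/=; rewrite in_itv/=.
  exact: cf.
- split.
  + by move=> x; rewrite in_itv/= => /andP[ax xb]; have [] := dF x; rewrite ?ltW.
  + by apply: cvg_at_right_filter; apply: cF; rewrite lexx ltW.
  + by apply: cvg_at_left_filter; apply: cF; rewrite lexx ltW.
- move=> x; rewrite in_itv/= => /andP[ax xb]; rewrite derive1E.
  by apply: derive_val; apply: dF; rewrite !ltW.
Qed.

Lemma ge0_FTC2y_is_derive (f F : R -> R) (a l : R) :
  (forall x, a <= x -> 0 <= f x) ->
  (forall x, a <= x -> {for x, continuous f}) ->
  (forall x, a <= x -> is_derive x 1 F (f x)) ->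
  F x @[x --> +oo] --> l ->
  (\int[mu]_(x in `[a, +oo[) (f x)%:E = (l - F a)%:E)%E.
Proof.
move=> f0 cf dF Fl.
have cF x : a <= x -> {for x, continuous F}.
  move=> xab; have [dFx _] := dF _ xab.
  exact/differentiable_continuous/derivable1_diffP.
rewrite EFinB; apply: ge0_continuous_FTC2y => //.
- apply: continuous_in_subspaceT => x /[!inE]/=; rewrite in_itv/= andbT.
  exact: cf.
- by move=> x ax; have [] := dF x (ltW ax).
- by apply: cvg_at_right_filter; apply: cF.
- move=> x; rewrite in_itv/= andbT => ax; rewrite derive1E.
  by apply: derive_val; apply: dF; exact: ltW.
Qed.

End FTC.

Section GammaFunction.
Context {R : realType}.
Local Notation mu := (@lebesgue_measure R).

Lemma le0_ler_powR (p x y : R) : p <= 0 -> 0 < x -> x <= y -> y `^ p <= x `^ p.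
Proof.
move=> p0 x0 xy; have y0 := lt_le_trans x0 xy.
rewrite -[p]opprK powRN [leRHS]powRN lef_pV2 ?posrE ?powR_gt0//.
by rewrite ge0_ler_powR ?nnegrE ?oppr_ge0// ltW.
Qed.

Lemma continuous_powR (a x : R) : 0 < x -> {for x, continuous (fun y => y `^ a)}.
Proof.
move=> x0; apply/differentiable_continuous/derivable1_diffP.
by have [] := is_derive1_powR a x0.
Qed.

Lemma integral_powR_itv (s d : R) : 0 < s -> 0 < d -> d < 1 ->
  (\int[mu]_(x in `[d, 1%R]) (x `^ (s - 1))%:E = (s^-1 - s^-1 * d `^ s)%:E)%E.
Proof.
move=> s0 d0 d1; rewrite [LHS](@FTC2_is_derive _ _ (fun x => s^-1 * x `^ s))//.
- by rewrite powR1 mulr1.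
- by move=> x /andP[nx _]; apply: continuous_powR; rewrite (lt_le_trans _ nx).
- move=> x /andP[nx _].
  have x0 : 0 < x by rewrite (lt_le_trans _ nx).
  have h := @is_derive1_powR R s _ x0.
  apply: is_derive_eq; rewrite -[_ *: _]/(_ * _) mulrA mulVf ?mul1r//.
  by rewrite gt_eqF.
Qed.

Lemma integral_powR_near0 (s : R) : 0 < s ->
  (\int[mu]_(x in `]0%R, 1%R]) (x `^ (s - 1))%:E <= s^-1%:E)%E.
Proof.
move=> s0.
(* Exhausts the interval away from the singularity at 0; starting at 1/2 keeps the left end strictly
   below 1, as [integral_powR_itv] requires. *)
pose F (n : nat) : set (measurableTypeR R) := `[n.+2%:R^-1, 1]%classic.
have F01 : `]0%R, 1%R]%classic = \bigcup_n F n.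
  apply/seteqP; split=> x /=; rewrite in_itv/=.
    move=> /andP[x0 x1].
    have [n nx] : exists n : nat, x^-1 <= n%:R.
      by exists (Num.truncn x^-1).+1; apply/ltW/truncnS_gt.
    exists n => //; rewrite /F/= in_itv/= x1 andbT invf_ple ?posrE//.
    by rewrite (le_trans nx)// ler_nat -addn2 leq_addr.
  move=> [n _]; rewrite /F/= in_itv/= => /andP[nx ->]; rewrite andbT.
  by rewrite (lt_le_trans _ nx)// invr_gt0.
rewrite F01.
have mF i : measurable (F i) by exact: measurable_itv.
have mpow i : measurable_fun (F i) (fun x : R => (x `^ (s - 1))%:E).
  apply/measurable_EFinP; apply: measurable_funTS; exact: measurable_powR.
have ndF : {homo F : n m / (n <= m)%N >-> (n <= m)%O}.
  move=> n m nm; apply/subsetPset => x; rewrite /F/= !in_itv/= => /andP[nx ->].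
  by rewrite andbT (le_trans _ nx)// lef_pV2 ?posrE// ler_nat.
have pow0 i x : F i x -> (0 <= (x `^ (s - 1))%:E)%E.
  by move=> _; rewrite lee_fin powR_ge0.
have c := @ge0_nondecreasing_set_cvg_integral _ _ _ F _ mu ndF mF mpow pow0.
rewrite -(cvg_lim _ c)//; apply: lime_le; first by apply/cvg_ex; eexists; exact: c.
apply: nearW => n /=.
rewrite integral_powR_itv ?invr_gt0 ?invf_lt1 ?ltr1n// lee_fin gerBl mulr_ge0 ?powR_ge0//.
by rewrite invr_ge0 ltW.
Qed.

(* The kernel of the Riemann-Liouville integral, up to the factor [Gamma s]. *)
Definition ppow (s x : R) : R := if 0 < x then x `^ (s - 1) else 0.

Lemma ppow_ge0 s x : 0 <= ppow s x.
Proof. by rewrite /ppow; case: ifP => // _; exact: powR_ge0. Qed.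

Lemma ppow_gt0 s x : 0 < x -> ppow s x = x `^ (s - 1).
Proof. by rewrite /ppow => ->. Qed.

Lemma ppow_le0 s x : x <= 0 -> ppow s x = 0.
Proof. by rewrite /ppow leNgt => /negbTE ->. Qed.

Lemma measurable_ppow s : measurable_fun setT (ppow s).
Proof.
apply: measurable_fun_ifT => //; exact: measurable_fun_ltr.
Qed.

Definition GammaE (s : R) : \bar R := (\int[mu]_x (ppow s x * expR (- x))%:E)%E.

Lemma measurable_expRN : measurable_fun setT (fun x : R => expR (- x)).
Proof. by apply: measurableT_comp => //; exact: measurable_funN. Qed.

Lemma GammaE_itv s : GammaE s = (\int[mu]_(x in `]0%R, +oo[) (x `^ (s - 1) * expR (- x))%:E)%E.
Proof.
rewrite [RHS]integral_mkcond; apply: eq_integral => x _; rewrite patchE mem_setE in_itv/= andbT /ppow.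
by case: ifP => //; rewrite mul0r.
Qed.

Lemma Gamma_fine (s : R) : Gamma s = fine (GammaE s).
Proof. by rewrite GammaE_itv. Qed.

(** The inequality 1 + u <= e^u at u = x / (2p), raised to the power p. *)
Lemma powR_le_expR (p x : R) : 0 < p -> 0 <= x -> x `^ p <= (2 * p) `^ p * expR (x / 2).
Proof.
move=> p0 x0.
have -> : x `^ p = (2 * p) `^ p * (x / (2 * p)) `^ p.
  rewrite -powRM ?mulr_ge0 ?invr_ge0 ?mulr_ge0 ?(ltW p0)//; congr (_ `^ _); field.
  by rewrite gt_eqF.
rewrite ler_wpM2l ?powR_ge0//.
have -> : x / 2 = (x / (2 * p)) * p by field; rewrite gt_eqF.
rewrite expRM ge0_ler_powR ?nnegrE ?(ltW p0) ?expR_ge0//.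
  by rewrite divr_ge0// mulr_ge0// ltW.
by rewrite (le_trans _ (expR_ge1Dx _))// lerDr.
Qed.

Lemma cvg_expRN_pinfty (c : R) : 0 < c -> expR (- (c * x)) @[x --> +oo] --> (0 : R).
Proof.
move=> c0; apply: (@cvg_comp _ _ _ (fun x : R => c * x) (fun x => expR (- x)) _ +oo).
  by apply: (gt0_cvgMry c0); exact: cvg_id.
exact: cvgr_expR.
Qed.

Lemma integral_expRN (c M : R) : 0 < c ->
  (\int[mu]_(x in `[M, +oo[) (expR (- (c * x)))%:E = (c^-1 * expR (- (c * M)))%:E)%E.
Proof.
move=> c0.
have d (x : R) : is_derive x (1 : R) (fun x : R => - c^-1 * expR (- (c * x))) (expR (- (c * x))).
  apply: is_derive_eq; rewrite -![_ *: _]/(_ * _); field.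
  by rewrite gt_eqF.
rewrite [LHS](@ge0_FTC2y_is_derive _ _ (fun x => - c^-1 * expR (- (c * x))) _ 0)//.
- by rewrite sub0r mulNr opprK.
- move=> x _; apply: continuous_comp; last exact: continuous_expR.
  by apply: continuousN; apply: continuousM; [exact: cvg_cst|exact: cvg_id].
- rewrite -[X in _ --> X](mulr0 (- c^-1)).
  by apply: cvgM; [exact: cvg_cst|exact: cvg_expRN_pinfty].
Qed.

Lemma GammaE_ge0 s : (0 <= GammaE s)%E.
Proof. by apply: integral_ge0 => x _; rewrite lee_fin mulr_ge0 ?ppow_ge0 ?expR_ge0. Qed.

Lemma GammaE_lty s : 0 < s -> (GammaE s < +oo)%E.
Proof.
move=> s0; rewrite GammaE_itv (@itv_bndbnd_setU _ _ _ (BRight 1)) ?bnd_simp//.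
have mf : measurable_fun setT (fun x : R => (x `^ (s - 1) * expR (- x))%:E).
  apply/measurable_EFinP/measurable_funM; first exact: measurable_powR.
  exact: measurable_expRN.
rewrite ge0_integral_setU//=; [|exact: measurable_funTS|..]; last 2 first.
  by move=> x _; rewrite lee_fin mulr_ge0 ?powR_ge0 ?expR_ge0.
  by rewrite disj_set2E; apply/eqP/seteqP; split=> x //= -[]; rewrite !in_itv/= => /andP[_ x1] /andP[]; rewrite ltNge x1.
apply: lte_add_pinfty.
  apply: (@le_lt_trans _ _ (s^-1)%:E); last exact: ltry.
  apply: le_trans (integral_powR_near0 s0); apply: ge0_le_integral => //.
  - by move=> x _; rewrite lee_fin mulr_ge0 ?powR_ge0 ?expR_ge0.
  - exact: measurable_funTS.
  - by apply/measurable_EFinP; apply: measurable_funTS; exact: measurable_powR.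
  - move=> x /=; rewrite in_itv/= => /andP[x0 _]; rewrite lee_fin ler_piMr ?powR_ge0//.
    by rewrite -expR0 ler_expR oppr_le0 ltW.
(* For x >= 1 the power x^(s-1) is at most x^p, which half of the exponential absorbs. *)
pose p := s + 1; have p0 : 0 < p by rewrite addr_gt0.
apply: (@le_lt_trans _ _ (\int[mu]_(x in `[0%R, +oo[) ((2 * p) `^ p * expR (- (2^-1 * x)))%:E)%E); last first.
  under eq_integral do rewrite EFinM.
  rewrite ge0_integralZl//; last 2 first.
    by apply/measurable_EFinP; apply: measurable_funTS; apply: measurableT_comp => //; apply: measurable_funN; exact: measurable_funM.
    by rewrite lee_fin powR_ge0.
  by rewrite integral_expRN// -EFinM ltry.
have mg : measurable_fun setT (fun x : R => ((2 * p) `^ p * expR (- (2^-1 * x)))%:E).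
  apply/measurable_EFinP; apply: measurable_funM => //.
  by apply: measurableT_comp => //; apply: measurable_funN; exact: measurable_funM.
have g0 x : (0 <= ((2 * p) `^ p * expR (- (2^-1 * x)))%:E)%E.
  by rewrite lee_fin mulr_ge0 ?powR_ge0 ?expR_ge0.
apply: (@le_trans _ _ (\int[mu]_(x in `]1%R, +oo[) ((2 * p) `^ p * expR (- (2^-1 * x)))%:E)%E).
  apply: ge0_le_integral => //.
  - by move=> x _; rewrite lee_fin mulr_ge0 ?powR_ge0 ?expR_ge0.
  - exact: measurable_funTS.
  - exact: measurable_funTS.
  - move=> x /=; rewrite in_itv/= andbT => x1; rewrite lee_fin.
    have x0 : 0 <= x by rewrite (le_trans ler01)// ltW.
    have -> : expR (- (2^-1 * x)) = expR (x / 2) * expR (- x).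
      by rewrite -expRD; congr expR; field.
    rewrite mulrA ler_wpM2r ?expR_ge0// (le_trans _ (powR_le_expR p0 x0))//.
    by rewrite ler_powR ?ltW// /p; lra.
apply: ge0_subset_integral => //; first exact: measurable_funTS.
by apply: subset_itvr; rewrite bnd_simp.
Qed.

Lemma GammaE_Gamma s : 0 < s -> GammaE s = (Gamma s)%:E.
Proof. by move=> s0; rewrite Gamma_fine fineK// ge0_fin_numE ?GammaE_ge0// GammaE_lty. Qed.

(* Keeping only the part of the integral over [M, M + 1]. As M is arbitrary,
   this makes the Mittag-Leffler series converge everywhere. *)
Lemma Gamma_lower_bound (s M : R) : 0 < s -> 0 < M ->
  M `^ s * (expR (- (M + 1)) / (M + 1)) <= Gamma s.
Proof.
move=> s0 M0; have M1 : 0 < M + 1 by rewrite addr_gt0.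
rewrite -lee_fin -GammaE_Gamma// GammaE_itv; set c := (_ * _ : R).
have c0 : 0 <= c by rewrite mulr_ge0 ?powR_ge0// divr_ge0 ?expR_ge0// ltW.
have mf : measurable_fun setT (fun x : R => (x `^ (s - 1) * expR (- x))%:E).
  apply/measurable_EFinP/measurable_funM; first exact: measurable_powR.
  exact: measurable_expRN.
apply: (@le_trans _ _ (\int[mu]_(x in `[M, (M + 1)%R]) (x `^ (s - 1) * expR (- x))%:E)%E).
  have <- : (\int[mu]_(x in `[M, (M + 1)%R]) c%:E = c%:E)%E.
    have m1 : mu (`[M, M + 1]%classic : set R) = 1%E.
      by rewrite lebesgue_measure_itv/= lte_fin ltrDl ltr01 -EFinB addrC addKr.
    by rewrite integral_cst//= [X in (_ * X)%E]m1 mule1.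
  apply: ge0_le_integral => //.
  - exact: measurable_funTS.
  - move=> x /=; rewrite in_itv/= => /andP[Mx xM]; rewrite lee_fin.
    have x0 : 0 < x by rewrite (lt_le_trans M0).
    have -> : x `^ (s - 1) = x `^ s / x by rewrite powRB ?(gt_eqF x0) ?implybT// powRr1// (ltW x0).
    rewrite /c mulrCA mulrC ler_pM ?expR_ge0 ?ler_expR ?lerN2 ?divr_ge0 ?powR_ge0 ?(ltW M1)//.
    rewrite ler_pM ?invr_ge0 ?powR_ge0 ?(ltW M1)//.
      by rewrite ge0_ler_powR ?nnegrE ?(ltW s0) ?(ltW M0) ?(ltW x0).
    by rewrite lef_pV2 ?posrE.
apply: ge0_subset_integral => //; first exact: measurable_funTS.
  by move=> x _; rewrite lee_fin mulr_ge0 ?powR_ge0 ?expR_ge0.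
by apply: subset_itv; rewrite bnd_simp.
Qed.

Lemma Gamma_gt0 (s : R) : 0 < s -> 0 < Gamma s.
Proof.
move=> s0; apply: lt_le_trans (Gamma_lower_bound s0 ltr01).
by rewrite mulr_gt0 ?powR_gt0// divr_gt0 ?expR_gt0.
Qed.

Lemma Gamma1 : Gamma 1 = 1 :> R.
Proof.
rewrite Gamma_fine GammaE_itv.
have -> : (\int[mu]_(x in `]0%R, +oo[) (x `^ (1 - 1) * expR (- x))%:E =
    \int[mu]_(x in `]0%R, +oo[) (expR (- (1 * x)))%:E)%E.
  by apply: eq_integral => x _; rewrite subrr powRr0 !mul1r.
rewrite integral_itv_obnd_cbnd; last first.
  by apply/measurable_EFinP; apply: measurable_funTS; apply: measurableT_comp => //; apply: measurable_funN; exact: measurable_funM.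
by rewrite integral_expRN// mulr0 oppr0 expR0 mulr1 invr1.
Qed.

End GammaFunction.

Section BetaIntegral.
Context {R : realType}.
Local Notation mu := (@lebesgue_measure R).

Let conv (a b t : R) : \bar R := (\int[mu]_x (ppow a x * ppow b (t - x))%:E)%E.

Let measurable_conv2 a b : measurable_fun setT
  (fun z : measurableTypeR R * measurableTypeR R => (ppow a z.1 * ppow b (z.2 - z.1))%:E).
Proof.
apply/measurable_EFinP; apply: measurable_funM.
  by apply: measurableT_comp; [exact: measurable_ppow|exact: measurable_fst].
apply: measurableT_comp; first exact: measurable_ppow.
by apply: measurable_funB; [exact: measurable_snd|exact: measurable_fst].
Qed.

Let conv_scale a b t : 0 < t -> conv a b t = ((t `^ (a + b - 1))%:E * conv a b 1)%E.
Proof.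
move=> t0; have mf : measurable_fun setT (fun x : R => (ppow a x * ppow b (t - x))%:E).
  apply/measurable_EFinP; apply: measurable_funM; first exact: measurable_ppow.
  by apply: measurableT_comp; [exact: measurable_ppow|exact: measurable_funB].
have f0 x : (0 <= (ppow a x * ppow b (t - x))%:E)%E by rewrite lee_fin mulr_ge0 ?ppow_ge0.
have -> : conv a b t = (t%:E * \int[mu]_x (ppow a (t * x) * ppow b (t - t * x))%:E)%E.
  rewrite (ge0_integral_scale (f := fun x => (ppow a x * ppow b (t - x))%:E) t0)//.
  by rewrite muleA -EFinM mulfV ?mul1e// gt_eqF.
rewrite /conv.
have -> : (\int[mu]_x (ppow a (t * x) * ppow b (t - t * x))%:E =
    \int[mu]_x ((t `^ (a - 1) * t `^ (b - 1))%:E * (ppow a x * ppow b (1 - x))%:E))%E.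
  apply: eq_integral => x _; rewrite -EFinM; congr _%:E.
  have -> : t - t * x = t * (1 - x) by ring.
  rewrite /ppow !pmulr_rgt0//; case: ifPn => [x0|_]; last by rewrite !mul0r mulr0.
  case: ifPn => [x1|_]; last by rewrite !mulr0.
  by rewrite !powRM ?ltW//; ring.
rewrite ge0_integralZl//; last 3 first.
  apply/measurable_EFinP; apply: measurable_funM; first exact: measurable_ppow.
  by apply: measurableT_comp; [exact: measurable_ppow|exact: measurable_funB].
  by move=> x _; rewrite lee_fin mulr_ge0 ?ppow_ge0.
  by rewrite lee_fin mulr_ge0 ?powR_ge0.
rewrite muleA -EFinM; congr (_%:E * _)%E.
rewrite -[X in X * _]powRr1 ?(ltW t0)// -!powRD ?(gt_eqF t0) ?implybT//.
by congr (_ `^ _); ring.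
Qed.

(** Tonelli after a translation: the product is the integral of e^(-y) against the convolution of
    the two powers at y, which by homogeneity is [conv a b 1] times [ppow (a + b) y]. *)
Let GammaM a b : 0 < a -> 0 < b -> (GammaE a * GammaE b = conv a b 1 * GammaE (a + b))%E.
Proof.
move=> a0 b0.
have mg s : measurable_fun setT (fun x : R => (ppow s x * expR (- x))%:E).
  by apply/measurable_EFinP; apply: measurable_funM; [exact: measurable_ppow|exact: measurable_expRN].
have g0 s x : (0 <= (ppow s x * expR (- x))%:E :> \bar R)%E.
  by rewrite lee_fin mulr_ge0 ?ppow_ge0 ?expR_ge0.
have -> : (GammaE a * GammaE b = \int[mu]_x \int[mu]_y
    ((ppow a x * ppow b (y - x))%:E * (expR (- y))%:E))%E.
  rewrite {1}/GammaE -ge0_integralZr//; [|exact: mg|exact: GammaE_ge0].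
  apply: eq_integral => x _.
  rewrite /GammaE -(ge0_integral_addr (- x))//.
  rewrite -ge0_integralZl//; last first.
    apply: measurableT_comp (mg b) _; exact: measurable_funD.
  apply: eq_integral => y _; rewrite -!EFinM; congr _%:E.
  have -> : expR (- y) = expR (- x) * expR (- (y - x)) by rewrite -expRD; congr expR; ring.
  by ring.
rewrite (@fubini_tonelli _ _ _ _ _ mu mu (fun z : measurableTypeR R * measurableTypeR R =>
  ((ppow a z.1 * ppow b (z.2 - z.1))%:E * (expR (- z.2))%:E))%E); last 2 first.
  apply: emeasurable_funM; first exact: measurable_conv2.
  by apply/measurable_EFinP; apply: (measurableT_comp measurable_expRN); exact: measurable_snd.
  by move=> x /=; rewrite lee_fin !mulr_ge0 ?ppow_ge0 ?expR_ge0.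
rewrite /GammaE -ge0_integralZl//; [|exact: mg|]; last first.
  by apply: integral_ge0 => x _; rewrite lee_fin mulr_ge0 ?ppow_ge0.
apply: eq_integral => y _ /=.
rewrite ge0_integralZr//; last 2 first.
  apply/measurable_EFinP; apply: measurable_funM; first exact: measurable_ppow.
  by apply: measurableT_comp; [exact: measurable_ppow|exact: measurable_funB].
  by move=> x _; rewrite lee_fin mulr_ge0 ?ppow_ge0.
rewrite -/(conv a b y); have [y0|y0] := ltP 0 y.
  by rewrite conv_scale// ppow_gt0// EFinM muleA (muleC (conv a b 1)).
have e : ppow (a + b) y = 0 by exact: ppow_le0.
rewrite e mul0r [RHS]mule0.
rewrite [conv a b y](_ : _ = 0%E) ?mul0e//; apply: integral0_eq => x _.
have [x0|x0] := ltP 0 x; last by rewrite (ppow_le0 _ x0) mul0r.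
by rewrite [ppow b _]ppow_le0 ?mulr0// subr_le0 (le_trans y0)// ltW.
Qed.

Local Opaque Gamma.

(** The kernel k_a. Its extension by 0 to t <= 0 turns every convolution over (0, t) into an
    integral over the whole line, so that domains of integration never change. *)
Definition rlk (a t : R) : R := ppow a t / Gamma a.

Lemma rlk_ge0 a t : 0 < a -> 0 <= rlk a t.
Proof. by move=> a0; rewrite divr_ge0 ?ppow_ge0// ltW// Gamma_gt0. Qed.

Lemma measurable_rlk a : measurable_fun setT (rlk a).
Proof. by apply: measurable_funM => //; exact: measurable_ppow. Qed.

Lemma rlk_gt0 a t : 0 < t -> rlk a t = t `^ (a - 1) / Gamma a.
Proof. by move=> t0; rewrite /rlk ppow_gt0. Qed.

Lemma rlk_le0 a t : t <= 0 -> rlk a t = 0.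
Proof. by move=> t0; rewrite /rlk ppow_le0// mul0r. Qed.

(** The semigroup law of fractional integration. Homogeneity reduces it to t = 1, where it is the
    Beta integral expressed through Gamma. *)
Lemma rlk_conv a b t : 0 < a -> 0 < b -> 0 < t ->
  (\int[mu]_x (rlk a x * rlk b (t - x))%:E = (rlk (a + b) t)%:E)%E.
Proof.
move=> a0 b0 t0; have ga := Gamma_gt0 a0; have gb := Gamma_gt0 b0.
have gab := Gamma_gt0 (addr_gt0 a0 b0); have gagb := mulr_gt0 ga gb.
have c1 : conv a b 1 = (Gamma a * Gamma b / Gamma (a + b))%:E.
  have := GammaM a0 b0; rewrite !GammaE_Gamma ?addr_gt0//.
  case: (conv a b 1) => [r| |].
  - rewrite -!EFinM => -[] ->; congr _%:E; field.
    by rewrite gt_eqF.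
  - by rewrite gt0_mulye.
  - by rewrite gt0_mulNye.
have -> : (\int[mu]_x (rlk a x * rlk b (t - x))%:E =
    \int[mu]_x (((Gamma a * Gamma b)^-1)%:E * (ppow a x * ppow b (t - x))%:E))%E.
  apply: eq_integral => x _; rewrite -EFinM; congr _%:E; rewrite /rlk.
  move: (Gamma a) (Gamma b) ga gb => u v u0 v0.
  by rewrite mulrACA -invfM mulrC.
rewrite ge0_integralZl//; last 3 first.
  apply/measurable_EFinP; apply: measurable_funM; first exact: measurable_ppow.
  by apply: measurableT_comp; [exact: measurable_ppow|exact: measurable_funB].
  by move=> x _; rewrite lee_fin mulr_ge0 ?ppow_ge0.
  by rewrite lee_fin invr_ge0 (ltW gagb).
rewrite -/(conv a b t) (conv_scale _ _ t0) c1 -!EFinM (rlk_gt0 _ t0); congr _%:E.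
move: (Gamma a) (Gamma b) (Gamma (a + b)) ga gb gab => u v w u0 v0 w0.
by field; rewrite !gt_eqF.
Qed.

Lemma integrable_rlk_conv a b t : 0 < a -> 0 < b -> 0 < t ->
  mu.-integrable setT (fun x => (rlk a x * rlk b (t - x))%:E).
Proof.
move=> a0 b0 t0; apply/integrableP; split.
  apply/measurable_EFinP; apply: measurable_funM; first exact: measurable_rlk.
  by apply: measurableT_comp; [exact: measurable_rlk|exact: measurable_funB].
rewrite [ltLHS](_ : _ = (rlk (a + b) t)%:E); first exact: ltry.
rewrite -(rlk_conv a0 b0 t0); apply: eq_integral => x _.
by rewrite gee0_abs// lee_fin; apply: mulr_ge0; exact: rlk_ge0.
Qed.

End BetaIntegral.

Section GammaRecurrence.
Context {R : realType}.
Local Notation mu := (@lebesgue_measure R).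

Lemma integral_powR01 (s : R) : 0 < s ->
  (\int[mu]_(x in `]0%R, 1%R]) (x `^ (s - 1))%:E = s^-1%:E)%E.
Proof.
move=> s0; apply/eqP; rewrite eq_le integral_powR_near0//=.
have mf : measurable_fun setT (fun x : R => (x `^ (s - 1))%:E).
  by apply/measurable_EFinP; exact: measurable_powR.
have i0 : (0 <= \int[mu]_(x in `]0%R, 1%R]) (x `^ (s - 1))%:E)%E.
  by apply: integral_ge0 => x _; rewrite lee_fin powR_ge0.
apply/lee_addgt0Pr => e e0; have [se|se] := leP 1 (s * e).
  apply: (@le_trans _ _ e%:E); last by rewrite leeDr.
  by rewrite lee_fin -div1r ler_pdivrMr// mulrC.
have se0 : 0 < s * e by rewrite mulr_gt0.
(* With d^s = s e, cutting the interval at [d] loses exactly e. *)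
pose d := (s * e) `^ s^-1; have d0 : 0 < d by rewrite powR_gt0.
have ds : d `^ s = s * e by rewrite /d -powRrM mulVf ?gt_eqF// powRr1// ltW.
have d1 : d < 1.
  have := @gt0_ltr_powR R s^-1; rewrite invr_gt0 => /(_ s0 (s * e) 1).
  by rewrite powR1; apply => //; rewrite nnegrE ltW.
apply: (@le_trans _ _ (\int[mu]_(x in `[d, 1%R]) (x `^ (s - 1))%:E + e%:E)%E).
  rewrite integral_powR_itv// ds mulrA mulVf ?gt_eqF// mul1r -EFinD.
  by rewrite subrK.
rewrite leeD2r//; apply: ge0_subset_integral => //; first exact: measurable_funTS.
  by move=> x _; rewrite lee_fin powR_ge0.
by apply: subset_itvr; rewrite bnd_simp.
Qed.

(** Read off from k_s * k_1 = k_{s+1} at t = 1, in place of an integration by parts. *)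
Lemma GammaS (s : R) : 0 < s -> Gamma (s + 1) = s * Gamma s.
Proof.
move=> s0; have := rlk_conv s0 ltr01 ltr01.
have gs := Gamma_gt0 s0; have gs1 := Gamma_gt0 (addr_gt0 s0 ltr01).
rewrite [RHS](_ : _ = (Gamma (s + 1))^-1%:E); last first.
  by rewrite rlk_gt0// powR1 mul1r.
rewrite [X in X = _ -> _](_ : _ =
    \int[mu]_(x in `]0%R, 1%R[) ((Gamma s)^-1%:E * (x `^ (s - 1))%:E))%E; last first.
  rewrite [RHS]integral_mkcond; apply: eq_integral => x _.
  rewrite patchE mem_setE in_itv/=; have [x0|x0] := ltP 0 x; last by rewrite rlk_le0// mul0r.
  have [x1|x1] := ltP x 1; last by rewrite [rlk 1 _]rlk_le0 ?mulr0// subr_le0.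
  by rewrite !rlk_gt0 ?subr_gt0// subrr powRr0 Gamma1 divr1 mulr1 mulrC EFinM.
have mf : measurable_fun setT (fun x : R => (x `^ (s - 1))%:E).
  by apply/measurable_EFinP; exact: measurable_powR.
rewrite ge0_integralZl//; last 3 first.
  exact: measurable_funTS.
  by move=> x _; rewrite lee_fin powR_ge0.
  by rewrite lee_fin invr_ge0 (ltW gs).
rewrite integral_itv_bndo_bndc; last exact: measurable_funTS.
rewrite (integral_powR01 s0) -EFinM => -[]; move: (Gamma _) (Gamma _) gs gs1 => u v u0 v0 uv.
by rewrite -[u]invrK -uv -invfM invrK mulrC.
Qed.

End GammaRecurrence.

(** * Mittag-Leffler functions *)

Section EntireSeries.
Context {R : realType}.

(** Infinite radius of convergence, stated through Cauchy bounds because these pass to the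
    differentiated series at once: doubling r absorbs the factor k + 1 <= 2^(k+1). *)
Definition entire_coef (c : R^nat) :=
  forall r : R, 0 < r -> exists C, forall k, `|c k| * r ^+ k <= C.

Lemma entire_pseries_norm_cvg (c : R^nat) (z : R) : entire_coef c ->
  cvgn (series (fun k => `|c k * z ^+ k|)).
Proof.
move=> ec; pose r := 2 * (`|z| + 1); have z1 : 0 < `|z| + 1 by rewrite ltr_wpDl.
have [|C hC] := ec r; first by rewrite mulr_gt0.
have C0 : 0 <= C by rewrite (le_trans _ (hC 0%N))// expr0 mulr1.
apply: (@series_le_cvg _ _ (geometric C 2^-1)).
- by move=> n; exact: normr_ge0.
- by move=> n; rewrite /= mulr_ge0// exprn_ge0// invr_ge0.
- move=> n; rewrite /geometric/= normrM normrX.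
  apply: (@le_trans _ _ (`|c n| * (r / 2) ^+ n)).
    rewrite ler_wpM2l// lerXn2r ?nnegrE//.
      by rewrite divr_ge0 ?mulr_ge0 ?ltW.
    by rewrite /r (mulrC 2) mulfK// lerDl.
  by rewrite exprMn mulrA ler_wpM2r// exprn_ge0// invr_ge0.
- by apply: is_cvg_geometric_series; rewrite ger0_norm ?invr_ge0// invf_lt1 ?ltr1n.
Qed.

Lemma entire_pseries_cvg (c : R^nat) (z : R) : entire_coef c -> cvgn (pseries c z).
Proof. by move=> ec; apply: normed_cvg; exact: entire_pseries_norm_cvg. Qed.

Lemma entire_coef_diffs (c : R^nat) : entire_coef c -> entire_coef (pseries_diffs c).
Proof.
move=> ec r r0; have [|C hC] := ec (2 * r); first by rewrite mulr_gt0.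
exists (C / r) => k; rewrite ler_pdivlMr// -mulrA -exprSr.
apply: le_trans (hC k.+1); rewrite /pseries_diffs normrM exprMn normr_nat -mulrA mulrCA.
rewrite ler_wpM2l// ler_wpM2r ?exprn_ge0 ?(ltW r0)//.
by rewrite -natrX ler_nat ltnW// ltn_expl.
Qed.

Lemma continuous_entire (c : R^nat) : entire_coef c -> continuous (fun z => limn (pseries c z)).
Proof.
move=> ec z; apply/differentiable_continuous/derivable1_diffP.
have [] // := @pseries_snd_diffs R c (`|z| + 1) z.
- exact: entire_pseries_cvg.
- by apply: entire_pseries_cvg; exact: entire_coef_diffs.
- by apply: entire_pseries_cvg; do 2 apply: entire_coef_diffs.
- by rewrite [ltRHS]ger0_norm ?addr_ge0// ltrDl.
Qed.

End EntireSeries.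

Section MittagLefflerSeries.
Context {R : realType}.
Variable rho : R.
Hypothesis rho_gt0 : 0 < rho.
Local Notation mu := (@lebesgue_measure R).
Implicit Types b c lam t z : R.

Definition ml_coef b (k : nat) : R := (Gamma (rho * k%:R + b))^-1.

(* The two-parameter Mittag-Leffler function E_{rho, b}. *)
Definition ml2 b z : R := limn (pseries (ml_coef b) z).

Lemma ml2_index_gt0 b (k : nat) : 0 < b -> 0 < rho * k%:R + b.
Proof. by move=> b0; rewrite ltr_wpDl// mulr_ge0// ltW. Qed.

Lemma ml_coef_ge0 b k : 0 < b -> 0 <= ml_coef b k.
Proof. by move=> b0; rewrite invr_ge0 ltW// Gamma_gt0// ml2_index_gt0. Qed.

Lemma entire_ml_coef b : 0 < b -> entire_coef (ml_coef b).
Proof.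
(* With M^rho = r, the lower bound on Gamma (rho k + b) becomes r^k M^b d. *)
move=> b0 r r0; pose M := r `^ rho^-1; have M0 : 0 < M by rewrite powR_gt0.
pose d := expR (- (M + 1)) / (M + 1).
have d0 : 0 < d by rewrite divr_gt0 ?expR_gt0// addr_gt0.
exists (M `^ b * d)^-1 => k; rewrite ger0_norm ?ml_coef_ge0//.
have kb := ml2_index_gt0 k b0.
have hG := Gamma_lower_bound kb M0; have G0 := Gamma_gt0 kb.
rewrite /ml_coef mulrC ler_pdivrMr// -ler_pdivrMl ?invr_gt0 ?(mulr_gt0 (powR_gt0 _ M0) d0)//.
rewrite invrK; apply: le_trans hG; rewrite -/d.
rewrite powRD ?(gt_eqF M0) ?implybT// powRrM.
have -> : M `^ rho = r by rewrite /M -powRrM mulVf ?gt_eqF// powRr1// ltW.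
rewrite powR_mulrn ?(ltW r0)//.
by have -> : M `^ b * d * r ^+ k = r ^+ k * M `^ b * d by ring.
Qed.

Lemma mittag_lefflerE z : mittag_leffler rho z = ml2 1 z.
Proof.
rewrite /mittag_leffler /ml2; congr (limn _); rewrite /pseries; congr series.
by apply/funext => k; rewrite /ml_coef mulrC.
Qed.

Lemma continuous_ml2 b : 0 < b -> continuous (ml2 b).
Proof. by move=> b0; apply: continuous_entire; exact: entire_ml_coef. Qed.

Lemma measurable_ml2 b : 0 < b -> measurable_fun setT (ml2 b).
Proof. by move=> b0; apply: continuous_measurable_fun; exact: continuous_ml2. Qed.

(* [mlf 1 lam] is t |-> E_rho(- lam t^rho), and [mlf rho lam] is the function w
   with [(mlf 1 lam)' = - lam w]. *)
Definition mlf b lam t : R := ppow b t * ml2 b (- lam * t `^ rho).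

(** Each term is a multiple of a kernel k_{rho k + b}, the form on which convolution acts through
    the semigroup law. *)
Definition mlf_term b lam t (k : nat) : R := (- lam) ^+ k * rlk (rho * k%:R + b) t.

Lemma mlf_termE b lam t k : 0 < b ->
  mlf_term b lam t k = ppow b t * (ml_coef b k * (- lam * t `^ rho) ^+ k).
Proof.
move=> b0; rewrite /mlf_term; have [t0|t0] := ltP 0 t; last first.
  by rewrite rlk_le0// ppow_le0// mulr0 mul0r.
rewrite rlk_gt0// ppow_gt0// /ml_coef exprMn -(powR_mulrn _ (powR_ge0 _ _)) -powRrM.
have -> : t `^ (rho * k%:R + b - 1) = t `^ (rho * k%:R) * t `^ (b - 1).
  by rewrite -addrA -powRD ?(gt_eqF t0) ?implybT.
by move: (Gamma _)^-1 => g; ring.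
Qed.

Lemma cvg_mlf b lam t : 0 < b -> series (mlf_term b lam t) @ \oo --> mlf b lam t.
Proof.
move=> b0; rewrite (_ : series _ = (fun n => ppow b t * pseries (ml_coef b) (- lam * t `^ rho) n)); last first.
  apply/funext => n; rewrite /pseries /series/= mulr_sumr; apply: eq_bigr => k _.
  exact: mlf_termE.
apply: cvgM; first exact: cvg_cst.
by apply: entire_pseries_cvg; exact: entire_ml_coef.
Qed.

(** Passing from lam to - |lam| turns the alternating series into its series of absolute values,
    which provides the dominating function below. *)
Lemma norm_mlf_term b lam t k : 0 < b -> `|mlf_term b lam t k| = mlf_term b (- `|lam|) t k.
Proof.
move=> b0; rewrite /mlf_term normrM normrX normrN opprK; congr (_ * _).
by rewrite ger0_norm// rlk_ge0// ml2_index_gt0.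
Qed.

Lemma mlf_term_ge0 b lam t k : 0 < b -> 0 <= mlf_term b (- `|lam|) t k.
Proof. by move=> b0; rewrite -norm_mlf_term. Qed.

Lemma mlf_partial_le b lam t n : 0 < b ->
  series (mlf_term b (- `|lam|) t) n <= mlf b (- `|lam|) t.
Proof.
move=> b0; have c := cvg_mlf (lam := - `|lam|) (t := t) b0.
rewrite -(cvg_lim _ c)//; apply: nondecreasing_cvgn_le; last by apply/cvg_ex; eexists; exact: c.
by apply: nondecreasing_series => k _ _; exact: mlf_term_ge0.
Qed.

Lemma measurable_mlf b lam : 0 < b -> measurable_fun setT (mlf b lam).
Proof.
move=> b0; apply: measurable_funM; first exact: measurable_ppow.
apply: measurableT_comp; first exact: measurable_ml2.
by apply: measurable_funM => //; exact: measurable_powR.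
Qed.

(* Splitting off the first term of the series. *)
Lemma mlf_shift b lam t : 0 < b -> mlf b lam t = rlk b t - lam * mlf (b + rho) lam t.
Proof.
move=> b0; have c := cvg_mlf (lam := lam) (t := t) b0.
have c' : series (mlf_term b lam t) n.+1 @[n --> \oo] --> rlk b t - lam * mlf (b + rho) lam t.
  rewrite (_ : (fun n => _) = (fun n => rlk b t + - lam * series (mlf_term (b + rho) lam t) n)).
    rewrite -mulNr; apply: cvgD; first exact: cvg_cst.
    by apply: cvgM; [exact: cvg_cst|apply: cvg_mlf; rewrite addr_gt0].
  apply/funext => n; rewrite /series/= big_nat_recl// mulr_sumr; congr (_ + _).
    by rewrite /mlf_term mulr0 add0r mul1r.
  apply: eq_bigr => k _; rewrite /mlf_term exprS -mulrA; congr (_ * (_ * rlk _ _)).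
  by rewrite -natr1; ring.
by rewrite -cvg_shiftS in c; exact: (cvg_unique _ c c').
Qed.

Let conv_partial b c lam t n : 0 < b -> 0 < c -> 0 < t ->
  (\int[mu]_s (series (mlf_term b (- `|lam|) s) n * rlk c (t - s))%:E =
    (series (mlf_term (b + c) (- `|lam|) t) n)%:E)%E.
Proof.
move=> b0 c0 t0.
have mr k : measurable_fun setT (fun s => (rlk (rho * k%:R + b) s * rlk c (t - s))%:E).
  apply/measurable_EFinP; apply: measurable_funM; first exact: measurable_rlk.
  by apply: measurableT_comp; [exact: measurable_rlk|exact: measurable_funB].
have -> : (\int[mu]_s (series (mlf_term b (- `|lam|) s) n * rlk c (t - s))%:E =
    \int[mu]_s \sum_(0 <= k < n) ((`|lam| ^+ k)%:E * (rlk (rho * k%:R + b) s * rlk c (t - s))%:E))%E.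
  apply: eq_integral => s _; rewrite /series/= mulr_suml -sumEFin; apply: eq_bigr => k _.
  by rewrite /mlf_term opprK -EFinM -mulrA.
rewrite ge0_integral_sum//; last 2 first.
  by move=> k; apply: emeasurable_funM => //; exact: mr.
  by move=> k s _; rewrite lee_fin mulr_ge0 ?exprn_ge0// mulr_ge0 ?rlk_ge0// ml2_index_gt0.
rewrite /series/= -sumEFin; apply: eq_bigr => k _.
rewrite ge0_integralZl//; last 2 first.
  exact: mr.
  by move=> s _; rewrite lee_fin mulr_ge0 ?rlk_ge0// ml2_index_gt0.
by rewrite (rlk_conv (ml2_index_gt0 k b0) c0 t0) -EFinM /mlf_term opprK addrA.
Qed.

(** Monotone convergence: the partial sums of the majorant convolve to partial sums for the index b
    + c, and these stay below their finite sum. *)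
Let integrable_conv_abs b c lam t : 0 < b -> 0 < c -> 0 < t ->
  mu.-integrable setT (fun s => (mlf b (- `|lam|) s * rlk c (t - s))%:E).
Proof.
move=> b0 c0 t0.
have mconv (u : R -> R) : measurable_fun setT u -> measurable_fun setT (fun s => (u s * rlk c (t - s))%:E).
  move=> mu_; apply/measurable_EFinP; apply: measurable_funM => //.
  by apply: measurableT_comp; [exact: measurable_rlk|exact: measurable_funB].
have mS n : measurable_fun setT (fun s => series (mlf_term b (- `|lam|) s) n).
  apply: measurable_sum => k; apply: measurable_funM => //; exact: measurable_rlk.
apply/integrableP; split; first by apply: mconv; exact: measurable_mlf.
pose g n s := (series (mlf_term b (- `|lam|) s) n * rlk c (t - s))%:E.
have nd s : {homo (fun n => series (mlf_term b (- `|lam|) s) n) : n m / (n <= m)%N >-> n <= m}.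
  by apply: nondecreasing_series => k _ _; exact: mlf_term_ge0.
have S0 n s : 0 <= series (mlf_term b (- `|lam|) s) n.
  by apply: sumr_ge0 => k _; exact: mlf_term_ge0.
have mct : (\int[mu]_s limn (g^~ s) = limn (fun n => \int[mu]_s g n s))%E.
  apply: monotone_convergence => //.
  - by move=> n; exact: mconv.
  - by move=> n s _; rewrite lee_fin mulr_ge0 ?rlk_ge0.
  - by move=> s _ n m nm; rewrite lee_fin ler_wpM2r ?rlk_ge0// nd.
move: mct; rewrite [X in X = _ -> _](_ : _ = (\int[mu]_s `|(mlf b (- `|lam|) s * rlk c (t - s))%:E|)%E); last first.
  apply: eq_integral => s _.
  rewrite gee0_abs; last first.
    by rewrite lee_fin mulr_ge0 ?rlk_ge0// (le_trans (S0 0%N s))// mlf_partial_le.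
  apply/cvg_lim => //; apply: cvg_EFin; first exact: nearW.
  by apply: cvgM; [exact: cvg_mlf|exact: cvg_cst].
move=> ->; apply: (@le_lt_trans _ _ (mlf (b + c) (- `|lam|) t)%:E); last exact: ltry.
have bc := addr_gt0 b0 c0.
apply: lime_le.
  apply: ereal_nondecreasing_is_cvgn => n m nm; apply: ge0_le_integral => //.
  - by move=> s _; rewrite lee_fin mulr_ge0 ?rlk_ge0.
  - exact: mconv.
  - exact: mconv.
  - by move=> s _; rewrite lee_fin ler_wpM2r ?rlk_ge0// nd.
by apply: nearW => n; rewrite conv_partial// lee_fin; exact: mlf_partial_le.
Qed.

(** The integrals of the partial sums converge to the left side by dominated convergence and to the
    right side by the semigroup law. *)
Lemma mlf_conv b c lam t : 0 < b -> 0 < c -> 0 < t ->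
  mu.-integrable setT (fun s => (mlf b lam s * rlk c (t - s))%:E) /\
  (\int[mu]_s (mlf b lam s * rlk c (t - s))%:E = (mlf (b + c) lam t)%:E)%E.
Proof.
move=> b0 c0 t0.
have mconv (u : R -> R) : measurable_fun setT u -> measurable_fun setT (fun s => (u s * rlk c (t - s))%:E).
  move=> mu_; apply/measurable_EFinP; apply: measurable_funM => //.
  by apply: measurableT_comp; [exact: measurable_rlk|exact: measurable_funB].
have mS n : measurable_fun setT (fun s => series (mlf_term b lam s) n).
  apply: measurable_sum => k; apply: measurable_funM => //; exact: measurable_rlk.
have ig := integrable_conv_abs lam b0 c0 t0.
have [] := @dominated_convergence _ _ _ mu _ measurableT
  (fun n s => (series (mlf_term b lam s) n * rlk c (t - s))%:E)
  (fun s => (mlf b lam s * rlk c (t - s))%:E) _ (fun n => mconv _ (mS n))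
  (mconv _ (measurable_mlf _ b0)) _ ig.
- apply: aeW => s _; apply: cvg_EFin; first exact: nearW.
  by apply: cvgM; [exact: cvg_mlf|exact: cvg_cst].
- apply: aeW => s n _; rewrite lee_fin normrM (ger0_norm (rlk_ge0 _ c0)).
  rewrite ler_wpM2r ?rlk_ge0// (le_trans _ (mlf_partial_le _ _ n b0))//.
  rewrite (le_trans (ler_norm_sum _ _ _))//.
  by rewrite le_eqVlt; apply/orP; left; apply/eqP/eq_bigr => k _; exact: norm_mlf_term.
move=> i1 _ c1; split => //.
have ik k : mu.-integrable setT (fun s => (mlf_term b lam s k * rlk c (t - s))%:E).
  apply: le_integrable ig => //.
    apply: mconv; apply: measurable_funM => //; exact: measurable_rlk.
  move=> s _ /=; rewrite lee_fin normrM [leRHS]normrM; apply: ler_wpM2r => //.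
  rewrite norm_mlf_term// [leRHS]ger0_norm; last by apply: le_trans (mlf_partial_le _ _ 0%N b0); rewrite /series/= big_nil.
  apply: le_trans (mlf_partial_le _ _ k.+1 b0); rewrite /series/= big_nat_recr//= lerDr.
  by apply: sumr_ge0 => j _; exact: mlf_term_ge0.
have c2 : (fun n => \int[mu]_s (series (mlf_term b lam s) n * rlk c (t - s))%:E)%E @ \oo --> (mlf (b + c) lam t)%:E.
  rewrite (_ : (fun n => _) = (fun n => (series (mlf_term (b + c) lam t) n)%:E)).
    by apply: cvg_EFin; [exact: nearW|apply: cvg_mlf; rewrite addr_gt0].
  apply/funext => n.
  rewrite (_ : (fun s => _) = (fun s => \sum_(0 <= k < n) (mlf_term b lam s k * rlk c (t - s))%:E)%E); last first.
    by apply/funext => s; rewrite /series/= mulr_suml sumEFin.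
  rewrite integral_sum//.
  rewrite /series/= -sumEFin; apply: eq_bigr => k _.
  have kb := ml2_index_gt0 k b0.
  rewrite (_ : (fun s => _) = (fun s => ((- lam) ^+ k)%:E * (rlk (rho * k%:R + b) s * rlk c (t - s))%:E)%E); last first.
    by apply/funext => s; rewrite -EFinM /mlf_term -mulrA.
  rewrite integralZl//; last exact: integrable_rlk_conv.
  by rewrite (rlk_conv kb c0 t0) -EFinM /mlf_term addrA.
exact: (cvg_unique _ c1 c2).
Qed.

End MittagLefflerSeries.

(** * Positivity of w from its Volterra equation *)

Lemma le_integral_lincomb d (T : measurableType d) (R : realType)
    (mu : {measure set T -> \bar R}) (f g h : T -> R) (a b F G H : R) :
  mu.-integrable setT (fun x => (f x)%:E) -> mu.-integrable setT (fun x => (g x)%:E) ->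
  mu.-integrable setT (fun x => (h x)%:E) ->
  (\int[mu]_x (f x)%:E = F%:E)%E -> (\int[mu]_x (g x)%:E = G%:E)%E ->
  (\int[mu]_x (h x)%:E = H%:E)%E ->
  (forall x, f x <= a * g x + b * h x) -> F <= a * G + b * H.
Proof.
move=> if_ ig ih Fe Ge He fgh.
have iag : mu.-integrable setT (fun x => (a%:E * (g x)%:E)%E) by exact: integrableZl.
have ibh : mu.-integrable setT (fun x => (b%:E * (h x)%:E)%E) by exact: integrableZl.
rewrite -lee_fin -Fe EFinD !EFinM -Ge -He -!integralZl// -integralD//.
apply: le_integral => //; first exact: integrableD.
by move=> x _; rewrite -!EFinM -EFinD lee_fin; exact: fgh.
Qed.

Lemma powR_sub1_ge_half (R : realType) (p x : R) : 0 < p -> p < 1 -> 0 < x -> x <= 2 ->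
  2^-1 <= x `^ (p - 1).
Proof.
move=> p0 p1 x0 x2; rewrite -powR_inv1//; apply: (@le_trans _ _ (2 `^ (p - 1))).
  by apply: ler_powR; [rewrite ler1n|rewrite lerDr ltW].
by apply: le0_ler_powR => //; rewrite subr_le0 ltW.
Qed.

(** Here ws and cs are w and k_rho * w at a point ts, c0 is k_rho * w at the first zero, q is the
    ratio of the kernels at the two points and j the mass of the last window. Then q ks - lam c0 >=
    ws (q - lam j) > 0. *)
Lemma volterra_arith (R : realFieldType) (lam c0 cs ws ks j q : R) :
  ws = ks - lam * cs -> lam * c0 <= lam * (q * cs + ws * j) -> lam * j < 2^-1 -> 2^-1 <= q ->
  0 < ws -> 0 < q * ks - lam * c0.
Proof.
move=> wE h lj q2 ws0; have qj : 0 < ws * (q - lam * j) by rewrite mulr_gt0// subr_gt0 (lt_le_trans lj).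
apply: (lt_le_trans qj); rewrite lerBrDr; apply: (le_trans (lerD (lexx _) h)).
by rewrite wE le_eqVlt; apply/orP; left; apply/eqP; ring.
Qed.

Section MittagLefflerPositivity.
Context {R : realType}.
Variables rho lam : R.
Hypotheses (rho_gt0 : 0 < rho) (rho_lt1 : rho < 1) (lam_ge0 : 0 <= lam).
Local Notation mu := (@lebesgue_measure R).
Implicit Types b s t : R.

Lemma continuous_mlf b t : 0 < b -> 0 < t -> {for t, continuous (mlf rho b lam)}.
Proof.
move=> b0 t0.
have e : {near t, (fun x => x `^ (b - 1) * ml2 rho b (- lam * x `^ rho)) =1 mlf rho b lam}.
  near=> x; rewrite /mlf ppow_gt0//; near: x; exact: (cvgr_gt t cvg_id).
have ct : mlf rho b lam t = t `^ (b - 1) * ml2 rho b (- lam * t `^ rho) by rewrite /mlf ppow_gt0.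
rewrite /prop_for /continuous_at ct.
apply: cvg_trans (near_eq_cvg e) _.
apply: cvgM; first exact: continuous_powR.
apply: continuous_comp; last exact: continuous_ml2.
by apply: continuousM; [exact: cvg_cst|exact: continuous_powR].
Unshelve. all: by end_near. Qed.

Lemma ml2_0 b : ml2 rho b 0 = (Gamma b)^-1.
Proof.
apply/cvg_lim => //; rewrite -cvg_shiftS /=.
rewrite (_ : (fun n => _) = cst (Gamma b)^-1); first exact: cvg_cst.
apply/funext => n; rewrite /pseries /series/= big_nat_recl//= big1 ?addr0.
  by rewrite /ml_coef mulr0 add0r expr0 mulr1.
by move=> i _; rewrite exprS mul0r mulr0.
Qed.

(** As w is singular at 0, the infimum is taken in z = t^rho, where w becomes a positive power times
    the continuous function [V]; it is positive because V(0) = 1 / Gamma(rho) > 0. *)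
Let first_zero t1 : 0 < t1 -> mlf rho rho lam t1 < 0 ->
  exists2 t0, 0 < t0 & mlf rho rho lam t0 <= 0 /\
    forall s, 0 < s -> s < t0 -> 0 < mlf rho rho lam s.
Proof.
move=> t10 wt1; pose V z := ml2 rho rho (- lam * z).
have cV : continuous V.
  move=> z; apply: continuous_comp; last exact: continuous_ml2.
  by apply: continuousM; [exact: cvg_cst|exact: cvg_id].
have wV t : 0 < t -> mlf rho rho lam t = t `^ (rho - 1) * V (t `^ rho).
  by move=> t0; rewrite /mlf ppow_gt0.
pose Z := [set z | 0 <= z /\ V z <= 0].
have Z1 : Z (t1 `^ rho).
  split; first exact: powR_ge0.
  by move: wt1; rewrite wV// pmulr_rlt0 ?powR_gt0// => /ltW.
have hZ : has_inf Z by split; [exists (t1 `^ rho)|exists 0 => z []].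
pose z0 := inf Z.
have z00 : 0 <= z0 by apply: lb_le_inf; [exists (t1 `^ rho)|move=> z []].
have Vlt z : 0 <= z -> z < z0 -> 0 < V z.
  move=> zge0 zz; rewrite ltNge; apply/negP => Vz.
  by move: zz; rewrite ltNge => /negP; apply; apply: ge_inf; [case: hZ|split].
have Vz0 : V z0 <= 0.
  rewrite leNgt; apply/negP => V0.
  have /nbhs_ballP[e /= e0 he] : \forall z \near z0, 0 < V z by exact: (cvgr_gt _ (cV z0) 0 V0).
  have [z [zge0 Vz] zlt] := inf_adherent e0 hZ.
  have zge : z0 <= z by apply: ge_inf; [case: hZ|split].
  have := he z; rewrite /ball/= ler0_norm ?subr_le0// opprB ltrBlDl => /(_ zlt).
  by rewrite ltNge Vz.
have z0gt : 0 < z0.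
  rewrite lt_neqAle z00 andbT; apply/eqP => z0E; move: Vz0.
  rewrite -z0E /V mulr0 ml2_0 leNgt => /negP; apply; rewrite invr_gt0; exact: Gamma_gt0.
pose t0 := z0 `^ rho^-1; have t00 : 0 < t0 by rewrite powR_gt0.
have t0z : t0 `^ rho = z0 by rewrite /t0 -powRrM mulVf ?gt_eqF// powRr1// ltW.
exists t0; [exact: t00|split].
  by rewrite (wV _ t00) t0z pmulr_rle0 ?Vz0// powR_gt0.
move=> s s0 st; rewrite (wV _ s0) pmulr_rgt0 ?powR_gt0//; apply: Vlt; first exact: powR_ge0.
by rewrite -t0z gt0_ltr_powR ?nnegrE ?ltW.
Qed.

Lemma mlf_le0 b t : t <= 0 -> mlf rho b lam t = 0.
Proof. by move=> t0; rewrite /mlf ppow_le0// mul0r. Qed.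

(* Log-convexity of the kernel. *)
Let rlk_ratio s t t0 : 0 < s -> s < t -> t < t0 ->
  rlk rho (t0 - s) <= (t0 / t) `^ (rho - 1) * rlk rho (t - s).
Proof.
move=> s0 st tt0; have t_gt0 := lt_trans s0 st; have t0_gt0 := lt_trans t_gt0 tt0.
have st0 := lt_trans st tt0.
rewrite !rlk_gt0 ?subr_gt0// mulrA ler_pM2r ?invr_gt0 ?Gamma_gt0//.
rewrite -powRM ?divr_ge0 ?subr_ge0 ?(ltW t_gt0) ?(ltW t0_gt0) ?(ltW st)//.
apply: le0_ler_powR; first by rewrite subr_le0 ltW.
  by rewrite mulr_gt0 ?divr_gt0 ?subr_gt0.
rewrite mulrAC ler_pdivrMr// !mulrBl !mulrBr (mulrC t0 t) lerD2l lerN2.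
by rewrite mulrC ler_pM2r// ltW.
Qed.

(** The Volterra equation at the first zero t0 is compared with the one at a point ts just before
    it, where w is maximal near t0. The history before ts is at most q times what ts sees, by
    log-convexity; the history after ts has size at most w(ts) times a kernel mass below 1/2. This
    leaves w(t0) > 0. *)
Lemma mlf_rho_ge0 t : 0 < t -> 0 <= mlf rho rho lam t.
Proof.
move=> t1_gt0; rewrite leNgt; apply/negP => /(first_zero t1_gt0)[t0 t00 [wt0 wpos]] {t t1_gt0}.
pose w := mlf rho rho lam.
have gr := Gamma_gt0 rho_gt0; have gr1 := Gamma_gt0 (addr_gt0 ltr01 rho_gt0).
have [eta [eta0 etat etal]] : exists eta, [/\ 0 < eta, eta <= t0 / 2 &
    lam * rlk (1 + rho) eta < 2^-1].
  (* Makes lam k_{1+rho}(d) equal to lam / (4 (lam + 1)) < 1/2. The other constraint, eta <= t0 / 2,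
     ensures t0 <= 2 ta and hence q >= 1/2. *)
  pose d := (Gamma (1 + rho) / (4 * (lam + 1))) `^ rho^-1.
  have l1 : 0 < lam + 1 by rewrite ltr_wpDl.
  have d0 : 0 < d by rewrite powR_gt0// divr_gt0// mulr_gt0.
  exists (Num.min d (t0 / 2)).
  have m0 : 0 < Num.min d (t0 / 2) by rewrite lt_min d0 divr_gt0.
  split => //; first by rewrite ge_min lexx orbT.
  rewrite rlk_gt0// (_ : 1 + rho - 1 = rho); last by ring.
  have : Num.min d (t0 / 2) `^ rho <= d `^ rho.
    by rewrite ge0_ler_powR ?nnegrE ?(ltW rho_gt0) ?(ltW d0) ?(ltW m0)// ge_min lexx.
  rewrite /d -powRrM mulVf ?gt_eqF// powRr1; last by rewrite divr_ge0 ?mulr_ge0 ?ltW.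
  move: (Gamma (1 + rho)) gr1 (Num.min _ _ `^ _) => g g0 x hx.
  apply: (@le_lt_trans _ _ (lam * (g / (4 * (lam + 1)) / g))).
    by rewrite ler_wpM2l// ler_pM2r// invr_gt0.
  have -> : lam * (g / (4 * (lam + 1)) / g) = lam / (4 * (lam + 1)).
    by field; rewrite !gt_eqF.
  by rewrite ltr_pdivrMr ?mulr_gt0//; lra.
(* [rlk 1] vanishes at 0, so [tb] must lie strictly below [ta] for [rlk 1 (s - tb)] to be 1 on the
   whole of [ta, t0]. *)
pose tb := t0 - eta; pose ta := t0 - eta / 2.
have tb0 : 0 < tb by rewrite /tb; lra.
have tatb : tb < ta by rewrite /tb /ta; lra.
have tat0 : ta < t0 by rewrite /ta; lra.
have ta2 : t0 <= 2 * ta by rewrite /ta; lra.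
(* The maximum is positive since w(ta) > 0, so it is not attained at t0. *)
have [ts] : exists2 c, c \in `[ta, t0] & forall t, t \in `[ta, t0] -> w t <= w c.
  apply: EVT_max; first exact: ltW.
  apply: continuous_in_subspaceT => x /[!inE]/=; rewrite in_itv/= => /andP[tax _].
  by apply: continuous_mlf => //; rewrite (lt_le_trans _ tax)// (lt_trans tb0).
rewrite in_itv/= => /andP[tats tst0] wmax.
have wts : 0 < w ts.
  apply: (@lt_le_trans _ _ (w ta)); first by apply: wpos => //; exact: lt_trans tatb.
  by apply: wmax; rewrite in_itv/= lexx ltW.
have {}tst0 : ts < t0.
  by rewrite lt_neqAle tst0 andbT; apply: contraTneq wts => ->; rewrite -leNgt.
have ts0 : 0 < ts by rewrite (lt_le_trans _ tats)// (lt_trans tb0).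
pose q := (t0 / ts) `^ (rho - 1).
have rr := addr_gt0 rho_gt0 rho_gt0.
have [i0 e0] := mlf_conv rho_gt0 lam rho_gt0 rho_gt0 t00.
have [is_ es] := mlf_conv rho_gt0 lam rho_gt0 rho_gt0 ts0.
have J : (\int[mu]_s (rlk 1 (s - tb) * rlk rho (t0 - s))%:E = (rlk (1 + rho) eta)%:E)%E.
  rewrite -(rlk_conv ltr01 rho_gt0 eta0) -[RHS](ge0_integral_addr (- tb)).
  - by apply: eq_integral => s _; rewrite (_ : eta - (s - tb) = t0 - s)// /tb; ring.
  - apply/measurable_EFinP; apply: measurable_funM; first exact: measurable_rlk.
    by apply: measurableT_comp; [exact: measurable_rlk|exact: measurable_funB].
  - by move=> s; rewrite lee_fin mulr_ge0 ?rlk_ge0.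
(* Up to ts the first term suffices by [rlk_ratio]; between ts and t0 the second does, by maximality
   of w(ts). *)
have key s : w s * rlk rho (t0 - s) <=
    q * (w s * rlk rho (ts - s)) + w ts * (rlk 1 (s - tb) * rlk rho (t0 - s)).
  have q0 : 0 <= q by exact: powR_ge0.
  have K0 a x : 0 < a -> 0 <= rlk a x :> R by exact: rlk_ge0.
  have N0 x : 0 <= w ts * (rlk 1 (x - tb) * rlk rho (t0 - x)).
    by apply: (mulr_ge0 (ltW wts)); apply: mulr_ge0; exact: K0.
  have [s0|s0] := leP s 0.
    by rewrite {1 2}/w mlf_le0// !mul0r mulr0 add0r.
  have [st|st] := ltP s ts.
    apply: ler_wpDr; [exact: N0|rewrite [leRHS]mulrCA; apply: ler_wpM2l].
      exact: ltW (wpos _ s0 (lt_trans st tst0)).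
    exact: rlk_ratio.
  have [s1|s1] := leP t0 s.
    by rewrite !(@rlk_le0 _ rho) ?subr_le0// !mulr0 addr0.
  rewrite [rlk rho (ts - s)]rlk_le0 ?subr_le0// !mulr0 add0r [leRHS]mulrA ler_wpM2r ?rlk_ge0//.
  have stb : tb < s by rewrite (lt_le_trans _ st)// (lt_le_trans tatb).
  rewrite rlk_gt0 ?subr_gt0// subrr powRr0 Gamma1 divr1 mulr1.
  by apply: wmax; rewrite in_itv/= (le_trans tats st) ltW.
have iJ : mu.-integrable setT (fun s => (rlk 1 (s - tb) * rlk rho (t0 - s))%:E).
  apply/integrableP; split.
    apply/measurable_EFinP; apply: measurable_funM.
      by apply: measurableT_comp; [exact: measurable_rlk|exact: measurable_funB].
    by apply: measurableT_comp; [exact: measurable_rlk|exact: measurable_funB].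
  rewrite [ltLHS](_ : _ = (rlk (1 + rho) eta)%:E) ?ltry// -J; apply: eq_integral => s _.
  by rewrite gee0_abs// lee_fin; apply: mulr_ge0; exact: rlk_ge0.
have le0 : mlf rho (rho + rho) lam t0 <=
    q * mlf rho (rho + rho) lam ts + w ts * rlk (1 + rho) eta.
  exact: (le_integral_lincomb i0 is_ iJ e0 es J key).
have q2 : 2^-1 <= q.
  apply: powR_sub1_ge_half => //; first by rewrite divr_gt0.
  rewrite ler_pdivrMr//; by apply: le_trans ta2 _; exact: ler_wpM2l.
have k0q : rlk rho t0 = q * rlk rho ts.
  rewrite !rlk_gt0// /q mulrA -powRM ?divr_ge0 ?(ltW ts0) ?(ltW t00)//.
  by rewrite divfK// gt_eqF.
have wt0E := mlf_shift rho_gt0 lam t0 rho_gt0.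
have wtsE := mlf_shift rho_gt0 lam ts rho_gt0.
move: wt0; rewrite leNgt => /negP; apply; rewrite wt0E k0q.
by apply: (volterra_arith wtsE _ etal q2 wts); exact: ler_wpM2l.
Qed.

End MittagLefflerPositivity.

(** * Bounds on y and w, uniform in lam *)

Lemma le_integral_scale d (T : measurableType d) (R : realType)
    (mu : {measure set T -> \bar R}) (f g : T -> R) (a F G : R) :
  mu.-integrable setT (fun x => (f x)%:E) -> mu.-integrable setT (fun x => (g x)%:E) ->
  (\int[mu]_x (f x)%:E = F%:E)%E -> (\int[mu]_x (g x)%:E = G%:E)%E ->
  (forall x, a * g x <= f x) -> a * G <= F.
Proof.
move=> if_ ig Fe Ge gf; rewrite -lee_fin -Fe EFinM -Ge -integralZl//.
apply: le_integral => //; first exact: integrableZl.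
by move=> x _; rewrite -EFinM lee_fin; exact: gf.
Qed.

Section MittagLefflerBounds.
Context {R : realType}.
Variables rho lam : R.
Hypotheses (rho_gt0 : 0 < rho) (rho_lt1 : rho < 1) (lam_ge0 : 0 <= lam).
Local Notation mu := (@lebesgue_measure R).
Local Notation w := (mlf rho rho lam).
Local Notation y := (mlf rho 1 lam).
Implicit Types s t : R.

Lemma rlk1 t : 0 < t -> rlk 1 t = 1.
Proof. by move=> t0; rewrite rlk_gt0// subrr powRr0 Gamma1 divr1. Qed.

Lemma mlf1E t : 0 < t -> y t = mittag_leffler rho (- lam * t `^ rho).
Proof. by move=> t0; rewrite /mlf ppow_gt0// subrr powRr0 mul1r mittag_lefflerE. Qed.

Let w_ge0 s : 0 <= w s.
Proof. by have [s0|s0] := leP s 0; [rewrite mlf_le0|exact: mlf_rho_ge0]. Qed.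

Lemma integral_mlf_rho_caputo t : 0 < t ->
  mu.-integrable setT (fun s => (w s * rlk (1 - rho) (t - s))%:E) /\
  (\int[mu]_s (w s * rlk (1 - rho) (t - s))%:E = (y t)%:E)%E.
Proof.
move=> t0; have r1 : 0 < 1 - rho by rewrite subr_gt0.
have [i e] := mlf_conv rho_gt0 lam rho_gt0 r1 t0; split; first exact: i.
have e1 : rho + (1 - rho) = 1 by ring.
by rewrite e1 in e; exact: e.
Qed.

Lemma mlf1_ge0 t : 0 <= y t.
Proof.
have [t0|t0] := leP t 0; first by rewrite mlf_le0.
have [_ e] := integral_mlf_rho_caputo t0; rewrite -lee_fin -e.
apply: integral_ge0 => s _; rewrite lee_fin; apply: mulr_ge0; first exact: w_ge0.
by apply: rlk_ge0; rewrite subr_gt0.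
Qed.

(** The integral of w over (0, t) is written against the kernel k_1, so that monotonicity of y in t
    is a comparison of integrands. *)
Let mlf1_integral t : 0 < t -> exists W,
  [/\ mu.-integrable setT (fun s => (w s * rlk 1 (t - s))%:E),
      (\int[mu]_s (w s * rlk 1 (t - s))%:E = W%:E)%E & y t = 1 - lam * W].
Proof.
move=> t0; have [i e] := mlf_conv rho_gt0 lam rho_gt0 ltr01 t0.
exists (mlf rho (rho + 1) lam t); split; [exact: i|exact: e|].
have := mlf_shift rho_gt0 lam t ltr01; rewrite (rlk1 t0) (addrC 1 rho); exact.
Qed.

Lemma mlf1_le1 t : y t <= 1.
Proof.
have [t0|t0] := leP t 0; first by rewrite mlf_le0.
have [W [_ e ->]] := mlf1_integral t0; rewrite gerBl; apply: mulr_ge0 => //.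
rewrite -lee_fin -e; apply: integral_ge0 => s _; rewrite lee_fin.
by apply: mulr_ge0; [exact: w_ge0|apply: rlk_ge0].
Qed.

Lemma mlf1_nonincreasing s t : 0 < s -> s <= t -> y t <= y s.
Proof.
move=> s0 st; have t0 := lt_le_trans s0 st.
have [V [iV eV ->]] := mlf1_integral s0; have [W [iW eW ->]] := mlf1_integral t0.
rewrite lerD2l lerN2; apply: ler_wpM2l => //; rewrite -[V]mul1r.
apply: (le_integral_scale iW iV eW eV) => x; rewrite mul1r; apply: ler_wpM2l; first exact: w_ge0.
have [xs|xs] := ltP x s; last by rewrite rlk_le0 ?subr_le0//; apply: rlk_ge0.
by rewrite !rlk1 ?subr_gt0// (lt_le_trans xs).
Qed.

(* Since y is nonincreasing, 1 - y = lam k_rho * y >= lam y(t) t^rho / Gamma(1 + rho). *)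
Lemma mlf1_decay t : 0 < t -> lam * t `^ rho * y t <= Gamma (1 + rho).
Proof.
move=> t0; have g0 := Gamma_gt0 (addr_gt0 ltr01 rho_gt0).
have [i e] := mlf_conv rho_gt0 lam ltr01 rho_gt0 t0.
have hy := mlf_shift rho_gt0 lam t ltr01; rewrite (rlk1 t0) in hy.
have h : y t * rlk (1 + rho) t <= mlf rho (1 + rho) lam t.
  apply: (le_integral_scale i (integrable_rlk_conv ltr01 rho_gt0 t0) e (rlk_conv ltr01 rho_gt0 t0)) => s.
  rewrite mulrA; have [s0|s0] := leP s 0.
    by rewrite (rlk_le0 _ s0) (mlf_le0 _ _ _ s0) mulr0 !mul0r.
  have [st|st] := leP t s; first by rewrite [rlk rho _]rlk_le0 ?subr_le0// !mulr0.
  rewrite (rlk1 s0) mulr1; apply: ler_wpM2r; first exact: rlk_ge0.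
  exact: mlf1_nonincreasing (ltW st).
have yt0 := mlf1_ge0 t.
have : lam * (y t * rlk (1 + rho) t) <= 1.
  by apply: le_trans (ler_wpM2l lam_ge0 h) _; move: yt0; rewrite hy subr_ge0.
rewrite (rlk_gt0 _ t0) (_ : 1 + rho - 1 = rho); last by ring.
move: (y t) (Gamma _) g0 => z g g0.
by rewrite !mulrA ler_pdivrMr// mul1r mulrAC.
Qed.

(* The kernel is nonincreasing, so k_rho * w >= k_rho(t) (1 * w), and lam (1 * w) = 1 - y. *)
Let mlf_rho_le t : 0 < t -> w t <= rlk rho t * y t.
Proof.
move=> t0; have [W [iW eW yE]] := mlf1_integral t0.
have [i e] := mlf_conv rho_gt0 lam rho_gt0 rho_gt0 t0.
have hw := mlf_shift rho_gt0 lam t rho_gt0.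
have h : rlk rho t * W <= mlf rho (rho + rho) lam t.
  apply: (le_integral_scale i iW e eW) => s; have [s0|s0] := leP s 0.
    by rewrite (mlf_le0 _ _ _ s0) !mul0r mulr0.
  rewrite mulrCA; apply: ler_wpM2l; first exact: w_ge0.
  have [st|st] := leP t s; first by rewrite !(@rlk_le0 _ _ (t - s)) ?subr_le0// mulr0.
  rewrite rlk1 ?subr_gt0// mulr1.
  rewrite !rlk_gt0 ?subr_gt0//; apply: ler_wpM2r; first by rewrite invr_ge0 ltW// Gamma_gt0.
  apply: le0_ler_powR; rewrite ?subr_le0 ?subr_gt0// ?ltW//.
  by rewrite gtrBl.
rewrite hw yE mulrBr mulr1 lerD2l lerN2 mulrCA; exact: ler_wpM2l.
Qed.

(** Combines w <= k_rho y with the decay of y; the constant is Gamma(1 + rho) / Gamma(rho) = rho. *)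
Lemma mlf_rho_bound t : 0 < t -> t * (lam * w t) <= rho.
Proof.
move=> t0; have g0 := Gamma_gt0 rho_gt0; have g1 := Gamma_gt0 (addr_gt0 ltr01 rho_gt0).
have h1 := mlf_rho_le t0; have h2 := mlf1_decay t0.
have gE : Gamma (1 + rho) = rho * Gamma rho by rewrite addrC GammaS.
rewrite gE in h2; rewrite (rlk_gt0 _ t0) in h1.
have tE : t * t `^ (rho - 1) = t `^ rho by rewrite mulr_powRB1// ltW.
move: (w t) (y t) (Gamma rho) g0 h1 h2 => W Y g g0 h1 h2.
apply: (@le_trans _ _ (t * (lam * (t `^ (rho - 1) / g * Y)))).
  by apply: ler_wpM2l; [exact: ltW|exact: ler_wpM2l].
have -> : t * (lam * (t `^ (rho - 1) / g * Y)) = lam * (t * t `^ (rho - 1)) * Y / g by ring.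
by rewrite tE ler_pdivrMr.
Qed.

(** By the functional equation, (k + 1) / Gamma(rho (k + 1) + 1) = 1 / (rho Gamma(rho k + rho)), so
    the differentiated series is that of E_{rho,rho} divided by rho; the chain rule returns the
    factor rho. *)
Lemma is_derive_mittag_leffler t : 0 < t ->
  is_derive t 1 (fun s => mittag_leffler rho (- lam * s `^ rho)) (- (lam * w t)).
Proof.
move=> t0.
have -> : (fun s => mittag_leffler rho (- lam * s `^ rho)) = ml2 rho 1 \o (fun s => - lam * s `^ rho).
  by apply/funext => s /=; rewrite mittag_lefflerE.
have ec := entire_ml_coef rho_gt0 (@ltr01 R).
pose z := - lam * t `^ rho.
have d1 : is_derive z 1 (ml2 rho 1) (limn (pseries (pseries_diffs (ml_coef rho 1)) z)).
  apply: (@pseries_snd_diffs R _ (`|z| + 1)).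
  - exact: entire_pseries_cvg.
  - by apply: entire_pseries_cvg; exact: entire_coef_diffs.
  - by apply: entire_pseries_cvg; do 2 apply: entire_coef_diffs.
  - by rewrite [ltRHS]ger0_norm ?addr_ge0// ltrDl.
have dE : pseries_diffs (ml_coef rho 1) = (fun k => rho^-1 * ml_coef rho rho k).
  apply/funext => k; rewrite /pseries_diffs /ml_coef.
  have k0 : 0 < rho * k%:R + rho by exact: ml2_index_gt0.
  have -> : rho * k.+1%:R = rho * k%:R + rho by rewrite -natr1 mulrDr mulr1.
  rewrite GammaS// (_ : rho * k%:R + rho = rho * k.+1%:R); last by rewrite -natr1 mulrDr mulr1.
  rewrite !invfM; move: (Gamma _)^-1 => g; field.
  by rewrite gt_eqF//= pnatr_eq0.
have lE : limn (pseries (pseries_diffs (ml_coef rho 1)) z) = rho^-1 * ml2 rho rho z.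
  apply/cvg_lim => //; rewrite dE.
  rewrite (_ : pseries _ _ = (fun n => rho^-1 * pseries (ml_coef rho rho) z n)); last first.
    by apply/funext => n; rewrite /pseries /series/= mulr_sumr; apply: eq_bigr => k _; rewrite mulrA.
  apply: cvgM; first exact: cvg_cst.
  by apply: entire_pseries_cvg; exact: entire_ml_coef.
have d2 : is_derive t 1 (fun s => - lam * s `^ rho) (- lam * (rho * t `^ (rho - 1))).
  have h := @is_derive1_powR R rho _ t0.
  exact: is_derive_eq.
have := @is_derive1_comp R (ml2 rho 1) (fun s => - lam * s `^ rho) t _ _ d1 d2; rewrite lE /mlf (ppow_gt0 _ t0) -/z.
rewrite (_ : rho^-1 * _ * _ = - (lam * (t `^ (rho - 1) * ml2 rho rho z)))//.
by move: (ml2 _ _ _) => m; field; rewrite gt_eqF.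
Qed.

End MittagLefflerBounds.

(** * Lebesgue measure on [R^N] and complex integrals *)

Lemma sigma_finite_transport d d' (X : measurableType d) (Y : measurableType d') (R : realType)
    (mu : {measure set X -> \bar R}) (phi : X -> Y) (psi : Y -> X) :
  sigma_finite setT mu ->
  measurable_fun setT phi -> measurable_fun setT psi -> cancel phi psi ->
  exists nu : {sigma_finite_measure set Y -> \bar R},
    forall f : Y -> \bar R, measurable_fun setT f -> (forall y, 0 <= f y)%E ->
      (\int[nu]_y f y = \int[mu]_x f (phi x))%E.
Proof.
move=> smu mphi mpsi phiK.
pose m' := [the {measure set Y -> \bar R} of pushforward mu phi].
pose m := m' mphi.
have sf : sigma_finite setT m.
  have [F FT Foo] := smu.
  exists (fun i => psi @^-1` (F i)).
    by rewrite -preimage_bigcup -FT preimage_setT.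
  move=> i; have [mF Fi] := Foo i; split.
    by rewrite -[X in measurable X]setTI; exact: mpsi.
  rewrite [m _](_ : _ = mu (F i))// /m /pushforward; congr (mu _).
  by apply/seteqP; split => x /=; rewrite phiK.
pose nu : {sigma_finite_measure set Y -> \bar R} :=
  HB.pack (m : set Y -> \bar R) (Measure.on m) (Measure_isSigmaFinite.Build _ _ _ _ sf).
exists nu => f mf f0.
rewrite -[RHS](ge0_integral_pushforward mphi mu measurableT mf)//.
Qed.

Lemma sigma_finite_transport_prod d1 d2 d' (X1 : measurableType d1) (X2 : measurableType d2)
    (Y : measurableType d') (R : realType) (m1 : {sigma_finite_measure set X1 -> \bar R})
    (m2 : {sigma_finite_measure set X2 -> \bar R}) (phi : X1 * X2 -> Y) (psi : Y -> X1 * X2) :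
  measurable_fun setT phi -> measurable_fun setT psi -> cancel phi psi ->
  exists nu : {sigma_finite_measure set Y -> \bar R},
    forall f : Y -> \bar R, measurable_fun setT f -> (forall y, 0 <= f y)%E ->
      (\int[nu]_y f y = \int[m1]_x1 \int[m2]_x2 f (phi (x1, x2)))%E.
Proof.
move=> mphi mpsi phiK.
have sm : sigma_finite setT (m1 \x m2)%E.
  have [[F TF Foo] [G TG Goo]] := (sigma_finiteT m1, sigma_finiteT m2).
  (* The products of the two covers, enumerated by codes of pairs; a non-code contributes the empty
     set. *)
  exists (fun n => if unpickle n is Some (i, j) then F i `*` G j else set0).
    apply/seteqP; split => // -[x y] _.
    have [i _ Fx] : (\bigcup_i F i) x by rewrite -TF.
    have [j _ Gy] : (\bigcup_i G i) y by rewrite -TG.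
    by exists (pickle (i, j)) => //; rewrite pickleK.
  move=> n; case: (unpickle n) => [[i j]|]; last by rewrite measure0.
  have [[mF Fi] [mG Gj]] := (Foo i, Goo j).
  split; first exact: measurableX.
  by rewrite product_measure1E// lte_mul_pinfty// ge0_fin_numE.
have [nu h] := sigma_finite_transport sm mphi mpsi phiK.
exists nu => f mf f0; rewrite h// (fubini_tonelli1 (f \o phi))//.
  exact: measurableT_comp.
by move=> z; exact: f0.
Qed.

Section TupleMeasure.
Context {R : realType}.
Local Notation mu := (@lebesgue_measure R).

(** Iterated integration overwrites the coordinates below k and leaves the others at their initial
    values, so integrands need comparing only at such points. *)
Lemma iter_int_eq k (g g' : (nat -> R) -> \bar R) (x x' : nat -> R) :
  (forall z z', (forall i, (i < k)%N -> z i = z' i) -> (forall i, (k <= i)%N -> z i = x i) ->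
    (forall i, (k <= i)%N -> z' i = x' i) -> g z = g' z') ->
  iter_int k g x = iter_int k g' x'.
Proof.
elim: k x x' => [|k IH] x x' h /=; first exact: h.
apply: eq_integral => y _; apply: IH => z z' zz' zx zx'; apply: h.
- move=> i; rewrite ltnS leq_eqVlt => /predU1P[->|]; last exact: zz'.
  by rewrite zx// zx'// /upd eqxx.
- by move=> i ki; rewrite zx ?(ltnW ki)// /upd gtn_eqF.
- by move=> i ki; rewrite zx' ?(ltnW ki)// /upd gtn_eqF.
Qed.

(** The outermost integral of [iter_int] runs over the last coordinate; hence the scalar is the
    first factor of the pair and the last entry of the tuple. *)
Definition snoc n (z : measurableTypeR R * n.-tuple R) : n.+1.-tuple R := [tuple of rcons z.2 z.1].
Definition unsnoc n (x : n.+1.-tuple R) : measurableTypeR R * n.-tuple R :=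
  (tnth x ord_max, [tuple tnth x (widen_ord (leqnSn n) i) | i < n]).

Lemma tnth_snoc n (z : measurableTypeR R * n.-tuple R) (i : 'I_n.+1) :
  tnth (snoc z) i = if unlift ord_max i is Some j then tnth z.2 j else z.1.
Proof.
rewrite (tnth_nth 0) /= nth_rcons size_tuple.
case: unliftP => [j ->|->]; last by rewrite /= ltnn eqxx.
by rewrite lift_max ltn_ord (tnth_nth 0).
Qed.

Lemma tnth_snoc_max n (z : measurableTypeR R * n.-tuple R) : tnth (snoc z) ord_max = z.1.
Proof. by rewrite tnth_snoc unlift_none. Qed.

Lemma tnth_snoc_widen n (z : measurableTypeR R * n.-tuple R) (i : 'I_n) :
  tnth (snoc z) (widen_ord (leqnSn n) i) = tnth z.2 i.
Proof.
have -> : widen_ord (leqnSn n) i = lift ord_max i by apply/val_inj; rewrite [RHS]lift_max.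
by rewrite tnth_snoc liftK.
Qed.

Lemma snocK n : cancel (@snoc n) (@unsnoc n).
Proof.
move=> [y x]; rewrite /unsnoc tnth_snoc_max; congr (_, _).
by apply: eq_from_tnth => i; rewrite tnth_mktuple tnth_snoc_widen.
Qed.

Lemma measurable_snoc n : measurable_fun setT (@snoc n).
Proof.
apply/measurable_fun_tnthP => i.
rewrite (_ : _ \o _ = fun z : measurableTypeR R * n.-tuple R =>
  if unlift ord_max i is Some j then tnth z.2 j else z.1); last first.
  by apply/funext => z /=; rewrite tnth_snoc.
case: unlift => [j|]; last exact: measurable_fst.
by apply: (measurableT_comp (measurable_tnth j)); exact: measurable_snd.
Qed.

Lemma measurable_unsnoc n : measurable_fun setT (@unsnoc n).
Proof.
apply: measurable_fun_pair; first exact: measurable_tnth.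
apply/measurable_fun_tnthP => i.
rewrite (_ : _ \o _ = (fun x => tnth x (widen_ord (leqnSn n) i))); first exact: measurable_tnth.
by apply/funext => x /=; rewrite tnth_mktuple.
Qed.

Lemma nnintN_snoc n (f : n.+1.-tuple R -> \bar R) :
  (nnintN f = \int[mu]_y nnintN (fun x : n.-tuple R => f (snoc (y, x))))%E.
Proof.
apply: eq_integral => y _; apply: iter_int_eq => z z' zz' zn _; congr f.
apply: eq_from_tnth => i; rewrite tnth_mktuple tnth_snoc; case: unliftP => [j ->|->].
  by rewrite tnth_mktuple lift_max zz'.
by rewrite zn// /upd eqxx.
Qed.

(** Turns the iterated integral into integration against a measure. Induction on the dimension: the
    Dirac mass on the empty tuple, then transport along [snoc] of the product with Lebesgue
    measure. *)
Lemma tuple_measure_exists n : exists nu : {sigma_finite_measure set (n.-tuple R) -> \bar R},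
  forall f : n.-tuple R -> \bar R, measurable_fun setT f -> (forall x, 0 <= f x)%E ->
    (nnintN f = \int[nu]_x f x)%E.
Proof.
elim: n => [|n [nu IH]].
  exists (dirac [tuple of [::]]) => f mf f0; rewrite integral_dirac// diracT mul1e.
  by rewrite /nnintN/=; congr f; rewrite [LHS]tuple0 [RHS]tuple0.
have [nu1 h] := sigma_finite_transport_prod mu nu (measurable_snoc (n := n))
  (measurable_unsnoc (n := n)) (@snocK n).
exists nu1 => f mf f0; rewrite h// nnintN_snoc.
have mfs : measurable_fun setT (f \o @snoc n) by apply: measurableT_comp => //; exact: measurable_snoc.
apply: eq_integral => y _; apply: IH => //.
by apply: (measurableT_comp mfs); exact: pair1_measurable.
Qed.

Definition lebN n : {sigma_finite_measure set (n.-tuple R) -> \bar R} :=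
  projT1 (cid (tuple_measure_exists n)).

Lemma nnintNE n (f : n.-tuple R -> \bar R) : measurable_fun setT f -> (forall x, 0 <= f x)%E ->
  (nnintN f = \int[lebN n]_x f x)%E.
Proof. by rewrite /lebN; case: cid => nu h /=; exact: h. Qed.

Lemma ge0_integral_snoc n (f : n.+1.-tuple R -> \bar R) :
  measurable_fun setT f -> (forall x, 0 <= f x)%E ->
  (\int[lebN n.+1]_x f x = \int[mu]_y \int[lebN n]_x f (snoc (y, x)))%E.
Proof.
move=> mf f0; rewrite -nnintNE// nnintN_snoc.
have mfs : measurable_fun setT (f \o @snoc n) by apply: measurableT_comp => //; exact: measurable_snoc.
apply: eq_integral => y _; rewrite nnintNE//.
by apply: (measurableT_comp mfs); exact: pair1_measurable.
Qed.

End TupleMeasure.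

(** * Complex-valued functions: modulus, integral, dominated convergence, Fubini *)

Section ComplexModulus.
Context {R : realType}.
Implicit Types z w : R[i].

Lemma creM z w : cre (z * w) = cre z * cre w - cim z * cim w.
Proof. by case: z; case: w. Qed.

Lemma cimM z w : cim (z * w) = cre z * cim w + cim z * cre w.
Proof. by case: z => a b; case: w => c d; rewrite /cim /cre /=; ring. Qed.

Lemma creD z w : cre (z + w) = cre z + cre w.
Proof. by case: z; case: w. Qed.

Lemma cimD z w : cim (z + w) = cim z + cim w.
Proof. by case: z; case: w. Qed.

Lemma creN z : cre (- z) = - cre z.
Proof. by case: z. Qed.

Lemma cimN z : cim (- z) = - cim z.
Proof. by case: z. Qed.

Lemma creB z w : cre (z - w) = cre z - cre w.
Proof. by rewrite creD creN. Qed.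

Lemma cimB z w : cim (z - w) = cim z - cim w.
Proof. by rewrite cimD cimN. Qed.

Lemma complexP z w : cre z = cre w -> cim z = cim w -> z = w.
Proof. by case: z => a b; case: w => c d; rewrite /cre /cim /= => -> ->. Qed.

Lemma cre_rc (x : R) : cre (rc x) = x. Proof. by []. Qed.
Lemma cim_rc (x : R) : cim (rc x) = 0. Proof. by []. Qed.

Lemma cre_rcM (x : R) z : cre (rc x * z) = x * cre z.
Proof. by rewrite creM cre_rc cim_rc mul0r subr0. Qed.

Lemma cim_rcM (x : R) z : cim (rc x * z) = x * cim z.
Proof. by rewrite cimM cre_rc cim_rc mul0r addr0. Qed.

Lemma rcM (x y : R) : rc (x * y) = rc x * rc y.
Proof. by apply: complexP; rewrite ?cre_rcM ?cim_rcM ?cre_rc ?cim_rc ?mulr0. Qed.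

Lemma cmod_ge0 z : 0 <= cmod z. Proof. exact: sqrtr_ge0. Qed.

Lemma sqr_cmod z : cmod z ^+ 2 = cre z ^+ 2 + cim z ^+ 2.
Proof. by rewrite sqr_sqrtr// addr_ge0// sqr_ge0. Qed.

Lemma cmodM z w : cmod (z * w) = cmod z * cmod w.
Proof.
apply/eqP; rewrite -(@eqrXn2 _ 2) ?mulr_ge0 ?cmod_ge0//; apply/eqP.
by rewrite exprMn !sqr_cmod creM cimM; ring.
Qed.

Lemma cmod_rc (x : R) : cmod (rc x) = `|x|.
Proof. by rewrite /cmod cre_rc cim_rc expr0n addr0 sqrtr_sqr. Qed.

Lemma cmod_cexpi (t : R) : cmod (cexpi t) = 1.
Proof. by rewrite /cmod /cexpi /cre /cim/= cos2Dsin2 sqrtr1. Qed.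

Lemma norm_cre_le z : `|cre z| <= cmod z.
Proof. by rewrite -sqrtr_sqr ler_wsqrtr// lerDl sqr_ge0. Qed.

Lemma norm_cim_le z : `|cim z| <= cmod z.
Proof. by rewrite -sqrtr_sqr ler_wsqrtr// lerDr sqr_ge0. Qed.

Lemma cmod_le_sum z : cmod z <= `|cre z| + `|cim z|.
Proof.
rewrite -[leRHS]ger0_norm ?addr_ge0// -sqrtr_sqr ler_wsqrtr// sqrrD !real_normK ?num_real//.
by rewrite addrAC lerDl mulrn_wge0// mulr_ge0.
Qed.

Lemma cmodN z : cmod (- z) = cmod z.
Proof. by rewrite /cmod creN cimN !sqrrN. Qed.

Lemma cmod_distC z w : cmod (z - w) = cmod (w - z).
Proof. by rewrite -cmodN opprB. Qed.

Lemma cmod0 : cmod (0 : R[i]) = 0.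
Proof. by rewrite /cmod /cre /cim/= expr0n addr0 sqrtr0. Qed.

Lemma cmodD z w : cmod (z + w) <= cmod z + cmod w.
Proof.
by have := @le_normcD R z w; case: z => a b; case: w => c d.
Qed.

Lemma sqr_cmodD z w : cmod (z + w) ^+ 2 <= 2 * cmod z ^+ 2 + 2 * cmod w ^+ 2.
Proof.
rewrite !sqr_cmod creD cimD -subr_ge0.
have -> : 2 * (cre z ^+ 2 + cim z ^+ 2) + 2 * (cre w ^+ 2 + cim w ^+ 2) -
  ((cre z + cre w) ^+ 2 + (cim z + cim w) ^+ 2) = (cre z - cre w) ^+ 2 + (cim z - cim w) ^+ 2 by ring.
by rewrite addr_ge0 ?sqr_ge0.
Qed.

Lemma cexpiD (s t : R) : cexpi (s + t) = cexpi s * cexpi t.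
Proof. by apply: complexP; rewrite ?creM ?cimM /cexpi /cre /cim/= ?cosD ?sinD; ring. Qed.

End ComplexModulus.

Section ComplexIntegral.
Context d {T : measurableType d} {R : realType} (mu : {measure set T -> \bar R}).
Implicit Types (f g : T -> R[i]) (c : R[i]).

Definition cmeas f := measurable_fun setT (fun x => cre (f x)) /\
  measurable_fun setT (fun x => cim (f x)).

Definition cintegrable f := mu.-integrable setT (fun x => (cre (f x))%:E) /\
  mu.-integrable setT (fun x => (cim (f x))%:E).

Definition cint f : R[i] := Complex (\int[mu]_x cre (f x)) (\int[mu]_x cim (f x)).

Lemma eq_cint f g : f =1 g -> cint f = cint g.
Proof. by move=> fg; congr cint; apply/funext. Qed.

Lemma cmeas_cst c : cmeas (fun=> c).
Proof. by []. Qed.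

Lemma cmeasM f g : cmeas f -> cmeas g -> cmeas (fun x => f x * g x).
Proof.
move=> [fr fi] [gr gi]; split.
  by under eq_fun do rewrite creM; apply: measurable_funB; exact: measurable_funM.
by under eq_fun do rewrite cimM; apply: measurable_funD; exact: measurable_funM.
Qed.

Lemma cmeasB f g : cmeas f -> cmeas g -> cmeas (fun x => f x - g x).
Proof.
move=> [fr fi] [gr gi]; split.
  by under eq_fun do rewrite creB; exact: measurable_funB.
by under eq_fun do rewrite cimB; exact: measurable_funB.
Qed.

Lemma cmeas_rc (h : T -> R) : measurable_fun setT h -> cmeas (fun x => rc (h x)).
Proof. by split. Qed.

Lemma cmeas_cexpi (h : T -> R) : measurable_fun setT h -> cmeas (fun x => cexpi (h x)).
Proof.
move=> mh; split; rewrite /cexpi /cre /cim/=.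
  by apply: measurableT_comp mh; apply: continuous_measurable_fun; exact: continuous_cos.
by apply: measurableT_comp mh; apply: continuous_measurable_fun; exact: continuous_sin.
Qed.

Lemma measurable_cmod f : cmeas f -> measurable_fun setT (fun x => cmod (f x)).
Proof.
move=> [fr fi]; apply: measurableT_comp; last first.
  by apply: measurable_funD; exact: measurable_funX.
by apply: continuous_measurable_fun; exact: sqrt_continuous.
Qed.

Lemma cintegrable_meas f : cintegrable f -> cmeas f.
Proof.
by move=> [/measurable_int/measurable_EFinP h1 /measurable_int/measurable_EFinP h2]; split.
Qed.

Lemma cintegrable_dom f (g : T -> R) : cmeas f -> mu.-integrable setT (fun x => (g x)%:E) ->
  (forall x, cmod (f x) <= g x) -> cintegrable f.
Proof.
move=> [fr fi] ig fg.
split; apply: (le_integrable measurableT _ _ ig); try exact/measurable_EFinP.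
  by move=> x _; rewrite lee_fin (le_trans (norm_cre_le _))// (le_trans (fg x))// ler_norm.
by move=> x _; rewrite lee_fin (le_trans (norm_cim_le _))// (le_trans (fg x))// ler_norm.
Qed.

Lemma integrable_cmod f : cintegrable f -> mu.-integrable setT (fun x => (cmod (f x))%:E).
Proof.
move=> cf; have [i1 i2] := cf.
have i3 : mu.-integrable setT (fun x => (`|cre (f x)|%:E + `|cim (f x)|%:E)%E).
  by apply: integrableD => //; [exact: (integrable_norm i1)|exact: (integrable_norm i2)].
apply: (le_integrable measurableT _ _ i3).
  by apply/measurable_EFinP/measurable_cmod/cintegrable_meas.
move=> x _; rewrite -EFinD lee_fin [leLHS]ger0_norm ?cmod_ge0// [leRHS]ger0_norm ?addr_ge0//.
exact: cmod_le_sum.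
Qed.

Lemma cintegrableP f : cmeas f -> (\int[mu]_x (cmod (f x))%:E < +oo)%E -> cintegrable f.
Proof.
move=> mf fy; apply: (@cintegrable_dom _ (fun x => cmod (f x))) => //.
apply/integrableP; split; first exact/measurable_EFinP/measurable_cmod.
by under eq_integral do rewrite gee0_abs ?lee_fin ?cmod_ge0//.
Qed.

Lemma cintegrableD f g : cintegrable f -> cintegrable g -> cintegrable (fun x => f x + g x).
Proof.
move=> [fr fi] [gr gi]; split.
  by under eq_fun do rewrite creD EFinD; exact: integrableD.
by under eq_fun do rewrite cimD EFinD; exact: integrableD.
Qed.

Lemma cintegrableB f g : cintegrable f -> cintegrable g -> cintegrable (fun x => f x - g x).
Proof.
move=> [fr fi] [gr gi]; split.
  by under eq_fun do rewrite creB EFinB; exact: integrableB.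
by under eq_fun do rewrite cimB EFinB; exact: integrableB.
Qed.

Lemma cintegrableM f g (M : R) : cintegrable f -> cmeas g -> (forall x, cmod (g x) <= M) ->
  cintegrable (fun x => f x * g x).
Proof.
move=> cf mg gM; apply: (@cintegrable_dom _ (fun x => M * cmod (f x))).
- by apply: cmeasM => //; exact: cintegrable_meas.
- by under eq_fun do rewrite EFinM; apply: integrableZl => //; exact: integrable_cmod.
- by move=> x; rewrite cmodM mulrC ler_wpM2r ?cmod_ge0.
Qed.

Lemma cintegrableZ c f : cintegrable f -> cintegrable (fun x => c * f x).
Proof.
move=> cf; under eq_fun do rewrite mulrC.
exact: (cintegrableM cf (cmeas_cst c) (fun=> lexx _)).
Qed.

Lemma cintD f g : cintegrable f -> cintegrable g ->
  cint (fun x => f x + g x) = cint f + cint g.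
Proof.
move=> [fr fi] [gr gi]; apply: complexP.
  rewrite creD /cint /cre/= -RintegralD//; apply: eq_Rintegral => x _; exact: creD.
rewrite cimD /cint /cim/= -RintegralD//; apply: eq_Rintegral => x _; exact: cimD.
Qed.

Lemma cintB f g : cintegrable f -> cintegrable g ->
  cint (fun x => f x - g x) = cint f - cint g.
Proof.
move=> [fr fi] [gr gi]; apply: complexP.
  rewrite creB /cint /cre/= -RintegralB//; apply: eq_Rintegral => x _; exact: creB.
rewrite cimB /cint /cim/= -RintegralB//; apply: eq_Rintegral => x _; exact: cimB.
Qed.

Lemma cintZ c f : cintegrable f -> cint (fun x => c * f x) = c * cint f.
Proof.
move=> [fr fi]; have hr k := integrableZl measurableT k fr.
have hi k := integrableZl measurableT k fi.
apply: complexP.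
  rewrite creM /cint [cre (Complex _ _)]/cre [cim (Complex _ _)]/cim/= -!RintegralZl//.
  rewrite -RintegralB; [|by []|exact: hr|exact: hi].
  by apply: eq_Rintegral => x _; exact: creM.
rewrite cimM /cint [cre (Complex _ _)]/cre [cim (Complex _ _)]/cim/= -!RintegralZl//.
rewrite -RintegralD; [|by []|exact: hi|exact: hr].
by apply: eq_Rintegral => x _; exact: cimM.
Qed.

(** The factor 2 is the price of bounding real and imaginary parts separately; every use is a
    qualitative estimate. *)
Lemma cmod_cint_le f : cintegrable f -> cmod (cint f) <= 2 * \int[mu]_x cmod (f x).
Proof.
move=> cf; have [fr fi] := cf; have fm := integrable_cmod cf.
apply: (le_trans (cmod_le_sum _)); rewrite mulr_natl mulr2n.
apply: lerD; (apply: (le_trans (le_normr_Rintegral _ _)) => //; apply: le_Rintegral => //).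
- exact: (integrable_norm fr).
- by move=> x _; exact: norm_cre_le.
- exact: (integrable_norm fi).
- by move=> x _; exact: norm_cim_le.
Qed.

Lemma cintegrable_cexpi f (h : T -> R) : cintegrable f -> measurable_fun setT h ->
  cintegrable (fun x => f x * cexpi (h x)).
Proof.
move=> cf mh; apply: (@cintegrableM _ _ 1) => //; first exact: cmeas_cexpi.
by move=> x; rewrite cmod_cexpi.
Qed.

Lemma cmod_cint_cexpi_le f (h : T -> R) : cintegrable f -> measurable_fun setT h ->
  cmod (cint (fun x => f x * cexpi (h x))) <= 2 * \int[mu]_x cmod (f x).
Proof.
move=> cf mh; have cfh := cintegrable_cexpi cf mh.
apply: (le_trans (cmod_cint_le cfh)); rewrite (_ : \int[mu]_x cmod (f x * cexpi (h x)) = \int[mu]_x cmod (f x))//.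
by apply: eq_Rintegral => x _; rewrite cmodM cmod_cexpi mulr1.
Qed.

Lemma Rintegral_dominated_cvg (f_ : nat -> T -> R) (f g : T -> R) :
  (forall n, measurable_fun setT (f_ n)) -> measurable_fun setT f ->
  mu.-integrable setT (fun x => (g x)%:E) -> (forall n x, `|f_ n x| <= g x) ->
  {ae mu, forall x, f_ n x @[n --> \oo] --> f x} ->
  \int[mu]_x f_ n x @[n --> \oo] --> \int[mu]_x f x.
Proof.
move=> mf_ mf ig fg fc.
have [] := @dominated_convergence _ _ _ mu _ measurableT (fun n x => (f_ n x)%:E)
  (fun x => (f x)%:E) (fun x => (g x)%:E).
- by move=> n; exact/measurable_EFinP.
- exact/measurable_EFinP.
- by apply: filterS fc => x hx _; apply: cvg_EFin => //; exact: nearW.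
- exact: ig.
- by apply: aeW => x n _; rewrite lee_fin.
move=> i_f _ h; apply: fine_cvg; rewrite fineK//; exact: integrable_fin_num.
Qed.

Definition ccvg (u : nat -> R[i]) (l : R[i]) :=
  cre (u n) @[n --> \oo] --> cre l /\ cim (u n) @[n --> \oo] --> cim l.

Lemma ccvg_near u l : ccvg u l -> forall e, 0 < e -> \forall n \near \oo, cmod (u n - l) < e.
Proof.
move=> [ur ui] e e0; have e2 : 0 < e / 2 by rewrite divr_gt0.
move/cvgrPdist_lt : ur => /(_ _ e2) ur; move/cvgrPdist_lt : ui => /(_ _ e2) ui.
near=> n; rewrite (le_lt_trans (cmod_le_sum _))// creB cimB (splitr e).
by apply: ltrD; rewrite distrC; near: n; [exact: ur|exact: ui].
Unshelve. all: by end_near. Qed.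

Lemma cint_dominated_cvg (f_ : nat -> T -> R[i]) f (g : T -> R) :
  (forall n, cmeas (f_ n)) -> cmeas f -> mu.-integrable setT (fun x => (g x)%:E) ->
  (forall n x, cmod (f_ n x) <= g x) -> {ae mu, forall x, ccvg (f_ ^~ x) (f x)} ->
  ccvg (fun n => cint (f_ n)) (cint f).
Proof.
move=> mf_ [mfr mfi] ig fg fc; split; apply: Rintegral_dominated_cvg ig _ _ => //.
- by move=> n; have [] := mf_ n.
- by move=> n x; exact: le_trans (norm_cre_le _) (fg n x).
- by apply: filterS fc => x [].
- by move=> n; have [] := mf_ n.
- by move=> n x; exact: le_trans (norm_cim_le _) (fg n x).
- by apply: filterS fc => x [].
Qed.

End ComplexIntegral.

Section ComplexLimits.
Context {R : realType}.
Implicit Types (u v : nat -> R[i]) (l m : R[i]).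

Lemma ccvg_cst l : ccvg (fun=> l) l.
Proof. by split; exact: cvg_cst. Qed.

Lemma ccvgM u v l m : ccvg u l -> ccvg v m -> ccvg (fun n => u n * v n) (l * m).
Proof.
move=> [ur ui] [vr vi]; split.
  by rewrite creM; under eq_fun do rewrite creM; apply: cvgB; exact: cvgM.
by rewrite cimM; under eq_fun do rewrite cimM; apply: cvgD; exact: cvgM.
Qed.

Lemma ccvg_rc (r : nat -> R) (s : R) : r n @[n --> \oo] --> s -> ccvg (fun n => rc (r n)) (rc s).
Proof. by move=> h; split; [exact: h|exact: cvg_cst]. Qed.

Lemma ccvg_cexpi (r : nat -> R) (s : R) : r n @[n --> \oo] --> s ->
  ccvg (fun n => cexpi (r n)) (cexpi s).
Proof.
move=> h; split; rewrite /cexpi /cre /cim/=.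
  by apply: (@cvg_comp _ _ _ r cos) h _; exact: continuous_cos.
by apply: (@cvg_comp _ _ _ r sin) h _; exact: continuous_sin.
Qed.

Lemma ccvg_unique u l m : ccvg u l -> ccvg u m -> l = m.
Proof. by move=> [a b] [c e]; apply: complexP; [exact: cvg_unique a c|exact: cvg_unique b e]. Qed.

End ComplexLimits.

Section RealFubini.
Context d1 d2 (T1 : measurableType d1) (T2 : measurableType d2) (R : realType).
Variables (m1 : {sigma_finite_measure set T1 -> \bar R}) (m2 : {sigma_finite_measure set T2 -> \bar R}).

(** [Rintegral] applies [fine] to the inner integrals, which are known to be finite only almost
    everywhere; hence the passage through an a.e. equality. *)
Lemma Rfubini1 (f : T1 * T2 -> R) : (m1 \x m2)%E.-integrable setT (fun z => (f z)%:E) ->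
  \int[m1]_x \int[m2]_y f (x, y) = \int[(m1 \x m2)%E]_z f z.
Proof.
move=> imf; rewrite /Rintegral -[in RHS]integral12_prod_meas1//; congr fine.
apply: ae_eq_integral => //.
- apply/measurable_EFinP; apply: (measurableT_comp (fine_measurable _)) => //.
  exact: (measurable_fubini_F imf).
- exact: (measurable_fubini_F imf).
- apply: filterS (ae_integrable1 imf) => x ix _.
  by rewrite fineK//; exact: integrable_fin_num.
Qed.

Lemma Rfubini2 (f : T1 * T2 -> R) : (m1 \x m2)%E.-integrable setT (fun z => (f z)%:E) ->
  \int[m2]_y \int[m1]_x f (x, y) = \int[(m1 \x m2)%E]_z f z.
Proof.
move=> imf; rewrite /Rintegral -[in RHS]integral21_prod_meas1//; congr fine.
apply: ae_eq_integral => //.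
- apply/measurable_EFinP; apply: (measurableT_comp (fine_measurable _)) => //.
  exact: (measurable_fubini_G imf).
- exact: (measurable_fubini_G imf).
- apply: filterS (ae_integrable2 imf) => x ix _.
  by rewrite fineK//; exact: integrable_fin_num.
Qed.

Lemma measurable_Rfubini1 (f : T1 * T2 -> R) : (m1 \x m2)%E.-integrable setT (fun z => (f z)%:E) ->
  measurable_fun setT (fun x => \int[m2]_y f (x, y)).
Proof.
move=> imf; apply: (measurableT_comp (fine_measurable _)) => //.
exact: (measurable_fubini_F imf).
Qed.

Lemma integrable_prod (a : T1 -> R) (b : T2 -> R) :
  m1.-integrable setT (fun x => (a x)%:E) -> m2.-integrable setT (fun x => (b x)%:E) ->
  (m1 \x m2)%E.-integrable setT (fun z => (a z.1 * b z.2)%:E).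
Proof.
move=> ia ib; have /measurable_int/measurable_EFinP ma := ia.
have /measurable_int/measurable_EFinP mb := ib.
apply/integrable12ltyP.
  apply/measurable_EFinP; apply: measurable_funM.
    by apply: (measurableT_comp ma); exact: measurable_fst.
  by apply: (measurableT_comp mb); exact: measurable_snd.
rewrite /=.
have -> : (\int[m1]_x \int[m2]_y `|(a x * b y)%:E| =
    \int[m1]_x (`|a x|%:E * \int[m2]_y `|b y|%:E))%E.
  apply: eq_integral => x _; rewrite -ge0_integralZl//; last first.
    by apply/measurable_EFinP; exact: measurableT_comp.
  by apply: eq_integral => y _; rewrite EFinM abseM.
have /integrableP[_ iay] := ia; have /integrableP[_ iby] := ib.
rewrite ge0_integralZr//; last 2 first.
- by apply/measurable_EFinP; exact: measurableT_comp.
- by apply: integral_ge0.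
by apply: lte_mul_pinfty => //; [exact: integral_ge0|rewrite ge0_fin_numE//; exact: integral_ge0].
Qed.

Lemma Rintegral_prod (a : T1 -> R) (b : T2 -> R) :
  m1.-integrable setT (fun x => (a x)%:E) -> m2.-integrable setT (fun x => (b x)%:E) ->
  \int[(m1 \x m2)%E]_z (a z.1 * b z.2) = (\int[m1]_x a x) * (\int[m2]_y b y).
Proof.
move=> ia ib; rewrite -(Rfubini1 (integrable_prod ia ib))/=.
rewrite -RintegralZr//; apply: eq_Rintegral => x _; exact: RintegralZl.
Qed.

Lemma cfubini (f : T1 * T2 -> R[i]) : cintegrable (m1 \x m2)%E f ->
  cint m1 (fun x => cint m2 (fun y => f (x, y))) = cint m2 (fun y => cint m1 (fun x => f (x, y))).
Proof.
move=> [fr fi]; apply: complexP; rewrite /cint /cre /cim/=.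
  by rewrite (Rfubini1 fr) -(Rfubini2 fr).
by rewrite (Rfubini1 fi) -(Rfubini2 fi).
Qed.

Lemma cintegrable_prod (a : T1 -> R[i]) (b : T2 -> R[i]) : cintegrable m1 a -> cintegrable m2 b ->
  cintegrable (m1 \x m2)%E (fun z => a z.1 * b z.2).
Proof.
move=> [ar ai] [br bi]; split.
  under eq_fun do rewrite creM EFinB; apply: integrableB => //; [exact: (integrable_prod ar br)|exact: (integrable_prod ai bi)].
under eq_fun do rewrite cimM EFinD; apply: integrableD => //; [exact: (integrable_prod ar bi)|exact: (integrable_prod ai br)].
Qed.

Lemma cint_prod (a : T1 -> R[i]) (b : T2 -> R[i]) : cintegrable m1 a -> cintegrable m2 b ->
  cint (m1 \x m2)%E (fun z => a z.1 * b z.2) = cint m1 a * cint m2 b.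
Proof.
move=> [ar ai] [br bi]; apply: complexP.
  rewrite creM /cint [cre (Complex _ _)]/cre [cim (Complex _ _)]/cim/= -!Rintegral_prod//.
  rewrite -RintegralB//; [|exact: (integrable_prod ar br)|exact: (integrable_prod ai bi)].
  by apply: eq_Rintegral => x _; exact: creM.
rewrite cimM /cint [cre (Complex _ _)]/cre [cim (Complex _ _)]/cim/= -!Rintegral_prod//.
rewrite -RintegralD//; [|exact: (integrable_prod ar bi)|exact: (integrable_prod ai br)].
by apply: eq_Rintegral => x _; exact: cimM.
Qed.

End RealFubini.

Section TupleIntegral.
Context {R : realType}.
Local Notation mu := (@lebesgue_measure R).

Lemma cintNE n (f : n.-tuple R -> R[i]) : cintegrable (lebN n) f -> cintN f = cint (lebN n) f.
Proof.
move=> [fr fi].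
have h (g : n.-tuple R -> R) : (lebN n).-integrable setT (fun x => (g x)%:E) ->
    rintN g = \int[lebN n]_x g x.
  move=> ig; have /measurable_int/measurable_EFinP mg := ig.
  have mm (k : n.-tuple R -> R) : measurable_fun setT k ->
      nnintN (fun x => (Num.max (k x) 0)%:E) = (\int[lebN n]_x (Num.max (k x) 0)%:E)%E.
    move=> mk; apply: nnintNE; last by move=> x; rewrite lee_fin le_max lexx orbT.
    by apply/measurable_EFinP; exact: measurable_maxr.
  rewrite /rintN !mm//; last exact: measurable_funN.
  rewrite /Rintegral [X in _ = fine X]integralE [RHS]fineB; last 2 first.
  - exact: (integrable_pos_fin_num measurableT ig).
  - exact: (integrable_neg_fin_num measurableT ig).
  congr (fine _ - fine _); apply: eq_integral => x _.
    by rewrite funeposE EFin_max.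
  by rewrite funenegE EFin_max EFinN.
by rewrite /cintN /cint !h.
Qed.

Lemma ge0_integral_snoc_prod n (f : n.+1.-tuple R -> \bar R) :
  measurable_fun setT f -> (forall x, 0 <= f x)%E ->
  (\int[lebN n.+1]_x f x = \int[(mu \x lebN n)%E]_z f (snoc z))%E.
Proof.
move=> mf f0; rewrite ge0_integral_snoc// (fubini_tonelli1 (f \o @snoc R n))//.
  by apply: measurableT_comp => //; exact: measurable_snoc.
by move=> z; exact: f0.
Qed.

Lemma integral_snoc n (f : n.+1.-tuple R -> \bar R) : measurable_fun setT f ->
  (\int[lebN n.+1]_x f x = \int[(mu \x lebN n)%E]_z f (snoc z))%E.
Proof.
move=> mf; rewrite integralE [in RHS]integralE !ge0_integral_snoc_prod//; last 2 first.
- exact: measurable_funeneg.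
- exact: measurable_funepos.
by congr (_ - _)%E; apply: eq_integral => z _; rewrite ?funeposE ?funenegE.
Qed.

Lemma integrable_snoc n (f : n.+1.-tuple R -> \bar R) : measurable_fun setT f ->
  (mu \x lebN n)%E.-integrable setT (fun z => f (snoc z)) -> (lebN n.+1).-integrable setT f.
Proof.
move=> mf /integrableP[_ h]; apply/integrableP; split => //.
by rewrite ge0_integral_snoc_prod//; exact: measurableT_comp.
Qed.

Lemma cintegrable_snoc n (f : n.+1.-tuple R -> R[i]) : cmeas f ->
  cintegrable (mu \x lebN n)%E (fun z => f (snoc z)) -> cintegrable (lebN n.+1) f.
Proof.
move=> [mr mi] [fr fi]; split; apply: integrable_snoc => //; exact/measurable_EFinP.
Qed.

Lemma cint_snoc n (f : n.+1.-tuple R -> R[i]) : cmeas f ->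
  cint (lebN n.+1) f = cint (mu \x lebN n)%E (fun z => f (snoc z)).
Proof.
by move=> [mr mi]; rewrite /cint /Rintegral !integral_snoc//; exact/measurable_EFinP.
Qed.

Lemma cmeas_tnth n (i : 'I_n) (g : R -> R[i]) : cmeas g -> cmeas (fun x : n.-tuple R => g (tnth x i)).
Proof.
move=> [gr gi]; split.
  by apply: (measurableT_comp gr); exact: measurable_tnth.
by apply: (measurableT_comp gi); exact: measurable_tnth.
Qed.

Lemma cmeas_prod d (T : measurableType d) (I : Type) (s : seq I) (f : I -> T -> R[i]) :
  (forall i, cmeas (f i)) -> cmeas (fun x => \prod_(i <- s) f i x).
Proof.
move=> mf; elim: s => [|i s IH].
  by under eq_fun do rewrite big_nil; exact: cmeas_cst.
by under eq_fun do rewrite big_cons; exact: cmeasM.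
Qed.

Lemma prod_snoc n (f : 'I_n.+1 -> R -> R[i]) (z : measurableTypeR R * n.-tuple R) :
  \prod_(i < n.+1) f i (tnth (snoc z) i) =
  f ord_max z.1 * \prod_(i < n) f (widen_ord (leqnSn n) i) (tnth z.2 i).
Proof.
rewrite big_ord_recr/= tnth_snoc_max mulrC; congr (_ * _); apply: eq_bigr => i _.
by rewrite tnth_snoc_widen.
Qed.

(** Iterated Fubini for products of functions of one variable. The indicators of boxes, the damped
    test functions and the integrable majorants on R^N all have this form. *)
Lemma cint_tuple_prod n (f : 'I_n -> R -> R[i]) : (forall i, cintegrable mu (f i)) ->
  cintegrable (lebN n) (fun x => \prod_(i < n) f i (tnth x i)) /\
  cint (lebN n) (fun x => \prod_(i < n) f i (tnth x i)) = \prod_(i < n) cint mu (f i).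
Proof.
elim: n f => [|n IH] f cf.
  have m1 : (\int[lebN 0]_x (1 : R)%:E = 1%:E :> \bar R)%E by rewrite -nnintNE.
  under eq_fun do rewrite big_ord0.
  split.
    apply: (@cintegrable_dom _ _ _ _ _ (fun=> 1)); first exact: cmeas_cst.
      by apply/integrableP; split => //; under eq_integral do rewrite /= normr1; rewrite m1 ltry.
    by move=> x; rewrite -[1]/(rc 1) cmod_rc normr1.
  rewrite big_ord0 /cint /Rintegral; apply: complexP; rewrite /cre /cim/=.
    by rewrite m1.
  by rewrite integral0.
have [IH1 IH2] := IH (fun i => f (widen_ord (leqnSn n) i)) (fun i => cf _).
have mP : cmeas (fun x : n.+1.-tuple R => \prod_(i < n.+1) f i (tnth x i)).
  by apply: cmeas_prod => i; apply: cmeas_tnth; exact: (cintegrable_meas (cf i)).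
have E : (fun z : measurableTypeR R * n.-tuple R => \prod_(i < n.+1) f i (tnth (snoc z) i)) =
  (fun z => f ord_max z.1 * \prod_(i < n) f (widen_ord (leqnSn n) i) (tnth z.2 i)).
  by apply/funext => z; exact: prod_snoc.
split.
  apply: cintegrable_snoc => //; rewrite E.
  exact: (cintegrable_prod (cf ord_max) IH1).
rewrite cint_snoc// E (cint_prod (cf ord_max) IH1) IH2.
by rewrite [RHS]big_ord_recr/= mulrC.
Qed.

End TupleIntegral.

(** * Boxes in R^N and functions determined by their integrals over boxes *)

Section Boxes.
Context {R : realType} (N : nat).
Implicit Types (a b : 'I_N -> R).

(** Half-open, and empty when some pair of ends is in the wrong order; thus boxes are closed under
    intersection without exception. *)
Definition box a b : set (N.-tuple R) := [set x | forall i, a i < tnth x i <= b i].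

Definition cube (n : nat) := box (fun=> - n%:R) (fun=> n%:R).

Definition boxes : set (set (N.-tuple R)) := [set A | exists a b, A = box a b].

Lemma boxE a b : box a b = \big[setI/setT]_(i < N) [set x | a i < tnth x i <= b i].
Proof.
apply/seteqP; split => x /=.
  by move=> xab; rewrite -bigcap_seq => i _; exact: xab.
by rewrite -bigcap_seq => h i; apply: h; rewrite /= mem_index_enum.
Qed.

Lemma measurable_box a b : measurable (box a b).
Proof.
rewrite boxE; apply: bigsetI_measurable => i _.
rewrite (_ : [set x | _] = (fun x : N.-tuple R => tnth x i) @^-1` `]a i, b i]); last first.
  by apply/seteqP; split => x /=; rewrite in_itv.
by rewrite -[X in measurable X]setTI; apply: measurable_tnth.
Qed.

Lemma setI_closed_boxes : setI_closed boxes.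
Proof.
move=> _ _ [a [b ->]] [c [e ->]].
exists (fun i => Num.max (a i) (c i)), (fun i => Num.min (b i) (e i)).
apply/seteqP; split => x /=.
  move=> [h1 h2] i; have /andP[h3 h4] := h1 i; have /andP[h5 h6] := h2 i.
  by rewrite gt_max h3 h5 le_min h4 h6.
by move=> h; split => i; move: (h i); rewrite gt_max le_min => /andP[/andP[h1 h2] /andP[h3 h4]]; apply/andP.
Qed.

Lemma tnth_le_sum (x : N.-tuple R) i : `|tnth x i| <= \sum_(j < N) `|tnth x j|.
Proof. by rewrite (bigD1 i)//= lerDl sumr_ge0. Qed.

Lemma tnth_lt_nat (x : N.-tuple R) : exists n : nat, forall i, `|tnth x i| < n%:R.
Proof.
exists (Num.truncn (\sum_(j < N) `|tnth x j|)).+1 => i.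
exact: le_lt_trans (tnth_le_sum x i) (truncnS_gt _).
Qed.

Lemma bigcup_cube : \bigcup_n cube n = setT.
Proof.
apply/seteqP; split => // x _; have [n hn] := tnth_lt_nat x; exists n => // i.
by have := hn i; rewrite ltr_norml => /andP[-> /ltW].
Qed.

Lemma measurable_boxesE : @measurable _ (N.-tuple R) = <<s boxes >>.
Proof.
apply/seteqP; split; last first.
  apply: smallest_sub; first exact: sigma_algebra_measurable.
  by move=> _ [a [b ->]]; exact: measurable_box.
pose T := g_sigma_algebraType boxes.
have mid : measurable_fun [set: T] (id : T -> N.-tuple R).
  apply/measurable_fun_tnthP => i.
  apply: (measurability (RGenOInfty.G (R := R))); first exact: RGenOInfty.measurableE.
  move=> _ [_ [c ->] <-]; rewrite setTI.
  (* A half-space x_i > c is a countable union of boxes, the first of which may be empty. *)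
  rewrite (_ : _ @^-1` _ = \bigcup_n box (fun j => if j == i then c else - n%:R) (fun=> n%:R)).
    apply: bigcup_measurable => n _; apply: sub_sigma_algebra.
    by exists (fun j => if j == i then c else - n%:R), (fun=> n%:R).
  apply/seteqP; split => x /=; rewrite in_itv/= andbT.
    move=> cx; have [n hn] := tnth_lt_nat x; exists n => // j.
    have := hn j; rewrite ltr_norml => /andP[h1 /ltW ->]; rewrite andbT.
    by case: eqP => [->|_].
  by move=> [n _ /(_ i)]; rewrite eqxx => /andP[].
by move=> A mA; rewrite -[A]setTI; exact: mid.
Qed.

Lemma indic_box a b x : \1_(box a b) x = \prod_(i < N) \1_(`]a i, b i]%classic) (tnth x i) :> R.
Proof.
rewrite indicE; have [|] := boolP (x \in box a b).
  rewrite inE => xab; rewrite big1// => i _; rewrite indicE mem_set//=.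
  by rewrite in_itv; exact: xab.
move=> /negP; rewrite inE => xab.
have [i /negP hi] : exists i, ~ (a i < tnth x i <= b i) by apply/existsNP.
rewrite (bigD1 i)//= indicE memNset ?mul0r//= in_itv.
exact/negP.
Qed.

End Boxes.

Section IntervalIndicator.
Context {R : realType}.
Local Notation mu := (@lebesgue_measure R).

Lemma integrable_indic_itv (a b : R) : mu.-integrable setT (fun y => (\1_(`]a, b]%classic) y)%:E).
Proof.
apply/integrableP; split; first by apply/measurable_EFinP; exact: measurable_indic.
under eq_integral do rewrite gee0_abs ?lee_fin//.
rewrite integral_indic// setIT.
have := @lebesgue_measure_itv R `]a, b]; rewrite /= => ->.
by case: ifP => _; rewrite ?ltry// -EFinB ltry.
Qed.

Lemma cintegrable_indic_itv (a b : R) : cintegrable mu (fun y => rc (\1_(`]a, b]%classic) y)).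
Proof.
apply: (cintegrable_dom _ (integrable_indic_itv a b)).
  by apply: cmeas_rc; exact: measurable_indic.
by move=> y; rewrite cmod_rc ger0_norm.
Qed.

Lemma rc_prod (I : Type) (s : seq I) (f : I -> R) : rc (\prod_(i <- s) f i) = \prod_(i <- s) rc (f i).
Proof. by elim: s => [|i s IH]; rewrite ?big_nil// !big_cons rcM IH. Qed.

Lemma integrable_indic_box N (a b : 'I_N -> R) : (lebN N).-integrable setT (fun x => (\1_(box a b) x)%:E).
Proof.
have [+ _] := cint_tuple_prod (fun i => cintegrable_indic_itv (a i) (b i)).
by move=> [+ _]; congr (integrable _ _ _); apply/funext => x; rewrite -rc_prod indic_box.
Qed.

End IntervalIndicator.

Section BoxUniqueness.
Context {R : realType} (N : nat).
Local Notation nu := (@lebN R N).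

Lemma cvg_indic_bigcup (T : Type) (F : (set T)^nat) (x : T) : trivIset setT F ->
  (forall n, \sum_(0 <= k < n) \1_(F k) x <= \1_(\bigcup_k F k) x :> R) /\
  (\sum_(0 <= k < n) \1_(F k) x) @[n --> \oo] --> (\1_(\bigcup_k F k) x : R).
Proof.
move=> tF; have E := @indic_bigcup T R F x tF.
have p0 n : (0 <= (\1_(F n) x)%:E :> \bar R)%E by rewrite lee_fin.
split.
  by move=> n; rewrite -lee_fin E -sumEFin; apply: nneseries_lim_ge.
have h : (\sum_(0 <= k < n) (\1_(F k) x)%:E)%E @[n --> \oo] --> (\1_(\bigcup_k F k) x : R)%:E.
  by rewrite E; apply: is_cvg_nneseries => n _ _.
have -> : (fun n => \sum_(0 <= k < n) \1_(F k) x : R) =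
    (fun n => fine (\sum_(0 <= k < n) (\1_(F k) x)%:E)%E).
  by apply/funext => n; rewrite sumEFin.
exact: (fine_cvg h).
Qed.

(** Inside a fixed cube, where h is integrable, the sets over which h integrates to 0 form a Dynkin
    system containing the boxes, hence all Borel sets. The cubes exhaust the space. *)
Lemma ae0_box_integrals (h : N.-tuple R -> R) :
  (forall a b, nu.-integrable (box a b) (fun x => (h x)%:E)) ->
  (forall a b, (\int[nu]_(x in box a b) (h x)%:E = 0)%E) ->
  {ae nu, forall x, h x = 0}.
Proof.
move=> ih h0.
suff: {ae nu, forall x, forall n : nat, cube n x -> (h x)%:E = 0%E}.
  apply: filterS => x hx; have : (\bigcup_n cube n) x by rewrite bigcup_cube.
  by move=> [n _ /hx] [].
apply: ae_foralln => n; pose c := @cube R N n; have mc : measurable c by exact: measurable_box.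
suff: ae_eq nu c (fun x => (h x)%:E) (cst 0%E) by apply: filterS => x hx /hx.
apply: integral_ae_eq => //; first exact: ih.
move=> E Ec mE; rewrite integral0.
suff: forall S, <<s @boxes R N >> S -> measurable S /\ (\int[nu]_(x in c `&` S) (h x)%:E = 0)%E.
  by move=> /(_ E); rewrite -measurable_boxesE => /(_ mE) [_]; rewrite setIidr.
have mh S : measurable S -> S `<=` c -> measurable_fun S (fun x => (h x)%:E).
  have mhc : measurable_fun c (fun x => (h x)%:E) by exact: (measurable_int nu (ih _ _)).
  by move=> mS Sc; exact: (measurable_funS mc Sc mhc).
apply: (@dynkin_induction _ _ (@boxes R N)).
- exact: measurable_boxesE.
- exact: setI_closed_boxes.
- by rewrite setIT; split => //; exact: h0.
- move=> _ [a [b ->]]; split; first exact: measurable_box.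
  have [||a' [b' ->]] := @setI_closed_boxes R N c (box a b); last exact: h0.
    by exists (fun=> - n%:R), (fun=> n%:R).
  by exists a, b.
- move=> S mS [_ hS]; split; first exact: measurableC.
  have : (\int[nu]_(x in (c `&` S) `|` (c `&` ~` S)) (h x)%:E = 0)%E.
    by rewrite -setIUr setUv setIT; exact: h0.
  rewrite integral_setU//=; first last.
  - rewrite disj_set2E; apply/eqP/seteqP; split => x //= -[[_ Sx] [_ nSx]]; exact: nSx.
  - rewrite -setIUr setUv setIT; exact: mh.
  - by apply: measurableI => //; exact: measurableC.
  - exact: measurableI.
  by rewrite hS add0e.
- move=> F mF tF hF; split; first by apply: bigcup_measurable => k _.
  rewrite setI_bigcupr integral_bigcup.
  - by apply: eseries0 => k _ _; exact: (hF k).2.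
  - exact: trivIset_setIl.
  - by move=> k; exact: measurableI.
  - apply: integrableS (ih _ _) => //; first exact: mc.
      by apply: bigcup_measurable => k _; exact: measurableI.
    by move=> x [k _ []].
Qed.

End BoxUniqueness.

(** * The Riemann-Lebesgue lemma *)

Section FourierIntegral.
Context {R : realType} (N : nat).
Local Notation nu := (@lebN R N).
Local Notation mu := (@lebesgue_measure R).
Implicit Types (G : N.-tuple R -> R[i]) (x : N.-tuple R).

Lemma measurable_dotp x : measurable_fun setT (fun xi : N.-tuple R => dotp x xi).
Proof.
by apply: measurable_sum => i; apply: measurable_funM => //; exact: measurable_tnth.
Qed.

Lemma cmeas_cexpi_dotp x : cmeas (fun xi : N.-tuple R => cexpi (dotp x xi)).
Proof. by apply: cmeas_cexpi; exact: measurable_dotp. Qed.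

(** The inverse Fourier integral: with (2 pi)^-N placed in the forward transform, no constant
    appears here. *)
Definition fint G x : R[i] := cint nu (fun xi => G xi * cexpi (dotp x xi)).

Lemma cintegrable_fint G x : cintegrable nu G -> cintegrable nu (fun xi => G xi * cexpi (dotp x xi)).
Proof.
by move=> cG; apply: cintegrable_cexpi => //; exact: measurable_dotp.
Qed.

Lemma fintB G H x : cintegrable nu G -> cintegrable nu H ->
  fint (fun xi => G xi - H xi) x = fint G x - fint H x.
Proof.
move=> cG cH; rewrite /fint -cintB; try exact: cintegrable_fint.
by apply: eq_cint => xi; rewrite mulrBl.
Qed.

Lemma fintD G H x : cintegrable nu G -> cintegrable nu H ->
  fint (fun xi => G xi + H xi) x = fint G x + fint H x.
Proof.
move=> cG cH; rewrite /fint -cintD; try exact: cintegrable_fint.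
by apply: eq_cint => xi; rewrite mulrDl.
Qed.

Lemma fintZ (c : R[i]) G x : cintegrable nu G -> fint (fun xi => c * G xi) x = c * fint G x.
Proof.
move=> cG; rewrite /fint -cintZ; last exact: cintegrable_fint.
by apply: eq_cint => xi; rewrite mulrA.
Qed.

Lemma cmod_fint_le G x : cintegrable nu G -> cmod (fint G x) <= 2 * \int[nu]_xi cmod (G xi).
Proof.
by move=> cG; apply: cmod_cint_cexpi_le => //; exact: measurable_dotp.
Qed.

Definition vanishing (F : N.-tuple R -> R[i]) :=
  forall e : R, 0 < e -> exists M, forall x, M < enorm x -> cmod (F x) < e.

(** [fint] is bounded by twice the L1 norm uniformly in x, so vanishing at infinity survives L1
    approximation; e / 4 compensates the factor 2. *)
Lemma vanishing_approx G : cintegrable nu G ->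
  (forall e : R, 0 < e -> exists H, [/\ cintegrable nu H, vanishing (fint H) &
    \int[nu]_xi cmod (G xi - H xi) < e]) -> vanishing (fint G).
Proof.
move=> cG hG e e0; have [|H [cH vH dGH]] := hG (e / 4); first by rewrite divr_gt0.
have [|M hM] := vH (e / 2); first by rewrite divr_gt0.
exists M => x /hM hx.
have -> : fint G x = (fint G x - fint H x) + fint H x by rewrite subrK.
apply: (le_lt_trans (cmodD _ _)); rewrite (splitr e); apply: ler_ltD => //.
rewrite -fintB//; apply: (le_trans (cmod_fint_le _ (cintegrableB cG cH))).
have -> : e / 2 = 2 * (e / 4) by field.
by rewrite ler_pM2l// ltW.
Qed.

Lemma vanishingD F1 F2 : vanishing F1 -> vanishing F2 -> vanishing (fun x => F1 x + F2 x).
Proof.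
move=> v1 v2 e e0; have e2 : 0 < e / 2 by rewrite divr_gt0.
have [M1 h1] := v1 _ e2; have [M2 h2] := v2 _ e2; exists (Num.max M1 M2) => x.
rewrite gt_max => /andP[/h1 h3 /h2 h4].
by rewrite (le_lt_trans (cmodD _ _))// (splitr e) ltrD.
Qed.

Lemma vanishingZ (c : R[i]) F : vanishing F -> vanishing (fun x => c * F x).
Proof.
move=> vF e e0; have c0 : 0 < cmod c + 1 by rewrite ltr_wpDl ?cmod_ge0.
have [|M hM] := vF (e / (cmod c + 1)); first by rewrite divr_gt0.
exists M => x /hM; rewrite cmodM ltr_pdivlMr// mulrC; apply: le_lt_trans.
by rewrite ler_wpM2r ?cmod_ge0// lerDl.
Qed.

Lemma enorm_le_sum x : enorm x <= \sum_(i < N) `|tnth x i|.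
Proof.
have S0 : 0 <= \sum_(i < N) `|tnth x i| by apply: sumr_ge0.
rewrite -[leRHS]ger0_norm// -sqrtr_sqr ler_wsqrtr// /dotp expr2 mulr_suml.
apply: ler_sum => i _; rewrite -expr2 -real_normK ?num_real// expr2 ler_wpM2l//.
exact: tnth_le_sum.
Qed.

Lemma enorm_lt_coord x (M : R) : N%:R * M < enorm x -> exists i, M < `|tnth x i|.
Proof.
move=> h; apply/existsP; rewrite -[X in is_true X]negbK negb_exists; apply/negP => /forallP hi.
move: h; rewrite ltNge => /negP; apply; apply: (le_trans (enorm_le_sum x)).
rewrite mulr_natl -[X in _ *+ X]card_ord -sumr_const; apply: ler_sum => i _.
by have := hi i; rewrite -leNgt.
Qed.

End FourierIntegral.

Section SimpleFunctions.
Import HBSimple.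

Lemma sfun_sum_indic (R : realType) d (T : measurableType d) (f : {sfun T >-> R}) :
  exists k, exists c : nat -> R, (forall x, f x = \sum_(i < k) c i * \1_(f @^-1` [set c i]) x) /\
    forall i, measurable (f @^-1` [set c i]).
Proof.
eexists; exists (nth 0 (finmap.enum_fset (fset_set (range f)))).
by split => [x|//]; exact: fimfunEord.
Qed.

End SimpleFunctions.

Section RiemannLebesgue.
Context {R : realType}.
Local Notation mu := (@lebesgue_measure R).

Lemma cint_itv (f : R -> R[i]) (a b : R) :
  cint mu (fun y => rc (\1_(`]a, b]%classic) y) * f y) =
  Complex (\int[mu]_(y in `]a, b]) cre (f y)) (\int[mu]_(y in `]a, b]) cim (f y)).
Proof.
rewrite /cint; congr Complex; rewrite [RHS]Rintegral_mkcond; apply: eq_Rintegral => y _.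
  by rewrite cre_rcM indicE patchE; case: ifP => _; rewrite ?mul1r ?mul0r.
by rewrite cim_rcM indicE patchE; case: ifP => _; rewrite ?mul1r ?mul0r.
Qed.

Lemma Rintegral_FTC2 (f F : R -> R) (a b : R) : a < b -> continuous f ->
  (forall x : R, is_derive x (1 : R) F (f x)) -> \int[mu]_(y in `]a, b]) f y = F b - F a.
Proof.
move=> ab cf dF; rewrite /Rintegral integral_itv_obnd_cbnd; last first.
  by apply/measurable_EFinP; apply: measurable_funTS; exact: continuous_measurable_fun.
by rewrite (@FTC2_is_derive _ f F a b ab (fun x _ => cf x) (fun x _ => dF x)).
Qed.

Lemma cmod_cint_itv_cexpi (a b t : R) : t != 0 ->
  cmod (cint mu (fun y => rc (\1_(`]a, b]%classic) y) * cexpi (t * y))) <= 4 / `|t|.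
Proof.
move=> t0; have [ba|ab] := leP b a.
  rewrite cint_itv set_itv_ge -?leNgt ?bnd_simp// !Rintegral_set0.
  by rewrite -[Complex 0 0]/(0 : R[i]) cmod0 divr_ge0.
have c1 : \int[mu]_(y in `]a, b]) cos (t * y) = t^-1 * sin (t * b) - t^-1 * sin (t * a).
  apply: (@Rintegral_FTC2 _ (fun y => t^-1 * sin (t * y))) => //.
    move=> y; apply: continuous_comp; last exact: continuous_cos.
    by apply: continuousM; [exact: cvg_cst|exact: cvg_id].
  by move=> y; apply: is_derive_eq; rewrite -![_ *: _]/(_ * _); field.
have c2 : \int[mu]_(y in `]a, b]) sin (t * y) = - t^-1 * cos (t * b) - - t^-1 * cos (t * a).
  apply: (@Rintegral_FTC2 _ (fun y => - t^-1 * cos (t * y))) => //.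
    move=> y; apply: continuous_comp; last exact: continuous_sin.
    by apply: continuousM; [exact: cvg_cst|exact: cvg_id].
  by move=> y; apply: is_derive_eq; rewrite -![_ *: _]/(_ * _); field.
rewrite cint_itv /cexpi /cre /cim/= c1 c2; apply: (le_trans (cmod_le_sum _)).
rewrite /cre /cim/=.
have h (u v : R) : `|u| <= 1 -> `|v| <= 1 -> `|t^-1 * u - t^-1 * v| <= 2 / `|t|.
  move=> u1 v1; rewrite -mulrBr normrM normfV mulrC ler_wpM2r ?invr_ge0//.
  by rewrite (le_trans (ler_normB _ _))// -[2]/(1 + 1) lerD.
have -> : 4 / `|t| = 2 / `|t| + 2 / `|t| by rewrite -mulrDl; congr (_ / _); ring.
apply: lerD; first by apply: h; rewrite ler_norml sin_geN1 sin_le1.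
have -> : - t^-1 * cos (t * b) - - t^-1 * cos (t * a) = t^-1 * cos (t * a) - t^-1 * cos (t * b) by ring.
by apply: h; rewrite ler_norml cos_geN1 cos_le1.
Qed.

Variable N : nat.
Local Notation nu := (@lebN R N).

Lemma fint_box (a b : 'I_N -> R) (x : N.-tuple R) :
  fint (fun xi => rc (\1_(box a b) xi)) x =
  \prod_(i < N) cint mu (fun y => rc (\1_(`]a i, b i]%classic) y) * cexpi (tnth x i * y)).
Proof.
have cf i : cintegrable mu (fun y => rc (\1_(`]a i, b i]%classic) y) * cexpi (tnth x i * y)).
  by apply: cintegrable_cexpi; [exact: cintegrable_indic_itv|exact: measurable_funM].
have [_ <-] := cint_tuple_prod cf; apply: eq_cint => xi.
rewrite indic_box rc_prod big_split/=; congr (_ * _).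
rewrite /dotp; elim/big_rec2: _ => [|i z u _ <-]; last by rewrite cexpiD.
by apply: complexP; rewrite /cexpi /cre /cim/= ?cos0 ?sin0.
Qed.

Lemma vanishing_box (a b : 'I_N -> R) : (0 < N)%N -> vanishing (fint (fun xi => rc (\1_(box a b) xi))).
Proof.
move=> N0 e e0.
(* Adding 1 makes each bound at least 1, so that omitting the factor i from the product cannot
   increase it. *)
pose K i := 2 * \int[mu]_y cmod (rc (\1_(`]a i, b i]%classic) y)) + 1.
have Kge i t : cmod (cint mu (fun y => rc (\1_(`]a i, b i]%classic) y) * cexpi (t * y))) <= K i.
  rewrite /K ler_wpDr//; apply: cmod_cint_cexpi_le; first exact: cintegrable_indic_itv.
  exact: measurable_funM.
have K1 i : 1 <= K i by rewrite /K lerDr mulr_ge0// Rintegral_ge0// => y _; exact: cmod_ge0.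
pose KK := \prod_(i < N) K i; have KK0 : 0 < KK.
  by apply: prodr_gt0 => i _; exact: lt_le_trans ltr01 (K1 i).
exists (N%:R * (4 * KK / e)) => x /enorm_lt_coord[i hi].
have t0 : 0 < `|tnth x i| by apply: le_lt_trans hi; rewrite divr_ge0 ?mulr_ge0 ?ltW.
rewrite fint_box (_ : cmod _ = \prod_(j < N)
  cmod (cint mu (fun y => rc (\1_(`]a j, b j]%classic) y) * cexpi (tnth x j * y)))); last first.
  by elim/big_rec2: _ => [|j z u _ <-]; rewrite ?cmodM// -[1]/(rc 1) cmod_rc normr1.
rewrite (bigD1 i)//=; apply: (@le_lt_trans _ _ (4 / `|tnth x i| * KK)).
  apply: ler_pM; rewrite ?cmod_ge0 ?prodr_ge0//.
  - by move=> j _; exact: cmod_ge0.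
  - by apply: cmod_cint_itv_cexpi; rewrite -normr_gt0.
  - apply: (@le_trans _ _ (\prod_(j < N | j != i) K j)).
      by apply: ler_prod => j _; rewrite cmod_ge0 Kge.
    rewrite /KK [leRHS](bigD1 i)//= ler_peMl// ?K1//.
    by apply: prodr_ge0 => j _; exact: le_trans ler01 (K1 j).
by move: hi; rewrite ltr_pdivrMr// => hi; rewrite mulrAC ltr_pdivrMr// [ltRHS]mulrC.
Qed.

Lemma rcB (x y : R) : rc (x - y) = rc x - rc y.
Proof. by apply: complexP; rewrite ?creB ?cimB !(cre_rc, cim_rc) ?subrr. Qed.

Lemma rcD (x y : R) : rc (x + y) = rc x + rc y.
Proof. by apply: complexP; rewrite ?creD ?cimD !(cre_rc, cim_rc) ?addr0. Qed.

Lemma indic_ge0 (T : Type) (A : set T) x : 0 <= \1_A x :> R.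
Proof. by []. Qed.

Lemma indic_le1 (T : Type) (A : set T) x : \1_A x <= 1 :> R.
Proof. by rewrite indicE; case: (_ \in _). Qed.

Lemma vanishing_fint_sum (I : Type) (s : seq I) (G : I -> N.-tuple R -> R[i]) :
  (forall i, cintegrable nu (G i)) -> (forall i, vanishing (fint (G i))) ->
  cintegrable nu (fun xi => \sum_(i <- s) G i xi) /\
  vanishing (fint (fun xi => \sum_(i <- s) G i xi)).
Proof.
move=> cG vG; elim: s => [|i s [IH1 IH2]].
  under eq_fun do rewrite big_nil; split.
    apply: (cintegrable_dom _ (integrable0 _ _)); first exact: cmeas_cst.
    by move=> x; rewrite cmod0.
  move=> e e0; exists 0 => x _; rewrite /fint (_ : cint _ _ = 0) ?cmod0//.
  under eq_cint do rewrite mul0r.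
  by apply: complexP; rewrite /cint /cre /cim/= Rintegral_cst// mul0r.
under eq_fun do rewrite big_cons; split; first exact: cintegrableD.
rewrite (_ : fint _ = fun x => fint (G i) x + fint (fun xi => \sum_(i <- s) G i xi) x).
  exact: vanishingD.
by apply/funext => x; rewrite fintD.
Qed.

Lemma cintegrable_indic_cube (f : N.-tuple R -> R) n : measurable_fun setT f ->
  (forall xi, `|f xi| <= 1) -> cintegrable nu (fun xi => rc (f xi * \1_(cube n) xi)).
Proof.
move=> mf f1; apply: (cintegrable_dom _ (integrable_indic_box (fun=> - n%:R) (fun=> n%:R))).
  apply: cmeas_rc; apply: measurable_funM => //.
  by apply: measurable_indic; exact: measurable_box.
by move=> xi; rewrite cmod_rc normrM (ger0_norm (indic_ge0 _ _)) ler_piMl.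
Qed.

(** A Dynkin argument started from boxes. Complements are differences within the cube, and disjoint
    unions are L1 limits of finite sums; the cube supplies the integrable majorant for that
    limit. *)
Lemma vanishing_set (A : set (N.-tuple R)) n : (0 < N)%N -> measurable A ->
  vanishing (fint (fun xi => rc (\1_A xi * \1_(cube n) xi))).
Proof.
move=> N0; rewrite measurable_boxesE; move: A.
have m1 S : measurable S -> measurable_fun setT (\1_S : N.-tuple R -> R) by exact: measurable_indic.
have n1 S (xi : N.-tuple R) : `|\1_S xi| <= 1 :> R by rewrite ger0_norm// indic_le1.
have ci S : measurable S -> cintegrable nu (fun xi => rc (\1_S xi * \1_(cube n) xi)).
  by move=> mS; apply: cintegrable_indic_cube => //; exact: m1.
have cubeE : fint (fun xi => rc (\1_setT xi * \1_(cube n) xi)) =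
    fint (fun xi => rc (\1_(@cube R N n) xi)).
  by apply/funext => x; apply: eq_cint => xi; rewrite indicT mul1r.
apply: (@dynkin_induction _ _ (@boxes R N)).
- exact: measurable_boxesE.
- exact: setI_closed_boxes.
- by rewrite cubeE; exact: vanishing_box.
- move=> _ [a [b ->]].
  have [||a' [b' E]] := @setI_closed_boxes R N (box a b) (cube n); [by exists a, b|by exists (fun=> - n%:R), (fun=> n%:R)|].
  have -> : fint (fun xi => rc (\1_(box a b) xi * \1_(cube n) xi)) = fint (fun xi => rc (\1_(box a' b') xi)).
    by apply/funext => x; apply: eq_cint => xi; rewrite -E indicI.
  exact: vanishing_box.
- move=> S mS vS.
  have -> : fint (fun xi => rc (\1_(~` S) xi * \1_(cube n) xi)) =
      (fun x => fint (fun xi => rc (\1_setT xi * \1_(cube n) xi)) x + (-1) * fint (fun xi => rc (\1_S xi * \1_(cube n) xi)) x).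
    apply/funext => x; rewrite mulN1r -fintB; [|exact: ci|exact: ci].
    apply: eq_cint => xi; congr (_ * _); rewrite indicT mul1r indicC.
    rewrite -rcB [\1_S xi]indicE; case: (xi \in S); rewrite /= ?mul1r ?mul0r ?subrr ?subr0//.
  apply: vanishingD; last exact: vanishingZ.
  by rewrite cubeE; exact: vanishing_box.
- move=> F mF tF vF; have mU : measurable (\bigcup_k F k) by exact: bigcup_measurable.
  pose S m xi : R := \sum_(0 <= k < m) \1_(F k) xi.
  have mS m : measurable_fun setT (S m) by apply: measurable_sum => k; exact: m1.
  have S0 m xi : 0 <= S m xi by apply: sumr_ge0.
  have SU m xi : S m xi <= \1_(\bigcup_k F k) xi by have [+ _] := @cvg_indic_bigcup R _ F xi tF; exact.
  have S1 m xi : `|S m xi| <= 1 by rewrite ger0_norm// (le_trans (SU m xi))// indic_le1.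
  apply: vanishing_approx; first exact: ci.
  move=> e e0.
  have cvg0 : \int[nu]_xi cmod (rc (\1_(\bigcup_k F k) xi * \1_(cube n) xi) - rc (S m xi * \1_(cube n) xi)) @[m --> \oo] --> \int[nu]_xi (0 : R).
    apply: (@Rintegral_dominated_cvg _ _ _ nu _ _ (fun xi => \1_(cube n) xi)).
    - move=> m; apply: measurable_cmod; apply: cmeasB.
        exact: (cintegrable_meas (ci _ mU)).
      exact: (cintegrable_meas (cintegrable_indic_cube n (mS m) (S1 m))).
    - exact: measurable_cst.
    - exact: integrable_indic_box.
    - move=> m xi; rewrite ger0_norm ?cmod_ge0//.
      rewrite (_ : rc _ - rc _ = rc ((\1_(\bigcup_k F k) xi - S m xi) * \1_(cube n) xi)); last first.
        by rewrite -rcB mulrBl.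
      rewrite cmod_rc normrM (ger0_norm (indic_ge0 _ _)) ler_piMl// ger0_norm ?subr_ge0//.
      by rewrite lerBlDr (le_trans (indic_le1 _ _))// lerDl.
    - apply: aeW => xi.
      have [_ c] := @cvg_indic_bigcup R _ F xi tF.
      have -> : (fun m => cmod (rc (\1_(\bigcup_k F k) xi * \1_(cube n) xi) - rc (S m xi * \1_(cube n) xi))) =
          (fun m => `|(\1_(\bigcup_k F k) xi - S m xi) * \1_(cube n) xi|).
        by apply/funext => m; rewrite -rcB cmod_rc mulrBl.
      rewrite -[X in _ --> X](@normr0 _ R) -[X in `|X|](mul0r (\1_(@cube R N n) xi)) -(subrr (\1_(\bigcup_k F k) xi : R)).
      apply: cvg_norm; apply: cvgM; last exact: cvg_cst.
      by apply: cvgB; [exact: cvg_cst|exact: c].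
  rewrite Rintegral_cst// mul0r in cvg0.
  move/cvgrPdist_lt : cvg0 => /(_ _ e0) [m _ /(_ m (leqnn m))] /=; rewrite sub0r normrN => hm.
  exists (fun xi => rc (S m xi * \1_(cube n) xi)); split.
  + exact: cintegrable_indic_cube.
  + have [_] := vanishing_fint_sum (index_iota 0 m) (fun k => ci _ (mF k)) vF.
    congr (vanishing (fint _)); apply/funext => xi; rewrite /S mulr_suml.
    by elim/big_rec2: _ => // k z u _ ->; rewrite rcD.
  + exact: le_lt_trans (ler_norm _) hm.
Qed.

(** Two L1 approximations, each within e / 2: cutting f off outside a cube, and replacing it by a
    simple function. The simple function is cut off too, so that its level sets meet the cube as
    [vanishing_set] demands. *)
Lemma vanishing_real (f : N.-tuple R -> R) : (0 < N)%N -> nu.-integrable setT (fun xi => (f xi)%:E) ->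
  vanishing (fint (fun xi => rc (f xi))).
Proof.
move=> N0 i_f; have /measurable_int/measurable_EFinP mf := i_f.
have cfc (g : N.-tuple R -> R) : nu.-integrable setT (fun xi => (g xi)%:E) -> cintegrable nu (fun xi => rc (g xi)).
  by move=> ig; split => //; exact: integrable0.
have mc n : measurable_fun setT (\1_(@cube R N n) : N.-tuple R -> R).
  by apply: measurable_indic; exact: measurable_box.
have icube (g : N.-tuple R -> R) n : nu.-integrable setT (fun xi => (g xi)%:E) ->
    nu.-integrable setT (fun xi => (g xi * \1_(cube n) xi)%:E).
  move=> ig; have /measurable_int/measurable_EFinP mg := ig.
  apply: (le_integrable measurableT _ _ ig).
    by apply/measurable_EFinP; exact: measurable_funM.
  by move=> xi _; rewrite lee_fin normrM ler_piMr// ger0_norm// indic_le1.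
have iB (g h : N.-tuple R -> R) : nu.-integrable setT (fun xi => (g xi)%:E) ->
    nu.-integrable setT (fun xi => (h xi)%:E) -> nu.-integrable setT (fun xi => (g xi - h xi)%:E).
  by move=> ig ih; under eq_fun do rewrite EFinB; exact: integrableB.
have subrc (a b : R) : cmod (rc a - rc b) = `|a - b|.
  by rewrite -rcB cmod_rc.
apply: vanishing_approx => [|e e0]; first exact: cfc.
have e2 : 0 < e / 2 by rewrite divr_gt0.
have [n hn] : exists n, \int[nu]_xi `|f xi - f xi * \1_(cube n) xi| < e / 2.
  have : \int[nu]_xi `|f xi - f xi * \1_(cube n) xi| @[n --> \oo] --> \int[nu]_xi (0 : R).
    apply: (Rintegral_dominated_cvg _ _ (integrable_norm i_f)).
    - by move=> n; apply: measurableT_comp => //; apply: measurable_funB => //; exact: measurable_funM.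
    - exact: measurable_cst.
    - move=> n xi; rewrite normr_id -{1}[f xi]mulr1 -mulrBr normrM ler_piMr//.
      by rewrite ger0_norm ?subr_ge0 ?indic_le1// gerBl.
    - apply: aeW => xi; have [n0 h0] := tnth_lt_nat xi.
      apply: cvg_near_cst; exists n0 => // n /= n0n.
      rewrite indicE mem_set ?mulr1 ?subrr ?normr0// => i.
      have := h0 i; rewrite ltr_norml => /andP[h1 h2].
      have nn : n0%:R <= n%:R :> R by rewrite ler_nat.
      by rewrite (le_lt_trans _ h1) ?lerN2//= (le_trans (ltW h2)).
  rewrite Rintegral_cst// mul0r => /cvgrPdist_lt /(_ _ e2) [n _ /(_ n (leqnn n))] /=.
  by rewrite sub0r normrN => h; exists n; exact: le_lt_trans (ler_norm _) h.
have [g [ig _ gc]] := approximation_sfun_integrable measurableT i_f.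
have [m hm] : exists m, \int[nu]_xi `|f xi - HBSimple.SimpleFun.sort (g m) xi| < e / 2.
  have [m _ /(_ m (leqnn m))] : \forall m \near \oo, (\int[nu]_z `|(f z)%:E - (HBSimple.SimpleFun.sort (g m) z)%:E| < (e / 2)%:E)%E.
    by apply: (gc (fun u => u < (e / 2)%:E)%E); apply: open_ereal_lt'; rewrite lte_fin.
  move=> hm; exists m; rewrite -lte_fin; apply: le_lt_trans hm.
  rewrite /Rintegral fineK//.
  apply: (integrable_fin_num measurableT); apply: integrable_norm.
  by apply: iB => //; exact: ig.
pose gm := HBSimple.SimpleFun.sort (g m).
exists (fun xi => rc (gm xi * \1_(cube n) xi)); split.
- by apply: cfc; apply: icube; exact: ig.
- have [k [c [gE mA]]] := sfun_sum_indic (g m); rewrite -/gm in gE mA.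
  have ci i : cintegrable nu (fun xi => rc (\1_(gm @^-1` [set c i]) xi * \1_(cube n) xi)).
    apply: cintegrable_indic_cube; first exact: measurable_indic.
    by move=> xi; rewrite ger0_norm// indic_le1.
  have [||_] := vanishing_fint_sum (index_enum 'I_k) (G := fun (i : 'I_k) xi =>
    rc (c i) * rc (\1_(gm @^-1` [set c i]) xi * \1_(cube n) xi)).
  + by move=> i; apply: cintegrableZ; exact: ci.
  + move=> i; rewrite (_ : fint _ = (fun x => rc (c i) * fint (fun xi => rc (\1_(gm @^-1` [set c i]) xi * \1_(cube n) xi)) x)).
      by apply: vanishingZ; exact: vanishing_set.
    by apply/funext => x; rewrite fintZ//; exact: ci.
  + congr (vanishing (fint _)); apply/funext => xi; rewrite gE mulr_suml.
    by elim/big_rec2: _ => // i z u _ ->; rewrite rcD -rcM mulrA.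
- rewrite (splitr e); apply: le_lt_trans (ltrD hn hm).
  have ifc := icube f n i_f.
  have ia : nu.-integrable setT (fun xi => (`|f xi - f xi * \1_(cube n) xi|)%:E).
    by apply: integrable_norm; exact: iB.
  have ib : nu.-integrable setT (fun xi => (`|f xi - gm xi|)%:E).
    by apply: integrable_norm; apply: iB => //; exact: ig.
  rewrite -RintegralD//; apply: le_Rintegral => //.
  + under eq_fun do rewrite subrc; apply: integrable_norm.
    by apply: iB => //; apply: icube; exact: ig.
  + by rewrite (_ : _ \o _ = (fun x => `|f x - f x * \1_(cube n) x|%:E + `|f x - gm x|%:E)%E)//; exact: integrableD.
  + move=> xi _; rewrite subrc.
    have -> : f xi - gm xi * \1_(cube n) xi = (f xi - f xi * \1_(cube n) xi) + (f xi - gm xi) * \1_(cube n) xi by ring.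
    rewrite (le_trans (ler_normD _ _))// lerD2l normrM ler_piMr// ger0_norm// indic_le1.
Qed.

Lemma riemann_lebesgue (G : N.-tuple R -> R[i]) : (0 < N)%N -> cintegrable nu G -> vanishing (fint G).
Proof.
move=> N0 cG; have [c1 c2] := cG.
have d1 : cintegrable nu (fun xi => rc (cre (G xi))) by split => //; exact: integrable0.
have d2 : cintegrable nu (fun xi => rc (cim (G xi))) by split => //; exact: integrable0.
rewrite (_ : fint G = (fun x => fint (fun xi => rc (cre (G xi))) x +
   Complex 0 1 * fint (fun xi => rc (cim (G xi))) x)).
  by apply: vanishingD; [|apply: vanishingZ]; exact: vanishing_real.
apply/funext => x; rewrite -fintZ// -fintD//; last exact: cintegrableZ.
apply: eq_cint => xi; congr (_ * _); apply: complexP.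
  by rewrite creD creM !cre_rc !cim_rc /cre /cim /=; ring.
by rewrite cimD cimM !cre_rc !cim_rc /cre /cim /=; ring.
Qed.

End RiemannLebesgue.

(** * Fourier inversion *)

Section PoissonKernel.
Context {R : realType}.
Local Notation mu := (@lebesgue_measure R).

Let continuous_expabs (eps : R) : continuous (fun x : R => expR (- (eps * `|x|))).
Proof.
move=> x; apply: continuous_comp; last exact: continuous_expR.
by apply: continuousN; apply: continuousM; [exact: cvg_cst|exact: norm_continuous].
Qed.

Let continuous_scale (h : R -> R) (y : R) : continuous h -> continuous (fun x => h (y * x)).
Proof.
by move=> ch x; apply: continuous_comp; [apply: continuousM; [exact: cvg_cst|exact: cvg_id]|exact: ch].
Qed.

(** The summand 1 makes the integrand nonnegative, so that reflection and the fundamental theorem on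
    a half-line apply without prior integrability. It is removed again in [cint_expabs_cexpi]. *)
Lemma integral_expabs_cos (eps y : R) : 0 < eps ->
  (\int[mu]_x (expR (- (eps * `|x|)) * (1 + cos (y * x)))%:E =
   (2 * (eps^-1 + eps / (eps ^+ 2 + y ^+ 2)))%:E)%E.
Proof.
move=> e0; pose D := eps ^+ 2 + y ^+ 2.
have D0 : 0 < D by rewrite ltr_pwDl ?exprn_gt0 ?sqr_ge0.
have f0 x : 0 <= 1 + cos (y * x) by rewrite -lerBlDl sub0r cos_geN1.
have cg : continuous (fun x : R => expR (- (eps * `|x|)) * (1 + cos (y * x))).
  move=> x; apply: cvgM; first exact: continuous_expabs.
  by apply: cvgD; [exact: cvg_cst|apply: continuous_scale; exact: continuous_cos].
rewrite ge0_symfun_integralT; last 3 first.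
- by move=> x; rewrite mulr_ge0 ?expR_ge0.
- exact: cg.
- by move=> x /=; rewrite normrN mulrN cosN.
rewrite -set_itvcy; pose g x := expR (- (eps * x)) * (1 + cos (y * x)).
rewrite (_ : (\int[mu]_(x in _) _)%E = (\int[mu]_(x in `[0%R, +oo[) (g x)%:E)%E); last first.
  by apply: eq_integral => x; rewrite inE/= in_itv/= andbT => x0; rewrite ger0_norm.
pose F x := - expR (- (eps * x)) * (eps^-1 + (eps * cos (y * x) - y * sin (y * x)) / D).
have ce (c : R) : continuous (fun x : R => expR (- (c * x))).
  move=> x; apply: continuous_comp; last exact: continuous_expR.
  by apply: continuousN; apply: continuousM; [exact: cvg_cst|exact: cvg_id].
rewrite [X in (_ * X)%E](@ge0_FTC2y_is_derive _ g F 0 0).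
- rewrite -EFinM; congr (_%:E); rewrite /F !mulr0 oppr0 expR0 cos0 sin0 /D; field.
  by rewrite gt_eqF//= gt_eqF.
- by move=> x _; rewrite mulr_ge0 ?expR_ge0.
- move=> x _; apply: cvgM; first exact: ce.
  by apply: cvgD; [exact: cvg_cst|apply: continuous_scale; exact: continuous_cos].
- move=> x _; rewrite /F; apply: is_derive_eq; rewrite -![_ *: _]/(_ * _) /g /D; field.
  by rewrite gt_eqF//= gt_eqF.
- pose K := eps^-1 + (eps + `|y|) / D.
  have K0 : 0 <= K by rewrite addr_ge0 ?invr_ge0 ?(ltW e0)// divr_ge0 ?(ltW D0)// addr_ge0// ltW.
  apply/cvgr0Pnorm_lt => e e_gt0.
  have : expR (- (eps * x)) * K @[x --> +oo] --> (0 : R).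
    by rewrite -[X in _ --> X](mul0r K); apply: cvgM; [exact: cvg_expRN_pinfty|exact: cvg_cst].
  move/cvgr0Pnorm_lt => /(_ _ e_gt0); apply: filterS => x; apply: le_lt_trans.
  rewrite /F mulNr normrN !normrM (ger0_norm (expR_ge0 _)) ler_wpM2l ?expR_ge0//.
  rewrite (ger0_norm K0) (le_trans (ler_normD _ _))// (@ger0_norm _ eps^-1) ?invr_ge0 ?(ltW e0)// /K lerD2l.
  rewrite normrM (@ger0_norm _ D^-1) ?invr_ge0 ?(ltW D0)// ler_wpM2r ?invr_ge0 ?(ltW D0)//.
  rewrite (le_trans (ler_normB _ _))// !normrM (ger0_norm (ltW e0)); apply: lerD.
    by rewrite ler_piMr ?(ltW e0)// ler_norml cos_geN1 cos_le1.
  by rewrite ler_piMr// ler_norml sin_geN1 sin_le1.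
Qed.

Lemma integral_expabs (eps : R) : 0 < eps ->
  (\int[mu]_x (expR (- (eps * `|x|)))%:E = (2 / eps)%:E)%E.
Proof.
move=> e0; have := integral_expabs_cos 0 e0.
under eq_integral do rewrite mul0r cos0 mulrC EFinM.
rewrite ge0_integralZl//; last first.
  by apply/measurable_EFinP; apply: continuous_measurable_fun; exact: continuous_expabs.
move=> h; have {}h := congr1 (fun u => 2^-1%:E * u)%E h.
rewrite muleA -!EFinM (_ : 2^-1 * (1 + 1) = 1 :> R) ?mul1e in h; last by field.
by rewrite h; congr (_%:E); field; rewrite gt_eqF.
Qed.

Lemma integrable_expabs (eps : R) : 0 < eps ->
  mu.-integrable setT (fun x => (expR (- (eps * `|x|)))%:E).
Proof.
move=> e0; apply/integrableP; split.
  by apply/measurable_EFinP; apply: continuous_measurable_fun; exact: continuous_expabs.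
by under eq_integral do rewrite gee0_abs ?lee_fin ?expR_ge0//; rewrite integral_expabs// ltry.
Qed.

Lemma cint_expabs_cexpi (eps y : R) : 0 < eps ->
  cintegrable mu (fun x => rc (expR (- (eps * `|x|))) * cexpi (y * x)) /\
  cint mu (fun x => rc (expR (- (eps * `|x|))) * cexpi (y * x)) = rc (2 * eps / (eps ^+ 2 + y ^+ 2)).
Proof.
move=> e0; have ie := integrable_expabs e0.
have me : measurable_fun setT (fun x : R => expR (- (eps * `|x|))).
  by apply: continuous_measurable_fun; exact: continuous_expabs.
have ci : cintegrable mu (fun x => rc (expR (- (eps * `|x|))) * cexpi (y * x)).
  apply: (cintegrable_dom _ ie).
    apply: cmeasM; first exact: cmeas_rc.
    by apply: cmeas_cexpi; apply: measurable_funM => //; exact: measurable_cst.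
  by move=> x; rewrite cmodM cmod_cexpi mulr1 cmod_rc ger0_norm ?expR_ge0.
split => //; have [c1 c2] := ci.
have {}c1 : mu.-integrable setT (fun x => (expR (- (eps * `|x|)) * cos (y * x))%:E).
  by apply: eq_integrable c1 => // x _; rewrite cre_rcM.
have {}c2 : mu.-integrable setT (fun x => (expR (- (eps * `|x|)) * sin (y * x))%:E).
  by apply: eq_integrable c2 => // x _; rewrite cim_rcM.
have RE : \int[mu]_x expR (- (eps * `|x|)) = 2 / eps by rewrite /Rintegral integral_expabs.
apply: complexP; rewrite ?cre_rc ?cim_rc.
  transitivity (\int[mu]_x (expR (- (eps * `|x|)) * cos (y * x))).
    by apply: eq_Rintegral => x _; rewrite cre_rcM.
  have : \int[mu]_x (expR (- (eps * `|x|)) * (1 + cos (y * x))) =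
      2 * (eps^-1 + eps / (eps ^+ 2 + y ^+ 2)) by rewrite /Rintegral integral_expabs_cos.
  under eq_Rintegral do rewrite mulrDr mulr1.
  by rewrite RintegralD// RE mulrDr mulrA => /addrI.
transitivity (\int[mu]_x (expR (- (eps * `|x|)) * sin (y * x))).
  by apply: eq_Rintegral => x _; rewrite cim_rcM.
(* Adding 1 to the sine makes the function nonnegative, hence invariant in integral under
   reflection; as the sine is odd, its own integral must be 0. *)
pose f x := expR (- (eps * `|x|)) * (1 + sin (y * x)).
have f0 x : 0 <= f x by rewrite mulr_ge0 ?expR_ge0// -lerBlDl sub0r sin_geN1.
have mf : measurable_fun setT f.
  apply: continuous_measurable_fun => x; apply: cvgM; first exact: continuous_expabs.
  by apply: cvgD; [exact: cvg_cst|apply: continuous_scale; exact: continuous_sin].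
have h : \int[mu]_x f (- x) = \int[mu]_x f x.
  rewrite /Rintegral; congr fine; apply: (@ge0_integral_opp _ (fun x => (f x)%:E)) => //.
  exact/measurable_EFinP.
have E1 : \int[mu]_x f x = 2 / eps + \int[mu]_x (expR (- (eps * `|x|)) * sin (y * x)).
  by rewrite -RE -RintegralD//; apply: eq_Rintegral => x _; rewrite /f mulrDr mulr1.
have E2 : \int[mu]_x f (- x) = 2 / eps - \int[mu]_x (expR (- (eps * `|x|)) * sin (y * x)).
  by rewrite -RE -RintegralB//; apply: eq_Rintegral => x _; rewrite /f mulrDr mulr1 normrN mulrN sinN mulrN.
by move: h; rewrite E1 E2; move: (\int[mu]_x _) => I; lra.
Qed.

End PoissonKernel.

Section ParametricIntegral.
Context d1 d2 (T1 : measurableType d1) (T2 : measurableType d2) (R : realType).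
Variable m2 : {sigma_finite_measure set T2 -> \bar R}.

(** Tonelli's measurability statement applied to positive and negative parts separately. *)
Lemma measurable_Rintegral_param (f : T1 * T2 -> R) : measurable_fun setT f ->
  measurable_fun setT (fun x => \int[m2]_y f (x, y)).
Proof.
move=> mf; have mE : measurable_fun setT (fun z => (f z)%:E) by exact/measurable_EFinP.
rewrite /Rintegral; apply: (measurableT_comp (fine_measurable measurableT)).
have -> : (fun x => \int[m2]_y (f (x, y))%:E)%E =
  (fubini_F m2 ((fun z => (f z)%:E)^\+) \- fubini_F m2 ((fun z => (f z)%:E)^\-))%E.
  apply/funext => x; rewrite [LHS]integralE /fubini_F.
  by congr (_ - _)%E; apply: eq_integral => y _; rewrite ?funeposE ?funenegE.
apply: emeasurable_funB; apply: measurable_fun_fubini_tonelli_F => //.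
- exact: measurable_funepos.
- exact: measurable_funeneg.
Qed.

Lemma cmeas_cint_param (f : T1 * T2 -> R[i]) : cmeas f ->
  cmeas (fun x => cint m2 (fun y => f (x, y))).
Proof. by move=> [mf1 mf2]; split; [exact: (measurable_Rintegral_param mf1)|exact: (measurable_Rintegral_param mf2)]. Qed.

End ParametricIntegral.

Section ComplexAux.
Context {R : realType}.

Lemma cexpi0 : cexpi (0 : R) = 1.
Proof. by apply: complexP; rewrite /cexpi /cre /cim/= ?cos0 ?sin0. Qed.

Lemma cexpi_sum (I : Type) (s : seq I) (f : I -> R) :
  cexpi (\sum_(i <- s) f i) = \prod_(i <- s) cexpi (f i).
Proof. by elim/big_rec2: _ => [|i z u _ <-]; rewrite ?cexpi0// cexpiD. Qed.

Lemma cmod1 : cmod (1 : R[i]) = 1.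
Proof. by rewrite -[1]/(rc 1) cmod_rc normr1. Qed.

Lemma cmod_prod (I : Type) (s : seq I) (f : I -> R[i]) :
  cmod (\prod_(i <- s) f i) = \prod_(i <- s) cmod (f i).
Proof. by elim/big_rec2: _ => [|j z u _ <-]; rewrite ?cmodM ?cmod1. Qed.

Lemma ccvg_prod (I : Type) (s : seq I) (u : I -> nat -> R[i]) (l : I -> R[i]) :
  (forall i, ccvg (u i) (l i)) -> ccvg (fun n => \prod_(i <- s) u i n) (\prod_(i <- s) l i).
Proof.
move=> ul; elim: s => [|i s IH].
  by under eq_fun do rewrite big_nil; rewrite big_nil; exact: ccvg_cst.
by under eq_fun do rewrite big_cons; rewrite big_cons; exact: ccvgM.
Qed.

End ComplexAux.

Section PoissonStep.
Context {R : realType} (a b : R).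
Hypothesis ab : a < b.
Local Notation mu := (@lebesgue_measure R).
Implicit Types (d x xi : R).

Definition itv_ft xi := cint mu (fun z => rc (\1_(`]a, b]%classic) z) * cexpi (xi * z)).

(** [itv_ft] decays only like 1/|xi| and is not integrable; the exponential makes it so. The phase
    [cexpi (d * xi)] translates the smoothed interval by d on the space side. *)
Definition damped_ft d xi := rc (expR (- (d ^+ 2 * `|xi|))) * cexpi (d * xi) * itv_ft xi.

(* Shifting by [d], which is large compared with the scale [d ^+ 2], makes the limit [d --> 0]
   equal to the indicator of the half-open interval at the end points as well. *)
Definition poisson_step d x := (atan ((b + d - x) / d ^+ 2) - atan ((a + d - x) / d ^+ 2)) / pi.

Lemma cmeas_itv_ft : cmeas itv_ft.
Proof.
apply: (@cmeas_cint_param _ _ (measurableTypeR R) _ _ mu (fun z => rc (\1_(`]a, b]%classic) z.2) * cexpi (z.1 * z.2))).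
apply: cmeasM.
  by apply: cmeas_rc; apply: (measurableT_comp (measurable_indic _)) => //; exact: measurable_snd.
by apply: cmeas_cexpi; apply: measurable_funM; [exact: measurable_fst|exact: measurable_snd].
Qed.

Definition itv_ft_bound := 2 * \int[mu]_y \1_(`]a, b]%classic) y.

Lemma cmod_itv_ft xi : cmod (itv_ft xi) <= itv_ft_bound.
Proof.
rewrite /itv_ft_bound (_ : \int[mu]_y _ = \int[mu]_y cmod (rc (\1_(`]a, b]%classic) y))).
  by apply: cmod_cint_cexpi_le; [exact: cintegrable_indic_itv|exact: measurable_funM].
by apply: eq_Rintegral => y _; rewrite cmod_rc ger0_norm.
Qed.

Let mexp d : measurable_fun setT (fun xi => expR (- (d ^+ 2 * `|xi|))).
Proof.
apply: measurableT_comp; first exact: measurable_expR.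
by apply: measurable_funN; apply: measurable_funM => //; exact: measurable_cst.
Qed.

Lemma cmeas_damped_ft d : cmeas (damped_ft d).
Proof.
apply: cmeasM; last exact: cmeas_itv_ft.
apply: cmeasM; first exact: cmeas_rc.
by apply: cmeas_cexpi; apply: measurable_funM => //; exact: measurable_cst.
Qed.

Lemma cmod_damped_ft_le d xi :
  cmod (damped_ft d xi) <= expR (- (d ^+ 2 * `|xi|)) * itv_ft_bound.
Proof.
rewrite !cmodM cmod_cexpi mulr1 cmod_rc ger0_norm ?expR_ge0//.
by rewrite ler_wpM2l ?expR_ge0// cmod_itv_ft.
Qed.

Lemma itv_ft_bound_ge0 : 0 <= itv_ft_bound.
Proof. exact: le_trans (cmod_ge0 _) (cmod_itv_ft 0). Qed.

Lemma cmod_damped_ft d xi : cmod (damped_ft d xi) <= itv_ft_bound.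
Proof.
apply: (le_trans (cmod_damped_ft_le _ _)); rewrite ler_piMl ?itv_ft_bound_ge0//.
by rewrite -expR0 ler_expR oppr_le0 mulr_ge0 ?sqr_ge0.
Qed.

Lemma cintegrable_damped_ft d : 0 < d -> cintegrable mu (damped_ft d).
Proof.
move=> d0; have ie := integrable_expabs (exprn_gt0 2 d0).
have {}ie : mu.-integrable setT (fun xi => (itv_ft_bound * expR (- (d ^+ 2 * `|xi|)))%:E).
  by under eq_fun do rewrite EFinM; exact: integrableZl.
apply: (cintegrable_dom _ ie); first exact: cmeas_damped_ft.
by move=> xi; rewrite [leRHS]mulrC cmod_damped_ft_le.
Qed.

(** After Fubini the integral in xi is a Poisson kernel of width d^2 evaluated at z + d - x, and
    integrating it over z in ]a, b] gives the arctangents. *)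
Lemma poisson_stepE d x : 0 < d ->
  cint mu (fun xi => damped_ft d xi * cexpi (- (x * xi))) = rc (2 * pi * poisson_step d x).
Proof.
move=> d0; have e0 : 0 < d ^+ 2 by rewrite exprn_gt0.
pose f (w : measurableTypeR R * measurableTypeR R) := rc (expR (- (d ^+ 2 * `|w.1|))) * rc (\1_(`]a, b]%classic) w.2) *
  cexpi ((w.2 + d - x) * w.1).
have cE : cintegrable mu (fun xi => rc (expR (- (d ^+ 2 * `|xi|)))).
  by split => //; [exact: integrable_expabs|exact: integrable0].
have cf : cintegrable (mu \x mu)%E f.
  apply: cintegrable_cexpi; first exact: (cintegrable_prod cE (cintegrable_indic_itv a b)).
  apply: measurable_funM; last exact: measurable_fst.
  by apply: measurable_funB; [apply: measurable_funD; [exact: measurable_snd|exact: measurable_cst]|exact: measurable_cst].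
transitivity (cint mu (fun xi => cint mu (fun z => f (xi, z)))).
  apply: eq_cint => xi; rewrite /damped_ft mulrAC -cintZ; last first.
    by apply: cintegrable_cexpi; [exact: cintegrable_indic_itv|exact: measurable_funM].
  apply: eq_cint => z; rewrite /f/= (_ : (z + d - x) * xi = d * xi + - (x * xi) + xi * z); last by ring.
  by rewrite !cexpiD; ring.
rewrite (cfubini cf).
transitivity (cint mu (fun z => rc (\1_(`]a, b]%classic) z) * rc (2 * d ^+ 2 / ((d ^+ 2) ^+ 2 + (z + d - x) ^+ 2)))).
  apply: eq_cint => z; have [ci <-] := @cint_expabs_cexpi R (d ^+ 2) (z + d - x) e0.
  by rewrite -cintZ//; apply: eq_cint => xi; rewrite /f/=; ring.
rewrite cint_itv; apply: complexP; rewrite ?cre_rc ?cim_rc /cre /cim/=; last first.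
  by rewrite Rintegral_cst//= mul0r.
have dd z : (d ^+ 2) ^+ 2 + (z + d - x) ^+ 2 != 0.
  by rewrite gt_eqF// ltr_pwDl ?exprn_gt0 ?sqr_ge0.
pose F z : R := 2 * atan ((z + d - x) / d ^+ 2).
transitivity (F b - F a); last first.
  by rewrite /poisson_step /F -mulrA (mulrC pi) divfK ?gt_eqF ?pi_gt0// mulrBr.
apply: (@Rintegral_FTC2 _ _ F a b ab).
  move=> z; apply: cvgM; first exact: cvg_cst.
  apply: cvgV; first exact: dd.
  apply: cvgD; first exact: cvg_cst.
  by apply: cvgM; (apply: cvgB; [apply: cvgD; [exact: cvg_id|exact: cvg_cst]|exact: cvg_cst]).
move=> z; rewrite /F.
have h1 : is_derive (z : R) (1 : R) (fun z : R => (z + d - x) / d ^+ 2) (d ^+ 2)^-1.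
  by apply: is_derive_eq; rewrite -![_ *: _]/(_ * _); ring.
have h := @is_derive1_comp _ atan (fun z => (z + d - x) / d ^+ 2) z _ _ (is_derive1_atan _) h1.
apply: is_derive_eq; rewrite -![_ *: _]/(_ * _).
have := dd z; move: (z + d - x) => y hy; field; rewrite hy /= !gt_eqF// ltr_pwDl ?sqr_ge0 ?exprn_gt0//.
Qed.

End PoissonStep.

Section PoissonStepLimit.
Context {R : realType} (a b : R).
Hypothesis ab : a < b.
Local Notation mu := (@lebesgue_measure R).
Implicit Types (d x : R).

(** The difference of two arctangents hides its decay in x; the mean value theorem exposes a
    quadratic one. *)
Lemma poisson_step_mvt d x : 0 < d -> exists2 z, a < z < b &
  poisson_step a b d x = (b - a) / pi * (d ^+ 2 / ((d ^+ 2) ^+ 2 + (z + d - x) ^+ 2)).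
Proof.
move=> d0; pose F z : R := atan ((z + d - x) / d ^+ 2).
have e0 : 0 < d ^+ 2 by rewrite exprn_gt0.
have dd z : (d ^+ 2) ^+ 2 + (z + d - x) ^+ 2 != 0.
  by rewrite gt_eqF// ltr_pwDl ?exprn_gt0 ?sqr_ge0.
have dF (z : R) : is_derive (z : R) (1 : R) F (d ^+ 2 / ((d ^+ 2) ^+ 2 + (z + d - x) ^+ 2)).
  have h1 : is_derive (z : R) (1 : R) (fun z : R => (z + d - x) / d ^+ 2) (d ^+ 2)^-1.
    by apply: is_derive_eq; rewrite -![_ *: _]/(_ * _); ring.
  have h := @is_derive1_comp _ atan (fun z => (z + d - x) / d ^+ 2) z _ _ (is_derive1_atan _) h1.
  apply: is_derive_eq.
  have := dd z; move: (z + d - x) => y hy; field; rewrite hy /= !gt_eqF// ltr_pwDl ?sqr_ge0 ?exprn_gt0//.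
have [|z zab e] := MVT ab (fun z _ => dF z).
  by apply: derivable_within_continuous => z _; have [] := dF z.
exists z; first by move: zab; rewrite in_itv.
by rewrite /poisson_step -/(F b) -/(F a) e; ring.
Qed.

Lemma poisson_step_le1 d x : `|poisson_step a b d x| <= 1.
Proof.
rewrite /poisson_step normrM normfV (gtr0_norm (pi_gt0 _)) ler_pdivrMr ?pi_gt0// mul1r.
rewrite ler_norml; have h1 := atan_gtNpi2; have h2 := atan_ltpi2.
have := h1 _ ((b + d - x) / d ^+ 2); have := h2 _ ((b + d - x) / d ^+ 2).
have := h1 _ ((a + d - x) / d ^+ 2); have := h2 _ ((a + d - x) / d ^+ 2).
move: (atan _) (atan _) => u v u1 u2 v1 v2; lra.
Qed.

(** The sum of the constants for two regimes, with L = |a| + |b| + 1. For |x| <= 2L the trivial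
    bound 1 is used. Beyond, 16 is the product of 4 from |z + d - x| >= |x| / 2 and 4 from 1 + |x|
    <= 2 |x|. *)
Definition poisson_bound : R := (1 + 2 * (`|a| + `|b| + 1)) ^+ 2 + 16 * (b - a).

Lemma poisson_step_bound d x : 0 < d <= 1 ->
  `|poisson_step a b d x| <= poisson_bound / (1 + `|x|) ^+ 2.
Proof.
move=> /andP[d0 d1]; pose L := `|a| + `|b| + 1.
have L0 : 1 <= L by rewrite lerDr addr_ge0.
have x1 : 0 < 1 + `|x| by rewrite ltr_pwDl.
have C2 : 0 <= 16 * (b - a) by rewrite mulr_ge0// subr_ge0 ltW.
have [xL|xL] := leP `|x| (2 * L).
  apply: (le_trans (poisson_step_le1 _ _)); rewrite ler_pdivlMr ?exprn_gt0// mul1r.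
  rewrite /poisson_bound -/L (@le_trans _ _ ((1 + 2 * L) ^+ 2))//; last by rewrite lerDl.
  by rewrite ler_sqr ?nnegrE ?(ltW x1)// ?lerD2l//; move: L L0 {xL} => L' ?; lra.
have [z /andP[az zb] ->] := poisson_step_mvt x d0.
have e0 : 0 < d ^+ 2 by rewrite exprn_gt0.
have e1 : d ^+ 2 <= 1 by rewrite expr_le1// ltW.
have zL : `|z| <= `|a| + `|b|.
  rewrite ler_norml; apply/andP; split.
    rewrite (le_trans _ (ltW az))// (@le_trans _ _ (- `|a|)) ?lerN2 ?lerDl//.
    by rewrite lerNl -normrN ler_norm.
  by rewrite (le_trans (ltW zb))// (le_trans (ler_norm b))// lerDr.
(* The centre z + d of the kernel has modulus at most L, which is less than |x| / 2. *)
have hw : `|x| / 2 <= `|z + d - x|.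
  have : `|x| <= `|z + d| + `|z + d - x|.
    have {1}-> : x = (z + d) - (z + d - x) by rewrite opprB addrC subrK.
    exact: ler_normB.
  have : `|z + d| <= L.
    by rewrite (le_trans (ler_normD _ _))// /L lerD// ger0_norm// ltW.
  by move: xL (`|z + d|) (`|z + d - x|) => xL u v; lra.
have x2 : 2 < `|x| by apply: le_lt_trans xL; rewrite ler_peMr.
have pi1 : 1 <= pi :> R by rewrite (le_trans _ (pi_ge2 _))// ler1n.
rewrite ger0_norm; last first.
  by rewrite mulr_ge0// divr_ge0 ?subr_ge0 ?(ltW ab) ?(ltW (pi_gt0 _)) ?(ltW e0)// addr_ge0// sqr_ge0.
apply: (@le_trans _ _ ((b - a) * (16 / (1 + `|x|) ^+ 2))); last first.
  rewrite mulrA ler_wpM2r ?invr_ge0 ?sqr_ge0// mulrC /poisson_bound lerDr.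
  by rewrite sqr_ge0.
apply: ler_pM.
- by rewrite divr_ge0 ?subr_ge0 ?(ltW ab) ?(ltW (pi_gt0 _)).
- by rewrite divr_ge0 ?(ltW e0)// addr_ge0// sqr_ge0.
- by rewrite ler_pdivrMr ?pi_gt0// ler_peMr// subr_ge0 ltW.
have w2 : `|x| ^+ 2 / 4 <= (z + d - x) ^+ 2.
  rewrite -[leRHS]real_normK ?num_real// (_ : _ / 4 = (`|x| / 2) ^+ 2); last by field.
  by rewrite ler_sqr ?nnegrE ?divr_ge0.
have x3 : (1 + `|x|) ^+ 2 <= 4 * `|x| ^+ 2.
  rewrite (_ : 4 * _ = (2 * `|x|) ^+ 2); last by ring.
  by rewrite ler_sqr ?nnegrE ?mulr_ge0 ?(ltW x1)//; lra.
rewrite ler_pdivrMr; last by rewrite ltr_pwDl ?exprn_gt0 ?sqr_ge0.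
rewrite mulrAC ler_pdivlMr ?exprn_gt0//.
apply: (@le_trans _ _ (1 * (1 + `|x|) ^+ 2)); first by rewrite ler_wpM2r ?sqr_ge0.
rewrite mul1r; have := sqr_ge0 (d ^+ 2); move: x3 w2; move: ((d ^+ 2) ^+ 2) ((z + d - x) ^+ 2) ((1 + `|x|) ^+ 2) (`|x| ^+ 2) => ? ? ? ? ? ? ?; lra.
Qed.

(** With d = 1/(n + 1) the argument is (c - x)(n + 1)^2 + (n + 1): the sign of c - x decides, and
    the linear term settles x = c in favour of + infinity. *)
Lemma cvg_atan_step (c x : R) :
  atan ((c + n.+1%:R^-1 - x) / n.+1%:R^-1 ^+ 2) @[n --> \oo] -->
  (if x <= c then pi / 2 else - (pi / 2)).
Proof.
have E n : (c + n.+1%:R^-1 - x) / n.+1%:R^-1 ^+ 2 = (c - x) * n.+1%:R ^+ 2 + n.+1%:R :> R.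
  have : n.+1%:R != 0 :> R by rewrite pnatr_eq0.
  by move: (n.+1%:R) => m m0; field; rewrite m0.
under eq_fun do rewrite E.
have ny : (n.+1%:R : R) @[n --> \oo] --> +oo.
  by apply: (@ger_cvgy _ _ _ _ (fun n : nat => n%:R)); [near=> n; rewrite ler_nat|exact: cvgr_idn].
case: ifPn => xc.
  apply: (@cvg_comp _ _ _ _ atan _ +oo); last exact: cvgy_atan.
  apply: ger_cvgy ny; near=> n; rewrite lerDr mulr_ge0 ?sqr_ge0 ?subr_ge0//.
have {}xc : 0 < x - c by rewrite subr_gt0 ltNge.
rewrite (_ : (fun n : nat => _) = (fun n : nat => - atan ((x - c) * n.+1%:R ^+ 2 - n.+1%:R))); last first.
  by apply/funext => n; rewrite -atanN; congr atan; ring.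
apply: cvgN; apply: (@cvg_comp _ _ _ _ atan _ +oo); last exact: cvgy_atan.
apply: (ger_cvgy _ ny).
(* Once n + 1 >= 2 / (x - c), half of the quadratic term dominates the linear one. *)
have /cvgryPge/(_ (2 / (x - c))) := ny; apply: filterS => n; rewrite ler_pdivrMr// mulrC => h.
rewrite lerBrDr expr2 mulrA (_ : n.+1%:R + _ = 2 * n.+1%:R); last by ring.
by rewrite ler_wpM2r.
Unshelve. all: by end_near. Qed.

Lemma cvg_poisson_step (x : R) :
  poisson_step a b n.+1%:R^-1 x @[n --> \oo] --> (\1_(`]a, b]%classic) x : R).
Proof.
have pi0 : pi != 0 :> R by rewrite gt_eqF// pi_gt0.
rewrite (_ : \1__ x = ((if x <= b then pi / 2 else - (pi / 2)) - (if x <= a then pi / 2 else - (pi / 2))) / pi).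
  by apply: cvgM; [apply: cvgB; exact: cvg_atan_step|exact: cvg_cst].
rewrite indicE; case: (leP x a) => xa.
  rewrite memNset /=; last by rewrite in_itv/= ltNge xa.
  by rewrite (le_trans xa (ltW ab)) subrr mul0r.
case: (leP x b) => xb.
  rewrite mem_set /=; last by rewrite in_itv/= xa xb.
  by rewrite opprK -splitr divff.
rewrite memNset /=; last by rewrite in_itv/= xa leNgt xb.
by rewrite subrr mul0r.
Qed.

End PoissonStepLimit.

Section PowerDecay.
Context {R : realType}.
Local Notation mu := (@lebesgue_measure R).

Lemma integrable_power_decay (q : R) : 1 < q ->
  mu.-integrable setT (fun x => ((1 + `|x|) `^ (- q))%:E).
Proof.
move=> q1; have q10 : 0 < q - 1 by rewrite subr_gt0.
have c1 : continuous (fun x : R => (1 + `|x|) `^ (- q)).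
  move=> x; apply: (@continuous_comp _ _ _ (fun x : R => 1 + `|x|) (fun y => y `^ (- q))); last first.
    by apply: continuous_powR; rewrite ltr_pwDl.
  by apply: cvgD; [exact: cvg_cst|exact: norm_continuous].
apply/integrableP; split; first by apply/measurable_EFinP; exact: continuous_measurable_fun.
under eq_integral do rewrite gee0_abs ?lee_fin ?powR_ge0//.
rewrite ge0_symfun_integralT; last 3 first.
- by move=> x; rewrite powR_ge0.
- exact: c1.
- by move=> x /=; rewrite normrN.
rewrite -set_itvcy; pose g (x : R) := (x + 1) `^ (- q).
rewrite (_ : (\int[mu]_(x in _) _)%E = (\int[mu]_(x in `[0%R, +oo[) (g x)%:E)%E); last first.
  by apply: eq_integral => x; rewrite inE/= in_itv/= andbT => x0; rewrite ger0_norm// addrC.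
pose F (x : R) := - (q - 1)^-1 * (x + 1) `^ (- (q - 1)).
have x10 (x : R) : 0 <= x -> 0 < x + 1 by move=> x0; rewrite ltr_wpDl.
rewrite [X in (_ * X)%E](@ge0_FTC2y_is_derive _ g F 0 0).
- by rewrite -EFinM ltry.
- by move=> x _; rewrite powR_ge0.
- move=> x x0; apply: (@continuous_comp _ _ _ (fun x : R => x + 1) (fun y => y `^ (- q))); last first.
    by apply: continuous_powR; rewrite x10.
  by apply: cvgD; [exact: cvg_id|exact: cvg_cst].
- move=> x x0.
  have h1 : is_derive (x : R) (1 : R) (fun x : R => x + 1) 1.
    by apply: is_derive_eq; rewrite addr0.
  have h2 := is_derive1_powR (- (q - 1)) (x10 _ x0).
  have h := @is_derive1_comp _ (fun y => y `^ (- (q - 1))) (fun x => x + 1) x _ _ h2 h1.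
  rewrite /F; apply: is_derive_eq; rewrite -![_ *: _]/(_ * _) /g.
  rewrite mulr1 (_ : - (q - 1) - 1 = - q); last by ring.
  by field; rewrite gt_eqF.
- rewrite -[X in _ --> X](mulr0 (- (q - 1)^-1)); apply: cvgM; first exact: cvg_cst.
  rewrite (_ : (fun x : R => _) = (fun x : R => ((x + 1) `^ (q - 1))^-1)); last first.
    by apply/funext => x; rewrite powRN.
  apply/cvgr0Pnorm_lt => e e0; near=> x.
  have x1 : e^-1 `^ (q - 1)^-1 < x + 1 by rewrite -ltrBlDr; near: x; exact: nbhs_pinfty_gt.
  have x0 : 0 < x + 1 by apply: le_lt_trans x1; exact: powR_ge0.
  rewrite ger0_norm ?invr_ge0 ?powR_ge0// -[ltRHS]invrK ltf_pV2 ?posrE ?powR_gt0 ?invr_gt0//.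
  rewrite (_ : e^-1 = (e^-1 `^ (q - 1)^-1) `^ (q - 1)); last first.
    by rewrite -powRrM mulVf ?gt_eqF// powRr1// invr_ge0 ltW.
  by apply: gt0_ltr_powR => //; rewrite nnegrE ?powR_ge0// ltW.
Unshelve. all: by end_near. Qed.

End PowerDecay.

Section TupleFourier.
Context {R : realType} (N : nat).
Local Notation nu := (@lebN R N).
Implicit Types (x xi : N.-tuple R).

Lemma dotpC x xi : dotp x xi = dotp xi x.
Proof. by apply: eq_bigr => i _; rewrite mulrC. Qed.

Lemma measurable_dotp2 d (T : measurableType d) (f g : T -> N.-tuple R) :
  measurable_fun setT f -> measurable_fun setT g -> measurable_fun setT (fun z => dotp (f z) (g z)).
Proof.
move=> mf mg; apply: measurable_sum => i; apply: measurable_funM.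
  exact: (measurableT_comp (measurable_tnth i)).
exact: (measurableT_comp (measurable_tnth i)).
Qed.

Lemma measurable_enorm : measurable_fun setT (@enorm R N).
Proof.
apply: measurableT_comp; first by apply: continuous_measurable_fun; exact: sqrt_continuous.
by apply: measurable_dotp2; exact: measurable_id.
Qed.

Lemma ball_indE (r : R) x : ball_ind r x = \1_[set y : N.-tuple R | enorm y < r] x.
Proof. by rewrite /ball_ind indicE; case: ifPn => h; [rewrite mem_set|rewrite memNset//; exact/negP]. Qed.

Lemma measurable_ball_ind (r : R) : measurable_fun setT (@ball_ind R N r).
Proof.
have -> : ball_ind r = \1_[set y : N.-tuple R | enorm y < r] by apply/funext => x; exact: ball_indE.
apply: measurable_indic; rewrite (_ : mkset _ = setT `&` @enorm R N @^-1` `]-oo, r[%classic).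
  exact: measurable_enorm.
by rewrite setTI; apply/seteqP; split => x /=; rewrite in_itv.
Qed.

Lemma ball_ind_ge0 (r : R) x : 0 <= ball_ind r x.
Proof. by rewrite /ball_ind; case: ifP. Qed.

Lemma ball_ind_le1 (r : R) x : ball_ind r x <= 1.
Proof. by rewrite /ball_ind; case: ifP. Qed.

Lemma norm_tnth_le_enorm x i : `|tnth x i| <= enorm x.
Proof.
rewrite -sqrtr_sqr ler_wsqrtr// /dotp (bigD1 i)//= -expr2 lerDl sumr_ge0// => j _.
by rewrite -expr2 sqr_ge0.
Qed.

Lemma ball_ind_cube (r : R) (n : nat) x : r <= n%:R -> ball_ind r x <= \1_(cube n) x.
Proof.
rewrite /ball_ind => rn; case: ifPn => // xr; rewrite indicE mem_set// => i.
have : `|tnth x i| < n%:R by rewrite (le_lt_trans (norm_tnth_le_enorm x i))// (lt_le_trans xr).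
by rewrite ltr_norml => /andP[-> /ltW].
Qed.

Lemma cvg_ball_ind x : ball_ind (n%:R : R) x @[n --> \oo] --> (1 : R).
Proof.
apply: cvg_near_cst; near=> n; rewrite /ball_ind ifT//; near: n.
have : (n%:R : R) @[n --> \oo] --> +oo by exact: cvgr_idn.
by move/cvgryPgt => /(_ (enorm x)).
Unshelve. all: by end_near. Qed.

Lemma cmeas_fint (G : N.-tuple R -> R[i]) (s : R) : cmeas G ->
  cmeas (fun x => cint nu (fun xi => G xi * cexpi (s * dotp x xi))).
Proof.
move=> mG; apply: (@cmeas_cint_param _ _ _ _ _ nu (fun z => G z.2 * cexpi (s * dotp z.1 z.2))).
apply: cmeasM.
  have [m1 m2] := mG.
  by split; [exact: (measurableT_comp m1 measurable_snd)|exact: (measurableT_comp m2 measurable_snd)].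
apply: cmeas_cexpi; apply: measurable_funM; first exact: measurable_cst.
by apply: measurable_dotp2; [exact: measurable_fst|exact: measurable_snd].
Qed.

(** Fubini. The parameter s is -1 when the forward transform is moved and 1 for the inverse one. *)
Lemma fint_multiplication (G H : N.-tuple R -> R[i]) (s : R) : cintegrable nu G -> cintegrable nu H ->
  cint nu (fun x => cint nu (fun xi => G xi * cexpi (s * dotp x xi)) * H x) =
  cint nu (fun xi => G xi * cint nu (fun x => H x * cexpi (s * dotp x xi))).
Proof.
move=> cG cH; pose f (z : N.-tuple R * N.-tuple R) := H z.1 * G z.2 * cexpi (s * dotp z.1 z.2).
have mk : measurable_fun setT (fun z : N.-tuple R * N.-tuple R => s * dotp z.1 z.2).
  apply: measurable_funM; first exact: measurable_cst.
  by apply: measurable_dotp2; [exact: measurable_fst|exact: measurable_snd].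
have cf : cintegrable (nu \x nu)%E f.
  by apply: cintegrable_cexpi => //; exact: (cintegrable_prod cH cG).
have cs (K : N.-tuple R -> R[i]) (h : N.-tuple R -> R) : cintegrable nu K -> measurable_fun setT h ->
    cintegrable nu (fun x => K x * cexpi (s * h x)).
  by move=> cK mh; apply: cintegrable_cexpi => //; apply: measurable_funM => //; exact: measurable_cst.
transitivity (cint nu (fun x => cint nu (fun xi => f (x, xi)))).
  apply: eq_cint => x; rewrite mulrC -cintZ; last by apply: cs => //; exact: measurable_dotp.
  by apply: eq_cint => xi; rewrite /f/= mulrA.
rewrite (cfubini cf); apply: eq_cint => xi; rewrite -cintZ; last first.
  by apply: cs => //; under eq_fun do rewrite dotpC; exact: measurable_dotp.
by apply: eq_cint => x; rewrite /f/=; ring.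
Qed.

Lemma ccvgP (u : nat -> R[i]) (l : R[i]) :
  (forall e, 0 < e -> \forall n \near \oo, cmod (u n - l) < e) -> ccvg u l.
Proof.
move=> h; split; apply/cvgrPdist_lt => e e0; have := h _ e0; apply: filterS => n; apply: le_lt_trans.
  by rewrite -creB (le_trans (norm_cre_le _))// cmod_distC.
by rewrite -cimB (le_trans (norm_cim_le _))// cmod_distC.
Qed.

End TupleFourier.

Section DampedBox.
Context {R : realType} (N : nat) (a b : 'I_N -> R).
Hypothesis ab : forall i, a i < b i.
Local Notation mu := (@lebesgue_measure R).
Local Notation nu := (@lebN R N).
Implicit Types (x xi : N.-tuple R) (d : R).

(** [damped_box] is the test function on the frequency side and [box_step] its counterpart in space;
    [box_bound] and [damped_bound] are their majorants, both independent of d. *)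
Definition damped_box d xi := \prod_(i < N) damped_ft (a i) (b i) d (tnth xi i).
Definition box_step d x := \prod_(i < N) poisson_step (a i) (b i) d (tnth x i).
Definition box_bound x := \prod_(i < N) (poisson_bound (a i) (b i) / (1 + `|tnth x i|) ^+ 2).
Definition damped_bound := \prod_(i < N) itv_ft_bound (a i) (b i).

Lemma cintegrable_damped_box d : 0 < d -> cintegrable nu (damped_box d).
Proof.
move=> d0; have cf i : cintegrable mu (damped_ft (a i) (b i) d) by exact: cintegrable_damped_ft.
by have [] := cint_tuple_prod cf.
Qed.

Lemma cmod_damped_box d xi : cmod (damped_box d xi) <= damped_bound.
Proof.
by rewrite cmod_prod; apply: ler_prod => i _; rewrite cmod_ge0 cmod_damped_ft.
Qed.

Lemma box_stepE d x : 0 < d ->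
  cint nu (fun xi => damped_box d xi * cexpi (- dotp x xi)) = rc ((2 * pi) ^+ N * box_step d x).
Proof.
move=> d0.
have cf i : cintegrable mu (fun y => damped_ft (a i) (b i) d y * cexpi (- (tnth x i * y))).
  apply: cintegrable_cexpi; first exact: cintegrable_damped_ft.
  by apply: measurable_funN; exact: measurable_funM.
transitivity (\prod_(i < N) cint mu (fun y => damped_ft (a i) (b i) d y * cexpi (- (tnth x i * y)))).
  have [_ <-] := cint_tuple_prod cf; apply: eq_cint => xi.
  by rewrite big_split/= -cexpi_sum sumrN.
rewrite (eq_bigr (fun i => rc (2 * pi * poisson_step (a i) (b i) d (tnth x i)))); last first.
  by move=> i _; rewrite poisson_stepE.
rewrite -rc_prod big_split/= prodr_const card_ord//.
Qed.

Lemma ccvg_damped_box xi :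
  ccvg (fun n => damped_box n.+1%:R^-1 xi) (\prod_(i < N) itv_ft (a i) (b i) (tnth xi i)).
Proof.
apply: ccvg_prod => i; rewrite -[X in ccvg _ X]mul1r; apply: ccvgM; last exact: ccvg_cst.
have n0 : (n.+1%:R^-1 : R) @[n --> \oo] --> (0 : R) by exact: cvg_harmonic.
rewrite -[X in ccvg _ X]mul1r; apply: ccvgM.
  rewrite -[X in ccvg _ X]/(rc 1) -[X in ccvg _ (rc X)]expR0; apply: ccvg_rc.
  apply: continuous_cvg; first exact: continuous_expR.
  rewrite -[X in _ --> X]oppr0; apply: cvgN.
  rewrite -[X in _ --> X](mul0r `|tnth xi i|); apply: cvgM; last exact: cvg_cst.
  by rewrite -[X in _ --> X](mul0r (0 : R)); apply: cvgM.
rewrite -[X in ccvg _ X](@cexpi0 R); apply: ccvg_cexpi.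
by rewrite -[X in _ --> X](mul0r (tnth xi i)); apply: cvgM => //; exact: cvg_cst.
Qed.

Lemma box_step_bound d x : 0 < d <= 1 -> `|box_step d x| <= box_bound x.
Proof.
move=> d1; rewrite normr_prod; apply: ler_prod => i _.
by rewrite normr_ge0 poisson_step_bound.
Qed.

Lemma cvg_box_step x : box_step n.+1%:R^-1 x @[n --> \oo] --> (\1_(box a b) x : R).
Proof.
rewrite indic_box /box_step; elim: (index_enum _) => [|i s IH].
  by under eq_fun do rewrite big_nil; rewrite big_nil; exact: cvg_cst.
under eq_fun do rewrite big_cons; rewrite big_cons; apply: cvgM => //.
exact: cvg_poisson_step.
Qed.

Lemma integrable_box_bound : nu.-integrable setT (fun x => (box_bound x)%:E).
Proof.
have cf i : cintegrable mu (fun y => rc (poisson_bound (a i) (b i) / (1 + `|y|) ^+ 2)).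
  split; last exact: integrable0.
  under eq_fun do rewrite cre_rc EFinM.
  apply: integrableZl => //; apply: eq_integrable (@integrable_power_decay R 2 _) => //; last by rewrite ltr1n.
  by move=> y _; rewrite powRN powR_mulrn.
have [[+ _] _] := cint_tuple_prod cf.
by apply: eq_integrable => // x _; rewrite -rc_prod cre_rc.
Qed.

Lemma poisson_bound_ge0 i : 0 <= poisson_bound (a i) (b i).
Proof. by rewrite addr_ge0 ?sqr_ge0// mulr_ge0// subr_ge0 ltW. Qed.

Lemma box_bound_ge0 x : 0 <= box_bound x.
Proof. by apply: prodr_ge0 => i _; rewrite divr_ge0 ?poisson_bound_ge0 ?sqr_ge0. Qed.

Lemma box_bound_le x : box_bound x <= \prod_(i < N) poisson_bound (a i) (b i).
Proof.
apply: ler_prod => i _; rewrite divr_ge0 ?poisson_bound_ge0 ?sqr_ge0//=.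
rewrite ler_pdivrMr ?exprn_gt0 ?ltr_pwDl// ler_peMr ?poisson_bound_ge0//.
by rewrite exprn_ege1// lerDl.
Qed.

Lemma measurable_box_step d : measurable_fun setT (box_step d).
Proof.
apply: measurable_prod => i _ /=; apply: (@measurableT_comp _ _ _ _ _ _ (poisson_step (a i) (b i) d)); last exact: measurable_tnth.
have c0 c : continuous (fun x : R => (c + d - x) / d ^+ 2).
  by move=> x; apply: cvgM; [apply: cvgB; [exact: cvg_cst|exact: cvg_id]|exact: cvg_cst].
have m c : measurable_fun setT (fun x : R => atan ((c + d - x) / d ^+ 2)).
  apply: continuous_measurable_fun => x.
  exact: (continuous_comp (c0 c x) (@continuous_atan R _)).
by apply: measurable_funM; [apply: measurable_funB|exact: measurable_cst].
Qed.

End DampedBox.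

Section TruncatedTransform.
Context {R : realType} (N : nat).
Local Notation nu := (@lebN R N).
Variable phi : N.-tuple R -> R[i].
Hypothesis mphi : cmeas phi.
Hypothesis iphi : nu.-integrable setT (fun x => (cmod (phi x) ^+ 2)%:E).

Lemma cintegrable_ball (r : R) : cintegrable nu (fun x => rc (ball_ind r x) * phi x).
Proof.
have [n rn] : exists n : nat, r <= n%:R.
  exists (Num.bound `|r|); rewrite (le_trans (ler_norm r))// ltW//; exact: archi_boundP.
(* A square integrable function is integrable on bounded sets, by t <= t^2 + 1. *)
have id : nu.-integrable setT (fun x => (cmod (phi x) ^+ 2 + \1_(@cube R N n) x)%:E).
  by under eq_fun do rewrite EFinD; apply: integrableD => //; exact: integrable_indic_box.
apply: (cintegrable_dom _ id).
  by apply: cmeasM => //; apply: cmeas_rc; exact: measurable_ball_ind.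
move=> x; rewrite cmodM cmod_rc ger0_norm ?ball_ind_ge0//.
have := ball_ind_cube x rn; rewrite /ball_ind; case: ifP => _ h.
  rewrite mul1r (@le_trans _ _ (cmod (phi x) ^+ 2 + 1)) ?lerD2l//.
  by have := sqr_ge0 (cmod (phi x) - 1); have := cmod_ge0 (phi x); move: (cmod _) => t; nra.
by rewrite mul0r addr_ge0 ?sqr_ge0.
Qed.

Lemma trunc_FTE (r : R) xi : trunc_FT phi r xi =
  rc ((2 * pi) ^- N) * cint nu (fun x => rc (ball_ind r x) * phi x * cexpi (-1 * dotp xi x)).
Proof.
rewrite /trunc_FT cintNE; last first.
  apply: cintegrable_cexpi; first exact: cintegrable_ball.
  by apply: measurable_funN; under eq_fun do rewrite dotpC; exact: measurable_dotp.
by congr (_ * _); apply: eq_cint => x; rewrite mulN1r dotpC.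
Qed.

Lemma cmeas_trunc_FT (r : R) : cmeas (trunc_FT phi r).
Proof.
have -> : trunc_FT phi r = (fun xi => rc ((2 * pi) ^- N) *
    cint nu (fun x => rc (ball_ind r x) * phi x * cexpi (-1 * dotp xi x))).
  by apply/funext => xi; exact: trunc_FTE.
apply: cmeasM; first exact: cmeas_cst.
by apply: cmeas_fint; apply: cintegrable_meas; exact: cintegrable_ball.
Qed.

Lemma cmod_trunc_FT (r : R) xi : cmod (trunc_FT phi r xi) <=
  (2 * pi) ^- N * (2 * \int[nu]_x cmod (rc (ball_ind r x) * phi x)).
Proof.
have p0 : 0 <= (2 * pi : R) ^- N by rewrite invr_ge0 exprn_ge0// mulr_ge0// ltW// pi_gt0.
rewrite trunc_FTE cmodM cmod_rc ger0_norm// ler_wpM2l//.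
apply: cmod_cint_cexpi_le; first exact: cintegrable_ball.
by apply: measurable_funM; [exact: measurable_cst|exact: measurable_dotp].
Qed.

(* The multiplication formula moves the transform of the truncation onto the damped box. *)
Lemma trunc_FT_damped_box (a b : 'I_N -> R) (r d : R) : (forall i, a i < b i) -> 0 < d ->
  cint nu (fun xi => trunc_FT phi r xi * damped_box a b d xi) =
  cint nu (fun x => rc (ball_ind r x * box_step a b d x) * phi x).
Proof.
move=> ab d0; have cQ := @cintegrable_damped_box _ _ a b _ d0; have cB := cintegrable_ball r.
transitivity (cint nu (fun xi => rc ((2 * pi) ^- N) * (cint nu (fun x => rc (ball_ind r x) * phi x * cexpi (-1 * dotp xi x)) * damped_box a b d xi))).
  by apply: eq_cint => xi; rewrite trunc_FTE mulrA.
have pi0 : (2 * pi) ^+ N != 0 :> R by rewrite expf_neq0// mulf_neq0// gt_eqF// pi_gt0.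
rewrite cintZ; last first.
  apply: (@cintegrable_dom _ _ _ _ _ (fun xi => (2 * \int[nu]_x cmod (rc (ball_ind r x) * phi x)) * cmod (damped_box a b d xi))).
  - apply: cmeasM; last exact: (cintegrable_meas cQ).
    by apply: cmeas_fint; exact: (cintegrable_meas cB).
  - by under eq_fun do rewrite EFinM; apply: integrableZl => //; exact: integrable_cmod.
  - move=> xi; rewrite cmodM ler_wpM2r ?cmod_ge0//.
    have := cmod_trunc_FT r xi; rewrite trunc_FTE cmodM cmod_rc ger0_norm; last first.
      by rewrite invr_ge0 exprn_ge0// mulr_ge0// ltW// pi_gt0.
    by rewrite ler_pM2l// invr_gt0 exprn_gt0// mulr_gt0// pi_gt0.
rewrite fint_multiplication// -cintZ; last first.
  apply: (@cintegrableM _ _ _ _ _ _ (2 * \int[nu]_x cmod (damped_box a b d x))) => //.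
    under eq_fun do under eq_cint do rewrite dotpC.
    by apply: cmeas_fint; exact: (cintegrable_meas cQ).
  move=> x; under eq_cint do rewrite dotpC.
  apply: cmod_cint_cexpi_le => //.
  by apply: measurable_funM; [exact: measurable_cst|exact: measurable_dotp].
apply: eq_cint => x.
rewrite (_ : cint nu _ = rc ((2 * pi) ^+ N * box_step a b d x)); last first.
  by rewrite -box_stepE//; apply: eq_cint => xi; rewrite mulN1r dotpC.
by rewrite mulrCA -rcM mulKf// rcM; ring.
Qed.

End TruncatedTransform.

Section L2Limit.
Context {R : realType} (N : nat).
Local Notation nu := (@lebN R N).
Variables phi g : N.-tuple R -> R[i].
Hypothesis mphi : cmeas phi.
Hypothesis iphi : nu.-integrable setT (fun x => (cmod (phi x) ^+ 2)%:E).
Hypothesis mg : cmeas g.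
Hypothesis FTg : (fun r : R => nnintN (fun xi => (cmod (trunc_FT phi r xi - g xi) ^+ 2)%:E))
  r @[r --> +oo] --> 0%E.

Let h n xi := trunc_FT phi n%:R xi - g xi.

Let mh n : cmeas (h n).
Proof. by apply: cmeasB; [exact: cmeas_trunc_FT|exact: mg]. Qed.

(** Convergence to 0 in the extended reals makes these integrals finite only eventually, so
    integrability belongs to the conclusion. *)
Lemma trunc_FT_L2_near (e : R) : 0 < e -> \forall n \near \oo,
  nu.-integrable setT (fun xi => (cmod (h n xi) ^+ 2)%:E) /\ \int[nu]_xi cmod (h n xi) ^+ 2 < e.
Proof.
move=> e0.
have mE n : measurable_fun setT (fun xi => (cmod (h n xi) ^+ 2)%:E).
  by apply/measurable_EFinP; apply: measurable_funX; exact: measurable_cmod.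
have hE n : (nnintN (fun xi => (cmod (h n xi) ^+ 2)%:E) = \int[nu]_xi (cmod (h n xi) ^+ 2)%:E)%E.
  by apply: nnintNE => // xi; rewrite lee_fin sqr_ge0.
have : \forall n \near \oo, (\int[nu]_xi (cmod (h n xi) ^+ 2)%:E < e%:E)%E.
  have e1 : (0 < e%:E :> \bar R)%E by rewrite lte_fin.
  have h0 := FTg (open_ereal_lt' e1).
  have [n0 _ hn0] := (@cvgr_idn R) _ h0; exists n0 => // n /hn0 /=.
  by rewrite -/(h n) hE.
apply: filterS => n hn; split.
  apply/integrableP; split => //; apply: lt_trans (ltry e).
  by under eq_integral do rewrite gee0_abs ?lee_fin ?sqr_ge0//.
rewrite -lte_fin /Rintegral fineK//.
rewrite ge0_fin_numE; first exact: lt_trans (ltry e).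
by apply: integral_ge0 => xi _; rewrite lee_fin sqr_ge0.
Qed.

End L2Limit.

Section FourierInversion.
Context {R : realType} (N : nat).
Local Notation nu := (@lebN R N).
Variables phi g : N.-tuple R -> R[i].
Hypothesis mphi : cmeas phi.
Hypothesis iphi : nu.-integrable setT (fun x => (cmod (phi x) ^+ 2)%:E).
Hypothesis cg : cintegrable nu g.
Hypothesis FTg : (fun r : R => nnintN (fun xi => (cmod (trunc_FT phi r xi - g xi) ^+ 2)%:E))
  r @[r --> +oo] --> 0%E.

Let h n xi := trunc_FT phi n%:R xi - g xi.

Variables a b : 'I_N -> R.
Hypothesis ab : forall i, a i < b i.

(** [box_bound] is bounded and integrable, hence square integrable, and its product with |phi| is at
    most the sum of the two squares. *)
Let integrable_boundM : nu.-integrable setT (fun x => (box_bound a b x * cmod (phi x))%:E).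
Proof.
pose C := \prod_(i < N) poisson_bound (a i) (b i).
have ib := integrable_box_bound a b.
have id : nu.-integrable setT (fun x => (cmod (phi x) ^+ 2 + C * box_bound a b x)%:E).
  by under eq_fun do rewrite EFinD; apply: integrableD => //; under eq_fun do rewrite EFinM; exact: integrableZl.
have /measurable_int/measurable_EFinP mb := ib.
apply: (le_integrable measurableT _ _ id).
  by apply/measurable_EFinP; apply: measurable_funM => //; exact: measurable_cmod.
move=> x _; rewrite lee_fin.
have b0 := box_bound_ge0 ab x; have p0 := cmod_ge0 (phi x); have bC := box_bound_le ab x.
have C0 : 0 <= C := le_trans b0 bC.
rewrite ger0_norm ?mulr_ge0// ger0_norm ?addr_ge0 ?sqr_ge0 ?mulr_ge0//.
apply: (@le_trans _ _ (cmod (phi x) ^+ 2 + box_bound a b x * box_bound a b x)).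
  by move: (cmod _) (box_bound _ _ _) b0 p0 => u v; nra.
by rewrite lerD2l ler_wpM2r.
Qed.

(** Both sides are limits of the truncated identity [trunc_FT_damped_box]: in space by dominated
    convergence, in frequency because the test function is square integrable and the transforms
    converge in L2. *)
Lemma inversion_damped_box (d : R) : 0 < d <= 1 ->
  cint nu (fun x => rc (box_step a b d x) * phi x) = cint nu (fun xi => g xi * damped_box a b d xi).
Proof.
move=> d01; have /andP[d0 _] := d01.
have cQ := cintegrable_damped_box a b d0; have mQ := cintegrable_meas cQ.
pose u n := cint nu (fun xi => trunc_FT phi n%:R xi * damped_box a b d xi).
apply: (@ccvg_unique _ u).
  rewrite (_ : u = (fun n => cint nu (fun x => rc (ball_ind n%:R x * box_step a b d x) * phi x))); last first.
    by apply/funext => n; rewrite /u trunc_FT_damped_box.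
  apply: (cint_dominated_cvg _ _ integrable_boundM).
  - move=> n; apply: cmeasM => //; apply: cmeas_rc; apply: measurable_funM.
      exact: measurable_ball_ind.
    exact: measurable_box_step.
  - by apply: cmeasM => //; apply: cmeas_rc; exact: measurable_box_step.
  - move=> n x; rewrite cmodM cmod_rc normrM (ger0_norm (ball_ind_ge0 _ _)).
    rewrite ler_wpM2r ?cmod_ge0// (@le_trans _ _ `|box_step a b d x|) ?box_step_bound//.
    by rewrite ler_piMl// ball_ind_le1.
  - apply: aeW => x; apply: ccvgM; last exact: ccvg_cst.
    apply: ccvg_rc; rewrite -[X in _ --> X]mul1r; apply: cvgM; [exact: cvg_ball_ind|exact: cvg_cst].
pose K := damped_bound a b; have QK xi : cmod (damped_box a b d xi) <= K by exact: cmod_damped_box.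
have K0 : 0 <= K := le_trans (cmod_ge0 _) (QK (zero_pt N)).
have cgQ : cintegrable nu (fun xi => g xi * damped_box a b d xi) by exact: cintegrableM QK.
have cTQ n : cintegrable nu (fun xi => trunc_FT phi n%:R xi * damped_box a b d xi).
  under eq_fun do rewrite mulrC; apply: (cintegrableM cQ _ (cmod_trunc_FT mphi iphi n%:R)).
  exact: cmeas_trunc_FT.
have iQ : nu.-integrable setT (fun xi => (cmod (damped_box a b d xi) ^+ 2)%:E).
  have id : nu.-integrable setT (fun xi => (K * cmod (damped_box a b d xi))%:E).
    by under eq_fun do rewrite EFinM; apply: integrableZl => //; exact: integrable_cmod.
  apply: (le_integrable measurableT _ _ id).
    by apply/measurable_EFinP; apply: measurable_funX; exact: measurable_cmod.
  move=> xi _; rewrite lee_fin ger0_norm ?sqr_ge0// ger0_norm ?mulr_ge0 ?cmod_ge0// expr2.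
  by rewrite ler_wpM2r ?cmod_ge0.
pose C := \int[nu]_xi cmod (damped_box a b d xi) ^+ 2.
have C0 : 0 <= C by apply: Rintegral_ge0 => xi _; exact: sqr_ge0.
apply: ccvgP => e e0.
(* The weight of the inequality 2 s t <= s^2 / eta + eta t^2, which plays the part of
   Cauchy-Schwarz. The second term contributes at most e / 2, and the first less than e / 2 once the
   squared L2 error is below eta e / 2. *)
pose eta := e / 2 / (C + 1).
have eta0 : 0 < eta by rewrite divr_gt0 ?divr_gt0// ltr_wpDl.
have amgm (s t : R) : 2 * (s * t) <= eta^-1 * s ^+ 2 + eta * t ^+ 2.
  rewrite -subr_ge0 (_ : _ - _ = eta * (eta^-1 * s - t) ^+ 2).
    by apply: mulr_ge0; [exact: ltW|exact: sqr_ge0].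
  by field; rewrite gt_eqF.
have := trunc_FT_L2_near mphi iphi (cintegrable_meas cg) FTg (mulr_gt0 eta0 (divr_gt0 e0 (ltr0n _ 2))); apply: filterS => n [ih hn].
rewrite /u -cintB//.
have chQ : cintegrable nu (fun xi => trunc_FT phi n%:R xi * damped_box a b d xi - g xi * damped_box a b d xi).
  exact: cintegrableB.
apply: (le_lt_trans (cmod_cint_le chQ)).
have ie : nu.-integrable setT (fun xi => (eta^-1 * cmod (h n xi) ^+ 2)%:E).
  by under eq_fun do rewrite EFinM; exact: integrableZl.
have iq : nu.-integrable setT (fun xi => (eta * cmod (damped_box a b d xi) ^+ 2)%:E).
  by under eq_fun do rewrite EFinM; exact: integrableZl.
rewrite -RintegralZl//; last exact: integrable_cmod.
apply: (@le_lt_trans _ _ (\int[nu]_xi (eta^-1 * cmod (h n xi) ^+ 2 + eta * cmod (damped_box a b d xi) ^+ 2))).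
  apply: le_Rintegral => //.
  - apply: eq_integrable (integrableZl measurableT 2 (integrable_cmod chQ)) => // xi _; by rewrite EFinM.
  - by apply: eq_integrable (integrableD measurableT ie iq).
  - by move=> xi _; rewrite -mulrBl cmodM; exact: amgm.
rewrite RintegralD// !RintegralZl// -/C (splitr e); apply: ltr_leD.
  by rewrite mulrC ltr_pdivrMr// mulrC.
by rewrite /eta mulrAC ler_pdivrMr ?ltr_wpDl// ler_wpM2l ?divr_ge0 ?(ltW e0)// lerDl.
Qed.

(** Removes the damping. Integrability of g is used here: a multiple of |g| dominates the frequency
    side, where the undamped transform of the box is merely bounded. A second multiplication formula
    then brings in [fint g]. *)
Lemma inversion_box :
  cint nu (fun x => rc (\1_(box a b) x) * phi x) = cint nu (fun x => rc (\1_(box a b) x) * fint g x).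
Proof.
pose d n : R := n.+1%:R^-1.
have d01 n : 0 < d n <= 1 by rewrite invr_gt0 ltr0n/= invf_le1// ler1n.
pose u n := cint nu (fun x => rc (box_step a b (d n) x) * phi x).
transitivity (cint nu (fun xi => g xi * \prod_(i < N) itv_ft (a i) (b i) (tnth xi i))).
  apply: (@ccvg_unique _ u).
    apply: (cint_dominated_cvg _ _ integrable_boundM).
    - by move=> n; apply: cmeasM => //; apply: cmeas_rc; exact: measurable_box_step.
    - by apply: cmeasM => //; apply: cmeas_rc; apply: measurable_indic; exact: measurable_box.
    - move=> n x; rewrite cmodM cmod_rc ler_wpM2r ?cmod_ge0//.
      exact: box_step_bound.
    - by apply: aeW => x; apply: ccvgM; [apply: ccvg_rc; exact: cvg_box_step|exact: ccvg_cst].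
  rewrite (_ : u = (fun n => cint nu (fun xi => g xi * damped_box a b (d n) xi))); last first.
    by apply/funext => n; rewrite /u inversion_damped_box.
  have id : nu.-integrable setT (fun xi => (damped_bound a b * cmod (g xi))%:E).
    by under eq_fun do rewrite EFinM; apply: integrableZl => //; exact: integrable_cmod.
  apply: (cint_dominated_cvg _ _ id).
  - move=> n; apply: cmeasM; first exact: (cintegrable_meas cg).
    by have /andP[d0 _] := d01 n; exact: (cintegrable_meas (cintegrable_damped_box a b d0)).
  - apply: cmeasM; first exact: (cintegrable_meas cg).
    by apply: cmeas_prod => i; apply: cmeas_tnth; exact: cmeas_itv_ft.
  - by move=> n xi; rewrite cmodM mulrC ler_wpM2r ?cmod_ge0// cmod_damped_box.
  - by apply: aeW => xi; apply: ccvgM; [exact: ccvg_cst|exact: ccvg_damped_box].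
have cB : cintegrable nu (fun x => rc (\1_(box a b) x)).
  by split; [exact: integrable_indic_box|exact: integrable0].
have := fint_multiplication 1 cg cB.
rewrite (_ : cint nu (fun x => cint nu _ * _) = cint nu (fun x => rc (\1_(box a b) x) * fint g x)); last first.
  by apply: eq_cint => x; rewrite mulrC; congr (_ * _); apply: eq_cint => xi; rewrite mul1r.
move=> ->; apply: eq_cint => xi; congr (_ * _); rewrite -[LHS]fint_box.
by apply: eq_cint => x; rewrite mul1r dotpC.
Qed.

End FourierInversion.

Section InversionAlmostEverywhere.
Context {R : realType} (N : nat).
Local Notation nu := (@lebN R N).

Lemma integral_box_indic (h : N.-tuple R -> R) (A : set (N.-tuple R)) : measurable A ->
  nu.-integrable setT (fun x => (\1_A x * h x)%:E) -> \int[nu]_x (\1_A x * h x) = 0 ->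
  nu.-integrable A (fun x => (h x)%:E) /\ (\int[nu]_(x in A) (h x)%:E = 0)%E.
Proof.
move=> mA iA A0.
have E : (fun x => (\1_A x * h x)%:E) = (fun x => (h x)%:E) \_ A.
  by apply/funext => x; rewrite patchE indicE; case: ifP => _; rewrite ?mul1r ?mul0r.
have iA' : nu.-integrable A (fun x => (h x)%:E) by apply/integrable_mkcond => //; rewrite -E.
split => //; rewrite integral_mkcond -E.
by rewrite -(@fineK _ (\int[nu]_x _)%E) ?(integrable_fin_num measurableT iA)// -/(Rintegral _ _ _) A0.
Qed.

Lemma ae_eqNP (f g : N.-tuple R -> R[i]) : cmeas f -> cmeas g ->
  {ae nu, forall x, f x = g x} -> ae_eqN f g.
Proof.
move=> mf mg fg; have [d1 d2] := cmeasB mf mg.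
pose A := [set y | f y != g y].
have AE : A = ~` ((fun x => cre (f x - g x)) @^-1` [set 0] `&` (fun x => cim (f x - g x)) @^-1` [set 0]).
  apply/seteqP; split => x /=; first by move/eqP => h [h1 h2]; apply: h; apply/eqP; rewrite -subr_eq0; apply/eqP/complexP.
  by move=> h; apply/eqP => E; apply: h; rewrite E subrr.
have mA : measurable A.
  rewrite AE; apply: measurableC; apply: measurableI; rewrite -[X in measurable X]setTI.
    exact: d1.
  exact: d2.
rewrite /ae_eqN nnintNE//; last by apply/measurable_EFinP; exact: measurable_indic.
rewrite integral_indic// setIT; apply: measure_negligible => //.
by apply: negligibleS fg => x /= /eqP.
Qed.

Variables phi g : N.-tuple R -> R[i].
Hypothesis mphi : cmeas phi.
Hypothesis iphi : nu.-integrable setT (fun x => (cmod (phi x) ^+ 2)%:E).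
Hypothesis cg : cintegrable nu g.
Hypothesis FTg : (fun r : R => nnintN (fun xi => (cmod (trunc_FT phi r xi - g xi) ^+ 2)%:E))
  r @[r --> +oo] --> 0%E.

(** The difference of the two functions has zero integral over every box, so its real and imaginary
    parts vanish almost everywhere. *)
Lemma fourier_inversion : ae_eqN (fint g) phi.
Proof.
have mF : cmeas (fint g).
  have := cmeas_fint 1 (cintegrable_meas cg); congr cmeas; apply/funext => x.
  by apply: eq_cint => xi; rewrite mul1r.
pose D x := fint g x - phi x; have mD : cmeas D by exact: cmeasB.
have m1 a b : measurable_fun setT (\1_(box a b) : N.-tuple R -> R).
  by apply: measurable_indic; exact: measurable_box.
have cF a b : cintegrable nu (fun x => rc (\1_(box a b) x) * fint g x).
  apply: (cintegrableM _ mF (fun x => cmod_fint_le x cg)).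
  by split; [exact: integrable_indic_box|exact: integrable0].
have cP a b : cintegrable nu (fun x => rc (\1_(box a b) x) * phi x).
  have id : nu.-integrable setT (fun x => (cmod (phi x) ^+ 2 + \1_(@box R N a b) x)%:E).
    by under eq_fun do rewrite EFinD; apply: integrableD => //; exact: integrable_indic_box.
  apply: (cintegrable_dom _ id); first by apply: cmeasM => //; exact: cmeas_rc.
  move=> x; rewrite cmodM cmod_rc ger0_norm// indicE; case: (_ \in _) => /=.
    rewrite mul1r; have := sqr_ge0 (cmod (phi x) - 1); have := cmod_ge0 (phi x).
    by move: (cmod _) => t; nra.
  by rewrite mul0r addr_ge0 ?sqr_ge0.
have cD a b : cintegrable nu (fun x => rc (\1_(box a b) x) * D x).
  by have := cintegrableB (cF a b) (cP a b); congr cintegrable; apply/funext => x; rewrite mulrBr.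
have D0 a b : cint nu (fun x => rc (\1_(box a b) x) * D x) = 0.
  transitivity (cint nu (fun x => rc (\1_(box a b) x) * fint g x) - cint nu (fun x => rc (\1_(box a b) x) * phi x)).
    by rewrite -cintB//; apply: eq_cint => x; rewrite mulrBr.
  (* A box with some b i <= a i is empty, and both integrals are 0. *)
  have [ab|/existsNP[i /negP]] := pselect (forall i, a i < b i); first by rewrite (inversion_box mphi iphi cg FTg ab) subrr.
  rewrite -leNgt => ba.
  have E f : cint nu (fun x => rc (\1_(box a b) x) * f x) = 0.
    apply: complexP; rewrite /cint {1}/cre {1}/cim/= -[RHS](mul0r (fine (nu setT))) -Rintegral_cst//;
    apply: eq_Rintegral => x _; rewrite indicE memNset ?mul0r// => /(_ i) /andP[h1 h2];
    by have := lt_le_trans h1 h2; rewrite ltNge ba.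
  by rewrite !E subrr.
have ae1 : {ae nu, forall x, cre (D x) = 0}.
  have H a b := @integral_box_indic (fun x => cre (D x)) _ (measurable_box a b).
  have {}H a b : nu.-integrable (box a b) (fun x => (cre (D x))%:E) /\ (\int[nu]_(x in box a b) (cre (D x))%:E = 0)%E.
    apply: H; first by have [+ _] := cD a b; apply: eq_integrable => // x _; rewrite cre_rcM.
    by have /(congr1 cre) := D0 a b; rewrite {1}/cre/= => <-; apply: eq_Rintegral => x _; rewrite cre_rcM.
  by apply: ae0_box_integrals => a b; have [] := H a b.
have ae2 : {ae nu, forall x, cim (D x) = 0}.
  have H a b := @integral_box_indic (fun x => cim (D x)) _ (measurable_box a b).
  have {}H a b : nu.-integrable (box a b) (fun x => (cim (D x))%:E) /\ (\int[nu]_(x in box a b) (cim (D x))%:E = 0)%E.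
    apply: H; first by have [_ +] := cD a b; apply: eq_integrable => // x _; rewrite cim_rcM.
    by have /(congr1 cim) := D0 a b; rewrite {1}/cim/= => <-; apply: eq_Rintegral => x _; rewrite cim_rcM.
  by apply: ae0_box_integrals => a b; have [] := H a b.
apply: ae_eqNP => //; apply: filterS2 ae1 ae2 => x h1 h2.
by apply/eqP; rewrite -subr_eq0; apply/eqP; exact: complexP.
Qed.

End InversionAlmostEverywhere.

(** * Integrability of the transform of a Sobolev function *)

Section SobolevTransform.
Context {R : realType} (N : nat).
Hypothesis N0 : (0 < N)%N.
Local Notation mu := (@lebesgue_measure R).
Local Notation nu := (@lebN R N).
Implicit Types xi : N.-tuple R.

Lemma measurable_sobolev_weight (s : R) :
  measurable_fun setT (fun xi : N.-tuple R => (1 + enorm xi ^+ 2) `^ s).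
Proof.
apply: (@measurableT_comp _ _ _ _ _ _ (fun y : R => y `^ s)); first exact: measurable_powR.
by apply: measurable_funD; [exact: measurable_cst|apply: measurable_funX; exact: measurable_enorm].
Qed.

Lemma sobolev_weight_gt0 xi : 0 < 1 + enorm xi ^+ 2.
Proof. by rewrite ltr_pwDl ?sqr_ge0. Qed.

(** For each i, (1 + |xi_i|)^2 <= 2 (1 + |xi|^2). Raising to the power tau / N and multiplying over
    i bounds the weight by a product of powers (1 + |xi_i|)^(- q) with q = 2 tau / N > 1. *)
Lemma integrable_sobolev_weight (tau : R) : N%:R / 2 < tau ->
  nu.-integrable setT (fun xi => ((1 + enorm xi ^+ 2) `^ (- tau))%:E).
Proof.
move=> tauN; have n0 : 0 < N%:R :> R by rewrite ltr0n.
have tau0 : 0 < tau by apply: lt_trans tauN; rewrite divr_gt0.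
pose p := tau / N%:R; pose q := p * 2; have p0 : 0 < p by rewrite divr_gt0.
have q1 : 1 < q by rewrite /q /p mulrAC ltr_pdivlMr// mul1r -ltr_pdivrMr.
have cf (i : 'I_N) : cintegrable mu (fun y => rc ((1 + `|y|) `^ (- q))).
  by split; [exact: integrable_power_decay|exact: integrable0].
have [[iP _] _] := cint_tuple_prod cf.
have id : nu.-integrable setT (fun xi => (2 `^ tau * \prod_(i < N) (1 + `|tnth xi i|) `^ (- q))%:E).
  under eq_fun do rewrite EFinM; apply: integrableZl => //.
  by apply: eq_integrable iP => // xi _; rewrite -rc_prod.
apply: (le_integrable measurableT _ _ id).
  by apply/measurable_EFinP; exact: measurable_sobolev_weight.
move=> xi _; rewrite lee_fin ger0_norm ?powR_ge0// (le_trans _ (ler_norm _))//.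
have E : \prod_(i < N) (1 + `|tnth xi i|) `^ (- q) = (\prod_(i < N) (1 + `|tnth xi i|) `^ q)^-1.
  by rewrite -prodfV; apply: eq_bigr => i _; rewrite powRN.
have P0 : 0 < \prod_(i < N) (1 + `|tnth xi i|) `^ q.
  by apply: prodr_gt0 => i _; rewrite powR_gt0// ltr_pwDl.
have W0 : 0 < (1 + enorm xi ^+ 2) `^ tau by rewrite powR_gt0// sobolev_weight_gt0.
rewrite E powRN ler_pdivlMr// mulrC ler_pdivrMr// -powRM//; last exact/ltW/sobolev_weight_gt0.
have -> : (2 * (1 + enorm xi ^+ 2)) `^ tau = \prod_(i < N) (2 * (1 + enorm xi ^+ 2)) `^ p.
  by rewrite prodr_const card_ord -[RHS]powR_mulrn ?powR_ge0// -powRrM /p divfK ?gt_eqF.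
apply: ler_prod => i _; rewrite powR_ge0/= /q mulrC powRrM powR_mulrn; last by rewrite addr_ge0.
have x2 := norm_tnth_le_enorm xi i.
have W1 := ltW (sobolev_weight_gt0 xi).
suff h : (1 + `|tnth xi i|) ^+ 2 <= 2 * (1 + enorm xi ^+ 2).
  apply: ge0_ler_powR h; [exact: ltW|by rewrite nnegrE sqr_ge0|by rewrite nnegrE mulr_ge0].
have : `|tnth xi i| ^+ 2 <= enorm xi ^+ 2 by rewrite ler_sqr ?nnegrE ?sqrtr_ge0.
have := sqr_ge0 (`|tnth xi i| - 1); move: (`|tnth xi i|) (enorm xi ^+ 2) => u v; nra.
Qed.

Variables (tau : R) (phi phihat : N.-tuple R -> R[i]).
Hypotheses (tauN : N%:R / 2 < tau) (sphi : sobolev_L2 tau phi) (FTphi : is_L2_fourier phi phihat).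

Lemma L2_integrable : nu.-integrable setT (fun x => (cmod (phi x) ^+ 2)%:E).
Proof.
have [[mphi fin_phi] _] := sphi.
have mE : measurable_fun setT (fun x => (cmod (phi x) ^+ 2)%:E).
  by apply/measurable_EFinP; apply: measurable_funX; exact: measurable_cmod.
apply/integrableP; split => //; under eq_integral do rewrite gee0_abs ?lee_fin ?sqr_ge0//.
by rewrite -nnintNE// => x; rewrite lee_fin sqr_ge0.
Qed.

(** The Sobolev condition provides some transform g, whereas [phihat] is prescribed; both are L2
    limits of the same transforms of truncations. *)
Lemma L2_fourier_unique (g : N.-tuple R -> R[i]) : is_L2_fourier phi g ->
  {ae nu, forall xi, phihat xi = g xi}.
Proof.
move=> [mg FTg]; have [mh FTh] := FTphi; have [[mphi _] _] := sphi; have iphi := L2_integrable.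
have md : cmeas (fun xi => phihat xi - g xi) by exact: cmeasB.
have mE : measurable_fun setT (fun xi => (cmod (phihat xi - g xi) ^+ 2)%:E).
  by apply/measurable_EFinP; apply: measurable_funX; exact: measurable_cmod.
have d0 xi : (0 <= (cmod (phihat xi - g xi) ^+ 2)%:E)%E by rewrite lee_fin sqr_ge0.
have I0 : (\int[nu]_xi (cmod (phihat xi - g xi) ^+ 2)%:E = 0)%E.
  apply/eqP; rewrite eq_le integral_ge0// andbT; apply/lee_addgt0Pr => e e0; rewrite add0e.
  have e4 : 0 < e / 4 by rewrite divr_gt0.
  have [n _ /(_ n (leqnn n))[[i1 h1] [i2 h2]]] := filterI (trunc_FT_L2_near mphi iphi mh FTh e4)
    (trunc_FT_L2_near mphi iphi mg FTg e4).
  have i2' (f : N.-tuple R -> R) : nu.-integrable setT (fun xi => (f xi)%:E) ->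
      nu.-integrable setT (fun xi => (2 * f xi)%:E).
    by move=> i_f; under eq_fun do rewrite EFinM; exact: integrableZl.
  have i12 : nu.-integrable setT (fun xi => (2 * cmod (trunc_FT phi n%:R xi - phihat xi) ^+ 2)%:E +
      (2 * cmod (trunc_FT phi n%:R xi - g xi) ^+ 2)%:E)%E.
    by apply: integrableD => //; [exact: (i2' _ i1)|exact: (i2' _ i2)].
  apply: (@le_trans _ _ (\int[nu]_xi ((2 * cmod (trunc_FT phi n%:R xi - phihat xi) ^+ 2)%:E +
      (2 * cmod (trunc_FT phi n%:R xi - g xi) ^+ 2)%:E))%E).
    apply: ge0_le_integral => //.
      by case/integrableP: i12.
    move=> xi _; rewrite -EFinD lee_fin.
    have -> : phihat xi - g xi = (trunc_FT phi n%:R xi - g xi) + - (trunc_FT phi n%:R xi - phihat xi) by ring.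
    by rewrite (le_trans (sqr_cmodD _ _))// cmodN addrC.
  rewrite -(@fineK _ (\int[nu]_xi _)%E) ?(integrable_fin_num measurableT i12)// lee_fin.
  rewrite -[leLHS]/(\int[nu]_xi (2 * cmod (trunc_FT phi n%:R xi - phihat xi) ^+ 2 + 2 * cmod (trunc_FT phi n%:R xi - g xi) ^+ 2)).
  rewrite RintegralD//; [|exact: (i2' _ i1)|exact: (i2' _ i2)].
  rewrite !RintegralZl//; move: (\int[nu]_xi _) (\int[nu]_xi _) h1 h2 => u v; lra.
have [+ _] := ae_eq_integral_abs nu measurableT mE.
under eq_integral do rewrite gee0_abs//.
move=> /(_ I0); apply: filterS => xi /(_ Logic.I) [] /eqP; rewrite sqrf_eq0 => /eqP h.
apply/eqP; rewrite -subr_eq0; apply/eqP/complexP; apply/eqP; rewrite -normr_eq0 eq_le normr_ge0 andbT.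
  by rewrite (le_trans (norm_cre_le _))// h.
by rewrite (le_trans (norm_cim_le _))// h.
Qed.

(** With w the Sobolev weight and t = |g|, the inequality 2 t <= w t^2 + 1 / w bounds g by two
    integrable functions, in the role of Cauchy-Schwarz. Almost everywhere equality transfers the
    result to [phihat]. *)
Lemma cintegrable_phihat : cintegrable nu phihat.
Proof.
have [_ [g [FTg fin_g]]] := sphi; have [mg _] := FTg; have [mh _] := FTphi.
have mw : measurable_fun setT (fun xi => ((1 + enorm xi ^+ 2) `^ tau * cmod (g xi) ^+ 2)%:E).
  apply/measurable_EFinP; apply: measurable_funM; first exact: measurable_sobolev_weight.
  by apply: measurable_funX; exact: measurable_cmod.
have w0 xi : 0 <= (1 + enorm xi ^+ 2) `^ tau * cmod (g xi) ^+ 2 by rewrite mulr_ge0 ?powR_ge0 ?sqr_ge0.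
have iw : nu.-integrable setT (fun xi => ((1 + enorm xi ^+ 2) `^ tau * cmod (g xi) ^+ 2)%:E).
  apply/integrableP; split => //; under eq_integral do rewrite gee0_abs ?lee_fin//.
  by rewrite -nnintNE.
have id : nu.-integrable setT (fun xi => ((1 + enorm xi ^+ 2) `^ tau * cmod (g xi) ^+ 2 +
    (1 + enorm xi ^+ 2) `^ (- tau))%:E).
  by under eq_fun do rewrite EFinD; apply: integrableD => //; exact: integrable_sobolev_weight.
have cg : cintegrable nu g.
  apply: (cintegrable_dom _ id) => // xi; rewrite powRN.
  have : 0 < (1 + enorm xi ^+ 2) `^ tau by rewrite powR_gt0// sobolev_weight_gt0.
  have := cmod_ge0 (g xi); move: (_ `^ tau) (cmod _) => w t t0 w0'.
  rewrite (@le_trans _ _ (2 * t))//; first by rewrite ler_peMl// ler1n.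
  rewrite -subr_ge0 (_ : _ - _ = w * (t - w^-1) ^+ 2); first by rewrite mulr_ge0 ?sqr_ge0// ltW.
  by field; rewrite gt_eqF.
apply: cintegrableP => //.
have -> : (\int[nu]_xi (cmod (phihat xi))%:E = \int[nu]_xi (cmod (g xi))%:E)%E.
  apply: ae_eq_integral => //; try by apply/measurable_EFinP; exact: measurable_cmod.
  by apply: filterS (L2_fourier_unique FTg) => xi -> _.
have /integrableP[_] := integrable_cmod cg.
by under eq_integral do rewrite gee0_abs ?lee_fin ?cmod_ge0//.
Qed.

End SobolevTransform.

(** * The forward problem *)

Section Ellipticity.
Context {R : realType} (N l : nat) (a : {ffun 'I_N -> 'I_(2 * l).+1} -> R).
Hypotheses (N0 : (0 < N)%N) (l0 : (0 < l)%N).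
Hypothesis ell : forall xi : N.-tuple R, xi != zero_pt N -> 0 < symbol a xi.
Implicit Types xi : N.-tuple R.

Lemma symbol_homogeneous (r : R) xi :
  symbol a [tuple r * tnth xi i | i < N] = r ^+ (2 * l) * symbol a xi.
Proof.
rewrite /symbol mulr_sumr; apply: eq_bigr => alpha /eqP ha.
rewrite mulrCA; congr (_ * _).
have -> : r ^+ (2 * l) = \prod_(j < N) r ^+ alpha j by rewrite prodrXr; congr (_ ^+ _).
rewrite -big_split/=.
by apply: eq_bigr => i _; rewrite tnth_mktuple exprMn.
Qed.

Lemma measurable_symbol : measurable_fun setT (symbol a).
Proof.
rewrite /symbol; under eq_fun do rewrite big_mkcond/=.
apply: measurable_sum => alpha; case: (_ == _); last exact: measurable_cst.
apply: measurable_funM; first exact: measurable_cst.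
by apply: measurable_prod => i _; apply: measurable_funX; exact: measurable_tnth.
Qed.

Let row_tuple (v : 'rV[R]_N) : N.-tuple R := [tuple v ord0 i | i < N].

Let continuous_symbol_row : continuous (fun v => symbol a (row_tuple v)).
Proof.
have cc i : continuous (fun v => tnth (row_tuple v) i).
  by move=> v; under eq_fun do rewrite tnth_mktuple; exact: coord_continuous.
have cX i k : continuous (fun v => tnth (row_tuple v) i ^+ k).
  elim: k => [|k IH]; first exact: (@cst_continuous _ _ (1 : R)).
  rewrite (_ : (fun v => _) = (fun v => tnth (row_tuple v) i * tnth (row_tuple v) i ^+ k)).
    move=> v; exact: (continuousM (cc i v) (IH v)).
  by apply/funext => v; rewrite exprS.
have cP (s : seq 'I_N) k : continuous (fun v => \prod_(i <- s) tnth (row_tuple v) i ^+ k i).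
  elim: s => [|i s IH].
    rewrite (_ : (fun v => _) = (fun=> 1)); first exact: cst_continuous.
    by apply/funext => v; rewrite big_nil.
  rewrite (_ : (fun v => _) = (fun v => tnth (row_tuple v) i ^+ k i * \prod_(i <- s) tnth (row_tuple v) i ^+ k i)).
    by move=> v; exact: (continuousM (cX i (k i) v) (IH v)).
  by apply/funext => v; rewrite big_cons.
rewrite /symbol; elim: (index_enum _) => [|al s IH].
  rewrite (_ : (fun v => _) = (fun=> 0)); first exact: cst_continuous.
  by apply/funext => v; rewrite big_nil.
pose c := if mi_order (fun j => al j : nat) == (2 * l)%N then a al else 0.
move: IH; set f := (X in continuous X) => IH; rewrite (_ : (fun v => _) = (fun v => c * \prod_(j <- index_enum 'I_N) tnth (row_tuple v) j ^+ al j + f v)).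
  move=> v; apply: continuousD (IH v).
  by apply: continuousM; [exact: cst_continuous|exact: (cP _ (fun j => al j))].
by apply/funext => v; rewrite big_cons /c /f; case: ifP => _; rewrite ?mul0r ?add0r.
Qed.

Let norm_coord (v : 'rV[R]_N) i : `|v ord0 i| <= `|v|.
Proof.
rewrite [leRHS]/Num.norm/= mx_normrE.
exact: (@le_bigmax _ _ _ 0 (fun ij : 'I_1 * 'I_N => `|v ij.1 ij.2|) (ord0, i)).
Qed.

(* The minimum of the symbol on the unit sphere of the maximum norm. *)
Lemma symbol_lower_bound : exists2 c : R, 0 < c & forall xi i, c * `|tnth xi i| ^+ (2 * l) <= symbol a xi.
Proof.
pose S := [set v : 'rV[R]_N | `|v| = 1].
have cS : compact S.
  apply: bounded_closed_compact.
    by exists 1; split => // M M1 v /= ->; exact: ltW.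
  rewrite (_ : S = (fun v : 'rV[R]_N => `|v|) @^-1` [set 1])//.
  apply: preimage_closed; last exact: closed_eq.
  by move=> v _; exact: norm_continuous.
have S0 : S !=set0.
  exists (const_mx 1); apply/eqP; rewrite eq_le; apply/andP; split.
    rewrite [leLHS]/Num.norm/= mx_normrE.
    by apply: bigmax_le => // ij _; rewrite mxE normr1.
  by have := norm_coord (const_mx 1) (Ordinal N0); rewrite mxE normr1.
have [v0 /set_mem Sv0 hv0] := EVT_min_rV S0 cS (continuous_subspaceT continuous_symbol_row).
have tz v : row_tuple v = zero_pt N -> v = 0.
  move=> h; apply/rowP => i; have := congr1 (fun t => tnth t i) h.
  by rewrite !tnth_mktuple mxE.
exists (symbol a (row_tuple v0)).
  by apply: ell; apply/eqP => /tz v00; move: Sv0; rewrite /S/= v00 normr0 => /esym/eqP; rewrite oner_eq0.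
move=> xi i; pose v : 'rV[R]_N := \row_j tnth xi j; pose r := `|v|.
have xiE : xi = [tuple r * tnth (row_tuple (r^-1 *: v)) j | j < N].
  apply: eq_from_tnth => j; rewrite !tnth_mktuple !mxE.
  (* For r = 0 the inverse is 0 by convention, and the identity holds because xi itself is 0. *)
  have [r0|r0] := eqVneq r 0; last by rewrite mulVKf.
  by rewrite r0 mul0r; have /normr0_eq0/rowP/(_ j) := r0; rewrite !mxE.
have vi : `|tnth xi i| <= r by have := norm_coord v i; rewrite mxE.
rewrite [leRHS](_ : _ = symbol a [tuple r * tnth (row_tuple (r^-1 *: v)) j | j < N]); last by rewrite -xiE.
rewrite symbol_homogeneous.
have [r0|r0] := eqVneq r 0.
  have -> : `|tnth xi i| = 0 by apply/eqP; rewrite eq_le normr_ge0 -r0 vi.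
  by rewrite r0 !expr0n muln_eq0/= eqn0Ngt l0/= mulr0 mul0r.
rewrite mulrC; apply: ler_pM => //.
- rewrite ltW// ell//; apply/eqP => /tz v00; move: Sv0; rewrite /S/= v00 normr0 => /esym/eqP; rewrite oner_eq0//.
- by apply: lerXn2r => //; rewrite nnegrE// /r.
- apply: hv0; rewrite mem_set// /S/= normrZ normfV normr_id mulVf//.
Qed.

Lemma symbol_ge0 xi : 0 <= symbol a xi.
Proof.
have [c c0 h] := symbol_lower_bound; apply: le_trans (h xi (Ordinal N0)).
by rewrite mulr_ge0 ?(ltW c0)// exprn_ge0.
Qed.

(** A monomial of degree k <= 2l is at most the k-th power of the largest coordinate, hence at most
    1 plus its 2l-th power, which ellipticity compares with the symbol. Monomials are indexed by
    sequences of directions, to match [pd_seq]. *)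
Lemma monomial_le_symbol : exists2 K : R, 0 < K & forall (s : seq 'I_N) xi, (size s <= 2 * l)%N ->
  \prod_(j <- s) `|tnth xi j| <= K * (1 + symbol a xi).
Proof.
have [c c0 h] := symbol_lower_bound; exists (1 + c^-1); first by rewrite addr_gt0// invr_gt0.
move=> s xi sl.
have [i hi] : exists i, forall j, `|tnth xi j| <= `|tnth xi i|.
  pose i := [arg max_(i > Ordinal N0) `|tnth xi i|]%O; exists i => j.
  by rewrite /i; case: arg_maxP => // k _; exact.
apply: (@le_trans _ _ (`|tnth xi i| ^+ size s)).
  elim: s {sl} => [|j s IH]; first by rewrite big_nil.
  by rewrite big_cons exprS ler_pM// prodr_ge0.
apply: (@le_trans _ _ (1 + `|tnth xi i| ^+ (2 * l))).
  have [x1|x1] := leP `|tnth xi i| 1.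
    by rewrite (@le_trans _ _ 1) ?exprn_ile1// lerDl exprn_ge0.
  by rewrite (@le_trans _ _ (`|tnth xi i| ^+ (2 * l))) ?lerDr// ler_weXn2l// ltW.
have h1 : `|tnth xi i| ^+ (2 * l) <= c^-1 * symbol a xi by rewrite ler_pdivlMl.
have A0 := symbol_ge0 xi; have c1 : 0 < c^-1 by rewrite invr_gt0.
rewrite mulrDl mul1r mulrDr mulr1; apply: (@le_trans _ _ (1 + c^-1 * symbol a xi)); first by rewrite lerD2l.
by apply: lerD; [rewrite lerDl|rewrite lerDr ltW].
Qed.

End Ellipticity.

(** * Differentiation under the integral sign and Fourier multipliers *)

Lemma is_derive_Rintegral d (T : measurableType d) (R : realType) (mu : {measure set T -> \bar R})
    (f df : R -> T -> R) (a u v : R) (G : T -> R) : u < a < v ->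
  (forall x, u < x < v -> mu.-integrable setT (fun y => (f x y)%:E)) ->
  (forall x y, u < x < v -> is_derive (x : R) (1 : R) (f ^~ y) (df x y)) ->
  mu.-integrable setT (fun y => (G y)%:E) ->
  (forall x y, u < x < v -> `|df x y| <= G y) ->
  is_derive (a : R) (1 : R) (fun x => \int[mu]_y f x y) (\int[mu]_y df a y).
Proof.
move=> auv intf derf intG hG.
have Ia : `]u, v[%classic a by rewrite /= in_itv.
have intf' x : `]u, v[%classic x -> mu.-integrable setT (EFin \o f x).
  by rewrite /= in_itv/=; exact: intf.
have derf' x y : `]u, v[%classic x -> setT y -> derivable (f ^~ y) x 1.
  by rewrite /= in_itv/= => hx _; have [] := derf x y hx.
have dE x y : `]u, v[%classic x -> partial1of2 f x y = df x y.
  rewrite /= in_itv/= => hx; rewrite partial1of2E; have dfx := derf x y hx.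
  by rewrite derive_val.
have G0 y : 0 <= G y by exact: le_trans (normr_ge0 _) (hG a y auv).
have G_ub x y : `]u, v[%classic x -> setT y -> `|partial1of2 f x y| <= G y.
  by move=> hx _; rewrite dE//; apply: hG; move: hx; rewrite /= in_itv.
have D := derivable_under_integral measurableT Ia intf' derf' G0 intG G_ub.
apply: DeriveDef => //; rewrite -derive1E (differentiation_under_integral measurableT Ia intf' derf' G0 intG G_ub).
by apply: eq_Rintegral => y _; rewrite dE.
Qed.

Section FourierDerivative.
Context {R : realType} (N : nat).
Local Notation nu := (@lebN R N).
Implicit Types (x xi : N.-tuple R) (G : N.-tuple R -> R[i]).

Lemma dotp_shift x j (s : R) xi : dotp (Defs.shift x j s) xi = dotp x xi + s * tnth xi j.
Proof.
rewrite /dotp (bigD1 j)//= [in RHS](bigD1 j)//= tnth_mktuple eqxx mulrDl -!addrA; congr (_ + _).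
rewrite addrC; congr (_ + _); apply: eq_bigr => i /negbTE ij.
by rewrite tnth_mktuple ij addr0.
Qed.

(** The modulus of the differentiated integrand is that of xi_j G, whatever the increment s, and so
    is its own dominating function. *)
Lemma pderiv_fint G j x : cintegrable nu G -> cintegrable nu (fun xi => Complex 0 (tnth xi j) * G xi) ->
  pderivable j (fint G) x /\
  pderiv j (fint G) x = fint (fun xi => Complex 0 (tnth xi j) * G xi) x.
Proof.
move=> cG cH; pose e s xi := G xi * cexpi (dotp x xi + s * tnth xi j).
pose de s xi := Complex 0 (tnth xi j) * G xi * cexpi (dotp x xi + s * tnth xi j).
have mH := measurable_cmod (cintegrable_meas cH).
have ce (s : R) : cintegrable nu (e s).
  have := cintegrable_fint (Defs.shift x j s) cG; congr cintegrable.
  by apply/funext => xi; rewrite dotp_shift.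
have th (s : R) (u v : R) : is_derive (s : R) (1 : R) (fun s : R => s * v + u) v.
  by apply: is_derive_eq; rewrite -![_ *: _]/(_ * _); ring.
have dre s xi : is_derive (s : R) (1 : R) (fun s => cre (e s xi)) (cre (de s xi)).
  rewrite (_ : (fun s => _) = (fun s : R => cre (G xi) * cos (s * tnth xi j + dotp x xi) - cim (G xi) * sin (s * tnth xi j + dotp x xi))); last first.
    by apply/funext => s'; rewrite creM (addrC (dotp x xi)).
  have h0 := th s (dotp x xi) (tnth xi j).
  have h1 := @is_derive1_comp _ cos _ s _ _ (is_derive_cos _) h0.
  have h2 := @is_derive1_comp _ sin _ s _ _ (is_derive_sin _) h0.
  apply: is_derive_eq; rewrite -![_ *: _]/(_ * _) /de !creM !cimM (addrC (dotp x xi)) /cexpi /cre /cim/=.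
  by ring.
have dim s xi : is_derive (s : R) (1 : R) (fun s => cim (e s xi)) (cim (de s xi)).
  rewrite (_ : (fun s => _) = (fun s : R => cre (G xi) * sin (s * tnth xi j + dotp x xi) + cim (G xi) * cos (s * tnth xi j + dotp x xi))); last first.
    by apply/funext => s'; rewrite cimM (addrC (dotp x xi)).
  have h0 := th s (dotp x xi) (tnth xi j).
  have h1 := @is_derive1_comp _ cos _ s _ _ (is_derive_cos _) h0.
  have h2 := @is_derive1_comp _ sin _ s _ _ (is_derive_sin _) h0.
  apply: is_derive_eq; rewrite -![_ *: _]/(_ * _) /de !cimM !creM (addrC (dotp x xi)) /cexpi /cre /cim/=.
  by ring.
have bd s xi : cmod (de s xi) <= cmod (Complex 0 (tnth xi j) * G xi).
  by rewrite [leLHS]cmodM cmod_cexpi mulr1.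
have i01 : ((-1 : R) < (0 : R)) && ((0 : R) < (1 : R)) by rewrite ltrN10 ltr01.
have d1 : is_derive (0 : R) (1 : R) (fun s => \int[nu]_xi cre (e s xi)) (\int[nu]_xi cre (de 0 xi)).
  apply: (@is_derive_Rintegral _ _ _ nu (fun s xi => cre (e s xi)) (fun s xi => cre (de s xi)) _ _ _ _ i01 _ _ (integrable_cmod cH)).
  - by move=> s _; have [] := ce s.
  - by move=> s xi _; exact: le_trans (norm_cre_le _) (bd s xi).
have d2 : is_derive (0 : R) (1 : R) (fun s => \int[nu]_xi cim (e s xi)) (\int[nu]_xi cim (de 0 xi)).
  apply: (@is_derive_Rintegral _ _ _ nu (fun s xi => cim (e s xi)) (fun s xi => cim (de s xi)) _ _ _ _ i01 _ _ (integrable_cmod cH)).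
  - by move=> s _; have [] := ce s.
  - by move=> s xi _; exact: le_trans (norm_cim_le _) (bd s xi).
have E1 : (fun s => cre (fint G (Defs.shift x j s))) = (fun s => \int[nu]_xi cre (e s xi)).
  by apply/funext => s; rewrite {1}/cre/=; apply: eq_Rintegral => xi _; rewrite dotp_shift.
have E2 : (fun s => cim (fint G (Defs.shift x j s))) = (fun s => \int[nu]_xi cim (e s xi)).
  by apply/funext => s; rewrite {1}/cim/=; apply: eq_Rintegral => xi _; rewrite dotp_shift.
split; first by split; rewrite ?E1 ?E2; [have [] := d1|have [] := d2].
rewrite /pderiv E1 E2 !derive1E !derive_val; rewrite /fint /cint; congr Complex.
  by apply: eq_Rintegral => xi _; rewrite /de mul0r addr0.
by apply: eq_Rintegral => xi _; rewrite /de mul0r addr0.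
Qed.

(** The Fourier multiplier of [pd_seq s]: one factor i xi_j for each derivative. *)
Definition monomial_mul (s : seq 'I_N) G xi := (\prod_(j <- s) Complex 0 (tnth xi j)) * G xi.

(** [pd_seq] differentiates from the tail of the list, so the intermediate functions correspond to
    the suffixes of s. *)
Lemma pd_seq_fint G s : (forall s', suffix s' s -> cintegrable nu (monomial_mul s' G)) ->
  pd_seq_ok s (fint G) /\ pd_seq s (fint G) = fint (monomial_mul s G).
Proof.
elim: s => [|j s IH] h.
  split => //=; apply/funext => x; apply: eq_cint => xi.
  by rewrite /monomial_mul big_nil mul1r.
have hs s' : suffix s' s -> suffix s' (j :: s).
  by move=> ss; rewrite -cat1s; apply: suffix_trans ss _; rewrite suffix_suffix.
have [IH1 IH2] := IH (fun s' ss => h s' (hs s' ss)).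
have H x : pderivable j (fint (monomial_mul s G)) x /\
    pderiv j (fint (monomial_mul s G)) x = fint (monomial_mul (j :: s) G) x.
  have E : monomial_mul (j :: s) G = (fun xi => Complex 0 (tnth xi j) * monomial_mul s G xi).
    by apply/funext => xi; rewrite /monomial_mul big_cons mulrA.
  rewrite E; apply: pderiv_fint; first by apply: h; apply: hs; exact: suffix_refl.
  by rewrite -E; apply: h; exact: suffix_refl.
split => /=; first by split => // x; rewrite IH2; have [] := H x.
by rewrite IH2; apply/funext => x; have [] := H x.
Qed.

Lemma cmod_imag (y : R) : cmod (Complex 0 y) = `|y|.
Proof. by rewrite /cmod /cre /cim/= expr0n/= add0r sqrtr_sqr. Qed.

Lemma prod_imag (alpha : 'I_N -> nat) xi :
  \prod_(j <- dirs alpha) Complex 0 (tnth xi j) =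
  Complex 0 1 ^+ mi_order alpha * rc (\prod_(j < N) tnth xi j ^+ alpha j).
Proof.
rewrite /dirs big_flatten big_map /mi_order expr_sum rc_prod -big_split/= -big_enum/=.
apply: eq_bigr => j _; elim: (alpha j) => [|k IH]; first by rewrite big_nil !expr0 mulr1.
rewrite /= big_cons IH !exprS rcM.
rewrite (_ : Complex 0 (tnth xi j) = Complex 0 1 * rc (tnth xi j)); first by ring.
by apply: complexP; rewrite ?creM ?cimM /cre /cim/=; ring.
Qed.

Lemma size_dirs (alpha : 'I_N -> nat) : size (dirs alpha) = mi_order alpha.
Proof.
rewrite /dirs size_flatten /shape -map_comp sumnE big_map /mi_order -big_enum/=.
by apply: eq_bigr => j _; rewrite size_nseq.
Qed.

Lemma fint_sum (I : Type) (s : seq I) (P : pred I) (G : I -> N.-tuple R -> R[i]) x :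
  (forall i, P i -> cintegrable nu (G i)) ->
  cintegrable nu (fun xi => \sum_(i <- s | P i) G i xi) /\
  fint (fun xi => \sum_(i <- s | P i) G i xi) x = \sum_(i <- s | P i) fint (G i) x.
Proof.
move=> cG.
have z0 : cintegrable nu (fun=> 0).
  apply: (cintegrable_dom _ (integrable0 _ _)); first exact: cmeas_cst.
  by move=> xi; rewrite cmod0.
elim: s => [|i s [IH1 IH2]].
  under eq_fun do rewrite big_nil; rewrite big_nil; split => //.
  by rewrite -[RHS](mul0r (fint (fun=> 0) x)) -fintZ//; apply: eq_cint => xi; rewrite mulr0.
under eq_fun do rewrite big_cons; rewrite big_cons; case: ifPn => Pi.
  by split; [apply: cintegrableD => //; exact: cG|rewrite fintD// ?IH2//; exact: cG].
by split.
Qed.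

End FourierDerivative.

(** * Time evolution: relaxation functions and the Caputo derivative of their superpositions *)

Section Relaxation.
Context {R : realType}.
Implicit Types rho lam t : R.

(** Agrees with [mlf rho 1 lam] for t > 0. At t = 0, where [mlf] is 0 by convention, it has the
    value 1 that the initial condition requires. *)
Definition relax rho lam t : R := mittag_leffler rho (- lam * t `^ rho).
Definition relax_bound rho t : R := Gamma (1 + rho) / t `^ rho.

Lemma relax0 rho lam : 0 < rho -> relax rho lam 0 = 1.
Proof. by move=> r0; rewrite /relax powR0 ?gt_eqF// mulr0 mittag_lefflerE ml2_0 Gamma1 invr1. Qed.

Lemma relax_ge0_le1 rho lam t : 0 < rho -> rho < 1 -> 0 <= lam -> 0 <= t -> 0 <= relax rho lam t <= 1.
Proof.
move=> r0 r1 l0; rewrite le_eqVlt => /predU1P[<-|t0]; first by rewrite relax0// ler01 lexx.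
rewrite /relax -(mlf1E _ _ t0); apply/andP; split; first exact: mlf1_ge0.
exact: mlf1_le1.
Qed.

Lemma relax_decay rho lam t : 0 < rho -> rho < 1 -> 0 <= lam -> 0 < t ->
  lam * relax rho lam t <= relax_bound rho t.
Proof.
move=> r0 r1 l0 t0; have := mlf1_decay r0 r1 l0 t0.
rewrite (mlf1E _ _ t0) -/(relax rho lam t) /relax_bound.
move: (relax _ _ _) (Gamma _) => y g h.
by rewrite ler_pdivlMr ?powR_gt0// mulrAC.
Qed.

Lemma relax_bound_ge0 rho t : 0 < rho -> 0 <= relax_bound rho t.
Proof.
move=> r0; rewrite /relax_bound; have := Gamma_gt0 (addr_gt0 (@ltr01 R) r0); move: (Gamma _) => g g0.
by rewrite divr_ge0 ?powR_ge0// ltW.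
Qed.

Lemma relax_bound_le rho s t : 0 < rho -> 0 < s -> s <= t -> relax_bound rho t <= relax_bound rho s.
Proof.
move=> r0 s0 st; rewrite /relax_bound; have := Gamma_gt0 (addr_gt0 (@ltr01 R) r0); move: (Gamma _) => g g0.
rewrite ler_pM2l// lef_pV2 ?posrE ?powR_gt0//; last exact: lt_le_trans st.
by apply: ge0_ler_powR; rewrite ?nnegrE ?(ltW r0) ?(ltW s0)// (le_trans (ltW s0)).
Qed.

Lemma cvg_relax rho lam t (u : nat -> R) : 0 < rho -> 0 < t -> u n @[n --> \oo] --> t ->
  relax rho lam (u n) @[n --> \oo] --> relax rho lam t.
Proof.
move=> r0 t0 ut.
have E z : mittag_leffler rho z = ml2 rho 1 z := mittag_lefflerE rho z.
have h : - lam * u n `^ rho @[n --> \oo] --> - lam * t `^ rho.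
  apply: cvgM; first exact: cvg_cst.
  exact: (cvg_comp _ _ ut (continuous_powR t0)).
rewrite /relax; under eq_fun do rewrite E; rewrite E.
exact: (cvg_comp _ _ h (@continuous_ml2 R rho r0 1 ltr01 _)).
Qed.

End Relaxation.

Lemma integrable_Rfubini1 d1 d2 (T1 : measurableType d1) (T2 : measurableType d2) (R : realType)
    (m1 : {sigma_finite_measure set T1 -> \bar R}) (m2 : {sigma_finite_measure set T2 -> \bar R})
    (f : T1 * T2 -> R) : (m1 \x m2)%E.-integrable setT (fun z => (f z)%:E) ->
  m1.-integrable setT (fun x => (\int[m2]_y f (x, y))%:E).
Proof.
move=> imf; have iF := integrable_fubini_F imf.
apply: (le_integrable measurableT _ _ iF).
  by apply/measurable_EFinP; exact: (measurable_Rfubini1 imf).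
move=> x _; rewrite /Rintegral /fubini_F/=; by case: (\int[m2]_y _)%E => //=; rewrite leey.
Qed.

Section Superposition.
Context d (T : measurableType d) (R : realType) (nu : {sigma_finite_measure set T -> \bar R}).
Variables (rho : R) (A F : T -> R).
Hypotheses (rho0 : 0 < rho) (rho1 : rho < 1) (A0 : forall xi, 0 <= A xi).
Hypotheses (mA : measurable_fun setT A) (iF : nu.-integrable setT (fun xi => (F xi)%:E)).
Local Notation mu := (@lebesgue_measure R).
Local Notation w xi s := (mlf rho rho (A xi) s).
Local Notation Y xi t := (relax rho (A xi) t).

Let mF : measurable_fun setT F.
Proof. by have /measurable_int/measurable_EFinP := iF. Qed.

Lemma measurable_relax t : measurable_fun setT (fun xi => Y xi t).
Proof.
have E z : mittag_leffler rho z = ml2 rho 1 z := mittag_lefflerE rho z.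
rewrite /relax; under eq_fun do rewrite E.
apply: (measurableT_comp (measurable_ml2 rho0 ltr01)).
by apply: measurable_funM; [exact: measurable_funN|exact: measurable_cst].
Qed.

Let mw : measurable_fun setT (fun z : measurableTypeR R * T => w z.2 z.1).
Proof.
rewrite /mlf; apply: measurable_funM.
  by apply: (measurableT_comp (measurable_ppow rho)); exact: measurable_fst.
apply: (measurableT_comp (measurable_ml2 rho0 rho0)).
apply: measurable_funM; first by apply: measurable_funN; exact: (measurableT_comp mA measurable_snd).
by apply: (measurableT_comp (measurable_powR rho)); exact: measurable_fst.
Qed.

Let w_ge0 xi s : 0 <= w xi s.
Proof.
have [s0|s0] := leP s 0; first by rewrite mlf_le0.
exact: mlf_rho_ge0.
Qed.

Let Aw_bound xi s : 0 < s -> `|- (A xi * w xi s)| <= rho / s.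
Proof.
move=> s0; have := mlf_rho_bound rho0 rho1 (A0 xi) s0; have := w_ge0 xi s.
move: (w xi s) => v v0 h.
by rewrite normrN ger0_norm ?mulr_ge0// ler_pdivlMr// mulrC.
Qed.

Let integrable_relaxF t : 0 <= t -> nu.-integrable setT (fun xi => (Y xi t * F xi)%:E).
Proof.
move=> t0; apply: (le_integrable measurableT _ _ iF).
  by apply/measurable_EFinP; apply: measurable_funM => //; exact: measurable_relax.
move=> xi _; have := relax_ge0_le1 rho0 rho1 (A0 xi) t0; move: (relax _ _ _) => y /andP[y0 y1].
by rewrite lee_fin normrM (ger0_norm y0) ler_piMl.
Qed.

(** The bound rho / x on A w is uniform in xi, so |F| dominates up to a constant. The window (s / 2,
    2 s) keeps x away from 0, where this bound blows up. *)
Lemma is_derive_superposition s : 0 < s ->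
  is_derive (s : R) (1 : R) (fun s => \int[nu]_xi (Y xi s * F xi)) (\int[nu]_xi (- (A xi * w xi s) * F xi)).
Proof.
move=> s0; have iG : nu.-integrable setT (fun xi => (rho / (s / 2) * `|F xi|)%:E).
  by under eq_fun do rewrite EFinM; apply: integrableZl => //; exact: integrable_norm.
have s12 : s / 2 < s < s * 2 by apply/andP; split; lra.
have dY x xi : s / 2 < x < s * 2 -> is_derive (x : R) (1 : R) (fun x => Y xi x * F xi) (- (A xi * w xi x) * F xi).
  move=> /andP[x1 _]; have x0 : 0 < x by apply: lt_trans x1; rewrite divr_gt0.
  have h := is_derive_mittag_leffler (A xi) rho0 x0.
  apply: is_derive_eq; rewrite -![_ *: _]/(_ * _).
  by move: (w xi x) (relax _ _ _) => v y; ring.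
apply: (@is_derive_Rintegral _ _ _ nu (fun s xi => Y xi s * F xi) (fun s xi => - (A xi * w xi s) * F xi) s (s / 2) (s * 2) _ s12 _ dY iG).
- move=> x /andP[x1 _]; apply: integrable_relaxF; rewrite ltW//; apply: lt_trans x1; rewrite divr_gt0//.
- move=> x xi /andP[x1 _]; have s20 : 0 < s / 2 by rewrite divr_gt0.
  have x0 : 0 < x := lt_trans s20 x1.
  rewrite normrM ler_wpM2r//; apply: (le_trans (Aw_bound xi x0)).
  by rewrite ler_wpM2l ?(ltW rho0)// lef_pV2 ?posrE// ltW.
Qed.

(** The integrand of the Caputo derivative before Fubini: the time derivative of the superposed
    function against k_{1-rho}. *)
Let k t (z : measurableTypeR R * T) : R := - (A z.2 * w z.2 z.1) * F z.2 * rlk (1 - rho) (t - z.1).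

Let r10 : 0 < 1 - rho. Proof. by rewrite subr_gt0. Qed.

Let mk t : measurable_fun setT (k t).
Proof.
apply: measurable_funM; first apply: measurable_funM.
- apply: measurable_funN; apply: measurable_funM => //.
  exact: (measurableT_comp mA measurable_snd).
- exact: (measurableT_comp mF measurable_snd).
- apply: (measurableT_comp (measurable_rlk (1 - rho))).
  by apply: measurable_funB; [exact: measurable_cst|exact: measurable_fst].
Qed.

Let absk t : 0 < t -> forall xi, (\int[mu]_s `|(k t (s, xi))%:E| = (A xi * Y xi t * `|F xi|)%:E)%E.
Proof.
move=> t0 xi; have [ic ec] := integral_mlf_rho_caputo (A xi) rho0 rho1 t0.
rewrite (mlf1E _ _ t0) -/(relax _ _ _) in ec.
rewrite (_ : (\int[mu]_s _)%E = (\int[mu]_s ((A xi * `|F xi|)%:E * (w xi s * rlk (1 - rho) (t - s))%:E))%E).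
  by rewrite integralZl// ec -EFinM; congr (_%:E); move: (relax _ _ _) => y; ring.
apply: eq_integral => s _; rewrite /k/= -EFinM; congr (_%:E).
have := rlk_ge0 (t - s) r10; have := w_ge0 xi s; move: (w xi s) (rlk _ _) => v q v0 q0.
rewrite 2!normrM normrN (ger0_norm (mulr_ge0 (A0 xi) v0)) (ger0_norm q0).
by ring.
Qed.

(** The pointwise bound rho / s is not integrable near s = 0, so absolute integrability is checked
    with the time integral inside: by w >= 0 and y = k_{1-rho} * w it equals A y |F|, and A y is
    bounded. *)
Let integrable_k t : 0 < t -> (mu \x nu)%E.-integrable setT (fun z => (k t z)%:E).
Proof.
move=> t0; apply/integrable21ltyP; first by apply/measurable_EFinP; exact: mk.
under eq_integral do rewrite (absk t0).
have iG : nu.-integrable setT (fun xi => (relax_bound rho t * `|F xi|)%:E).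
  by under eq_fun do rewrite EFinM; apply: integrableZl => //; exact: integrable_norm.
have /integrableP[mG] := iG; apply: le_lt_trans; apply: ge0_le_integral => //.
- move=> xi _; rewrite lee_fin; have /andP[+ _] := relax_ge0_le1 rho0 rho1 (A0 xi) (ltW t0).
  by move: (relax _ _ _) => y y0; rewrite !mulr_ge0.
- apply/measurable_EFinP; apply: measurable_funM; last exact: measurableT_comp.
  by apply: measurable_funM => //; exact: measurable_relax.
- exact: measurableT_comp.
- move=> xi _; rewrite gee0_abs ?lee_fin; last by rewrite mulr_ge0// relax_bound_ge0.
  by rewrite ler_wpM2r// relax_decay.
Qed.

(** Fubini applied to [k t]. The integral over xi gives the integrand defining the Caputo
    derivative, the integral over time gives - A y F. *)
Lemma caputo_superposition t : 0 < t ->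
  caputo_exists rho (fun s => \int[nu]_xi (Y xi s * F xi)) t /\
  caputo rho (fun s => \int[nu]_xi (Y xi s * F xi)) t = - \int[nu]_xi (A xi * Y xi t * F xi).
Proof.
move=> t0; have ik := integrable_k t0.
set H := (fun s => \int[nu]_xi (Y xi s * F xi)).
have dH s : 0 < s -> derive1 H s = \int[nu]_xi (- (A xi * w xi s) * F xi).
  by move=> s0; have h := is_derive_superposition s0; rewrite derive1E; rewrite (@derive_val _ _ _ _ _ _ _ h).
have g0 : Gamma (1 - rho) != 0 by rewrite gt_eqF// Gamma_gt0.
(* The conventions [mlf = 0] on s <= 0 and [rlk = 0] on t <= s confine the integrand to ]0, t[; the
   kernel already contains the normalisation 1 / Gamma(1 - rho). *)
have kE s : \int[nu]_xi k t (s, xi) = if (0 < s) && (s < t) then derive1 H s * ((t - s) `^ (- rho) / Gamma (1 - rho)) else 0.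
  have [s0|s0] := leP s 0.
    transitivity (\int[nu]_xi (0 : R)); last by rewrite Rintegral_cst// mul0r.
    by apply: eq_Rintegral => xi _; rewrite /k/= mlf_le0// mulr0 oppr0 !mul0r.
  have [st|st] := ltP s t; last first.
    transitivity (\int[nu]_xi (0 : R)); last by rewrite Rintegral_cst// mul0r.
    by apply: eq_Rintegral => xi _; rewrite /k/= rlk_le0 ?mulr0// subr_le0.
  rewrite dH// -RintegralZr//.
    by apply: eq_Rintegral => xi _; rewrite /k/= rlk_gt0 ?subr_gt0// (_ : 1 - rho - 1 = - rho)//; ring.
  have iG : nu.-integrable setT (fun xi => (rho / s * `|F xi|)%:E).
    by under eq_fun do rewrite EFinM; apply: integrableZl => //; exact: integrable_norm.
  apply: (le_integrable measurableT _ _ iG).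
    apply/measurable_EFinP; apply: measurable_funM => //; apply: measurable_funN; apply: measurable_funM => //.
    exact: (measurableT_comp mw (pair1_measurable s)).
  have rs : 0 <= rho / s by rewrite divr_ge0 ?(ltW rho0) ?(ltW s0).
  move=> xi _; rewrite lee_fin [leRHS](ger0_norm (mulr_ge0 rs (normr_ge0 _))).
  by rewrite normrM ler_wpM2r// Aw_bound.
have iK := integrable_Rfubini1 ik.
have mI : measurable (`]0, t[%classic : set (measurableTypeR R)) by exact: measurable_itv.
have KE s : `]0, t[%classic s -> derive1 H s * (t - s) `^ (- rho) = Gamma (1 - rho) * \int[nu]_xi k t (s, xi).
  rewrite /= in_itv/= => st; rewrite kE st; move: g0 (derive1 H s) => /=; move: (Gamma _) => g g0 h.
  by field.
have iKI : mu.-integrable `]0, t[%classic (fun s => (\int[nu]_xi k t (s, xi))%:E).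
  exact: (integrableS measurableT mI _ iK).
split.
  split; first by move=> s /andP[s0 _]; have [] := is_derive_superposition s0.
  apply: eq_integrable (integrableZl mI (Gamma (1 - rho)) iKI) => //.
  by move=> s; rewrite inE => st; rewrite -EFinM KE.
rewrite /caputo.
transitivity ((Gamma (1 - rho))^-1 * \int[mu]_(s in `]0, t[) (Gamma (1 - rho) * \int[nu]_xi k t (s, xi))).
  by congr (_ * _); apply: eq_Rintegral => s; rewrite inE; exact: KE.
rewrite RintegralZl//; move: (Gamma (1 - rho)) g0 => g g0; rewrite mulKf//.
transitivity (\int[mu]_s \int[nu]_xi k t (s, xi)).
  rewrite Rintegral_mkcond; apply: eq_Rintegral => s _; rewrite patchE; case: ifPn => //.
  rewrite notin_setE/= in_itv/= => /negP/negbTE h; rewrite kE h//.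
rewrite (Rfubini1 ik) -(Rfubini2 ik).
have iAY : nu.-integrable setT (fun xi => (A xi * Y xi t * F xi)%:E).
  have iG : nu.-integrable setT (fun xi => (relax_bound rho t * `|F xi|)%:E).
    by under eq_fun do rewrite EFinM; apply: integrableZl => //; exact: integrable_norm.
  apply: (le_integrable measurableT _ _ iG).
    apply/measurable_EFinP; apply: measurable_funM => //.
    by apply: measurable_funM => //; exact: measurable_relax.
  move=> xi _; rewrite lee_fin [leRHS](ger0_norm (mulr_ge0 (relax_bound_ge0 t rho0) (normr_ge0 _))).
  rewrite normrM ler_wpM2r// ger0_norm; first exact: relax_decay.
  have /andP[+ _] := relax_ge0_le1 rho0 rho1 (A0 xi) (ltW t0).
  by move: (relax _ _ _) => y y0; exact: mulr_ge0.
rewrite -mulN1r -RintegralZl//; apply: eq_Rintegral => xi _.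
have [ic ec] := integral_mlf_rho_caputo (A xi) rho0 rho1 t0.
rewrite (mlf1E _ _ t0) -/(relax _ _ _) in ec.
transitivity (\int[mu]_s ((- (A xi * F xi)) * (w xi s * rlk (1 - rho) (t - s)))).
  by apply: eq_Rintegral => s _; rewrite /k/=; move: (w xi s) (rlk _ _) => v q; ring.
rewrite RintegralZl// /Rintegral ec/=; move: (relax _ _ _) => y; ring.
Qed.

End Superposition.

(** * The solution: regularity, equation and uniform convergence *)

Section Solution.
Context {R : realType} (N l : nat) (a : {ffun 'I_N -> 'I_(2 * l).+1} -> R) (rho : R)
  (phihat : N.-tuple R -> R[i]).
Hypotheses (N0 : (0 < N)%N) (l0 : (0 < l)%N).
Hypothesis ell : forall xi : N.-tuple R, xi != zero_pt N -> 0 < symbol a xi.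
Hypotheses (rho0 : 0 < rho) (rho1 : rho < 1).
Local Notation nu := (@lebN R N).
Local Notation A := (symbol a).
Hypothesis cphi : cintegrable nu phihat.
Implicit Types (x xi : N.-tuple R) (t : R).

Definition evolved t xi := rc (relax rho (A xi) t) * phihat xi.
Definition solution x t := fint (evolved t) x.

Let A_ge0 xi : 0 <= A xi := symbol_ge0 N0 l0 ell xi.
Let mA : measurable_fun setT A := measurable_symbol a.
Let mphi := cintegrable_meas cphi.

Let relax_norm xi t : 0 <= t -> `|relax rho (A xi) t| <= 1.
Proof.
move=> t0; have := relax_ge0_le1 rho0 rho1 (A_ge0 xi) t0.
by move: (relax _ _ _) => y /andP[y0 y1]; rewrite ger0_norm.
Qed.

Let cmeas_evolved t : cmeas (evolved t).
Proof. by apply: cmeasM => //; apply: cmeas_rc; exact: measurable_relax. Qed.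

Lemma cmod_evolved t xi : 0 <= t -> cmod (evolved t xi) <= cmod (phihat xi).
Proof.
move=> t0; have := relax_norm xi t0; rewrite cmodM cmod_rc; move: (relax _ _ _) => y y1.
by rewrite ler_piMl// cmod_ge0.
Qed.

Lemma cintegrable_evolved t : 0 <= t -> cintegrable nu (evolved t).
Proof.
by move=> t0; apply: (cintegrable_dom _ (integrable_cmod cphi)) => // xi; exact: cmod_evolved.
Qed.

Lemma relax_symbol_bound t xi : 0 < t ->
  (1 + A xi) * `|relax rho (A xi) t| <= 1 + relax_bound rho t.
Proof.
move=> t0; have := relax_ge0_le1 rho0 rho1 (A_ge0 xi) (ltW t0).
have := relax_decay rho0 rho1 (A_ge0 xi) t0.
move: (relax _ _ _) (relax_bound _ _) => y b yb /andP[y0 y1].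
by rewrite ger0_norm// mulrDl mul1r lerD.
Qed.

(** Ellipticity bounds the monomial by a multiple of 1 + A, and the decay of the relaxation function
    makes its product with 1 + A bounded for t > 0. The multiplier is therefore bounded. *)
Lemma cintegrable_monomial (s : seq 'I_N) t : 0 < t -> (size s <= 2 * l)%N ->
  cintegrable nu (monomial_mul s (evolved t)).
Proof.
move=> t0 sl; have [K K0 hK] := monomial_le_symbol N0 l0 ell.
have id : nu.-integrable setT (fun xi => (K * (1 + relax_bound rho t) * cmod (phihat xi))%:E).
  by under eq_fun do rewrite EFinM; apply: integrableZl => //; exact: integrable_cmod.
apply: (cintegrable_dom _ id).
  apply: cmeasM => //; apply: cmeas_prod => j; split; first exact: measurable_cst.
  exact: measurable_tnth.
move=> xi; rewrite /monomial_mul cmodM cmod_prod cmodM cmod_rc mulrA ler_wpM2r ?cmod_ge0//.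
rewrite (eq_bigr (fun j => `|tnth xi j|)); last by move=> j _; rewrite cmod_imag.
apply: (@le_trans _ _ (K * (1 + A xi) * `|relax rho (A xi) t|)).
  by apply: ler_wpM2r; [exact: normr_ge0|exact: hK].
by rewrite -mulrA; apply: ler_wpM2l; [exact: ltW|exact: relax_symbol_bound].
Qed.

Lemma Dalpha_solution (alpha : 'I_N -> nat) t : 0 < t -> (mi_order alpha <= 2 * l)%N ->
  Dalpha_exists alpha (solution ^~ t) /\
  Dalpha alpha (solution ^~ t) = fint (monomial_mul (dirs alpha) (evolved t)).
Proof.
move=> t0 al; apply: pd_seq_fint => s' ss; apply: cintegrable_monomial => //.
by apply: leq_trans (size_suffix ss) _; rewrite size_dirs.
Qed.

Lemma vanishing_Dalpha_solution (alpha : 'I_N -> nat) t : 0 < t -> (mi_order alpha <= 2 * l)%N ->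
  vanishing (Dalpha alpha (solution ^~ t)).
Proof.
move=> t0 al; have [_ ->] := Dalpha_solution t0 al; apply: riemann_lebesgue => //.
by apply: cintegrable_monomial => //; rewrite size_dirs.
Qed.

Lemma imag_unit_pow : (Complex 0 1 : R[i]) ^+ (2 * l) = rc ((-1) ^+ l).
Proof.
rewrite exprM (_ : Complex 0 1 ^+ 2 = rc (-1)).
  by elim: l => [|k IH]; rewrite ?expr0// !exprS IH -rcM.
by apply: complexP; rewrite expr2 ?creM ?cimM /cre /cim/=; ring.
Qed.

Lemma AD_solution x t : 0 < t ->
  AD a (solution ^~ t) x = fint (fun xi => rc (A xi) * evolved t xi) x.
Proof.
move=> t0; rewrite /AD.
pose P (alpha : {ffun 'I_N -> 'I_(2 * l).+1}) := mi_order (fun j => nat_of_ord (alpha j)) == (2 * l)%N.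
pose D (alpha : {ffun 'I_N -> 'I_(2 * l).+1}) := monomial_mul (dirs (fun j => nat_of_ord (alpha j))) (evolved t).
have cD alpha : P alpha -> cintegrable nu (D alpha).
  by move=> /eqP pa; apply: cintegrable_monomial => //; rewrite size_dirs pa.
rewrite (eq_bigr (fun alpha => fint (fun xi => rc (a alpha) * D alpha xi) x)); last first.
  move=> alpha pa; rewrite fintZ; last exact: cD.
  by have [|_ ->] := @Dalpha_solution (fun j => nat_of_ord (alpha j)) t t0; first by rewrite (eqP pa).
have [cS <-] := @fint_sum _ _ _ (index_enum _) P (fun alpha xi => rc (a alpha) * D alpha xi) x
  (fun alpha pa => cintegrableZ _ (cD alpha pa)).
rewrite -fintZ//; apply: eq_cint => xi; congr (_ * _); rewrite /symbol.
rewrite (eq_bigr (fun alpha => rc ((-1) ^+ l) * (rc (a alpha * \prod_(j < N) tnth xi j ^+ alpha j) * evolved t xi))).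
  (* The two signs (-1)^l cancel: one comes from the definition of [AD], the other from i^(2l). *)
  rewrite -mulr_sumr mulrA -rcM -exprMn mulrNN mulr1 expr1n mul1r -mulr_suml.
  congr (_ * _); by elim/big_rec2: _ => // alpha y z _ ->; rewrite rcD.
move=> alpha /eqP pa; rewrite /D /monomial_mul prod_imag pa imag_unit_pow rcM; ring.
Qed.

Lemma caputo_solution x t : 0 < t -> ccaputo_exists rho (solution x) t /\
  ccaputo rho (solution x) t = - fint (fun xi => rc (A xi) * evolved t xi) x.
Proof.
move=> t0; have [i1 i2] := cintegrable_fint x cphi.
pose F xi := phihat xi * cexpi (dotp x xi).
have E1 : (fun s => cre (solution x s)) = (fun s => \int[nu]_xi (relax rho (A xi) s * cre (F xi))).
  by apply/funext => s; rewrite {1}/cre/=; apply: eq_Rintegral => xi _; rewrite -mulrA cre_rcM.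
have E2 : (fun s => cim (solution x s)) = (fun s => \int[nu]_xi (relax rho (A xi) s * cim (F xi))).
  by apply/funext => s; rewrite {1}/cim/=; apply: eq_Rintegral => xi _; rewrite -mulrA cim_rcM.
have [c1 d1] := caputo_superposition rho0 rho1 A_ge0 mA i1 t0.
have [c2 d2] := caputo_superposition rho0 rho1 A_ge0 mA i2 t0.
split; first by split; [rewrite E1; exact: c1|rewrite E2; exact: c2].
rewrite /ccaputo E1 E2 d1 d2; apply: complexP; rewrite ?creN ?cimN {1}/cre {1}/cim/=; congr (- _);
  apply: eq_Rintegral => xi _.
  by rewrite -[LHS]mulrA -2!cre_rcM /evolved; congr cre; rewrite !mulrA.
by rewrite -[LHS]mulrA -2!cim_rcM /evolved; congr cim; rewrite !mulrA.
Qed.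

Lemma cvg_dotp (y : nat -> N.-tuple R) x xi :
  (forall i, tnth (y n) i @[n --> \oo] --> tnth x i) -> dotp (y n) xi @[n --> \oo] --> dotp x xi.
Proof.
move=> yx; rewrite /dotp; elim: (index_enum _) => [|i s IH].
  by under eq_fun do rewrite big_nil; rewrite big_nil; exact: cvg_cst.
under eq_fun do rewrite big_cons; rewrite big_cons; apply: cvgD => //.
by apply: cvgM; [exact: yx|exact: cvg_cst].
Qed.

(** Dominated convergence is sequential, so a failure of continuity is turned into a sequence of
    points tending to (x, t) along which the values stay at distance e. *)
Lemma cont_strip_solution (T : R) :
  cont_strip T (fun x t => fint (fun xi => rc (A xi) * evolved t xi) x).
Proof.
move=> x t /andP[t0 tT] e e0; apply: contrapT => nd.
have t2 : 0 < t / 2 by rewrite divr_gt0.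
(* The factor t / 2 keeps all times of the sequence above t / 2, where one constant bounds A y. *)
pose d n : R := t / 2 * n.+1%:R^-1.
have d0 n : 0 < d n by rewrite mulr_gt0// invr_gt0.
have dt n : d n <= t / 2 by rewrite ler_piMr ?(ltW t2)// invf_le1// ler1n.
have d_cvg : d n @[n --> \oo] --> (0 : R).
  by rewrite -[X in _ --> X](mulr0 (t / 2)); apply: cvgM; [exact: cvg_cst|exact: cvg_harmonic].
have [z hz] : {z : nat -> N.-tuple R * R & forall n, [/\ Defs.edist (z n).1 x < d n, `|(z n).2 - t| < d n &
    e <= cmod (fint (fun xi => rc (A xi) * evolved (z n).2 xi) (z n).1 - fint (fun xi => rc (A xi) * evolved t xi) x)]}.
  apply: (@choice _ _ (fun n z => [/\ Defs.edist z.1 x < d n, `|z.2 - t| < d n &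
    e <= cmod (fint (fun xi => rc (A xi) * evolved z.2 xi) z.1 - fint (fun xi => rc (A xi) * evolved t xi) x)])) => n.
  apply: contrapT => nz; apply: nd; exists (d n) => // y s s0 ys st.
  by rewrite ltNge; apply/negP => h; apply: nz; exists (y, s).
have zt : (z n).2 @[n --> \oo] --> t.
  apply/cvgrPdist_lt => r r0; move/cvgrPdist_lt : d_cvg => /(_ _ r0); apply: filterS => n.
  rewrite sub0r normrN gtr0_norm// => dr; have [_ h _] := hz n.
  by rewrite distrC (lt_trans h).
have zx i : tnth (z n).1 i @[n --> \oo] --> tnth x i.
  apply/cvgrPdist_lt => r r0; move/cvgrPdist_lt : d_cvg => /(_ _ r0); apply: filterS => n.
  rewrite sub0r normrN gtr0_norm// => dr; have [h _ _] := hz n.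
  rewrite distrC (lt_trans _ dr)// (le_lt_trans _ h)// /Defs.edist.
  by have := norm_tnth_le_enorm [tuple tnth (z n).1 i - tnth x i | i < N] i; rewrite tnth_mktuple.
have zt2 n : t / 2 <= (z n).2.
  have [_ h _] := hz n; have := dt n; move: h; rewrite ltr_norml => /andP[h _] h'.
  by move: (d n) h h' => dn h h'; lra.
have id : nu.-integrable setT (fun xi => (relax_bound rho (t / 2) * cmod (phihat xi))%:E).
  by under eq_fun do rewrite EFinM; apply: integrableZl => //; exact: integrable_cmod.
have mf y s : cmeas (fun xi => rc (A xi) * evolved s xi * cexpi (dotp y xi)).
  apply: cmeasM; last exact: cmeas_cexpi_dotp.
  by apply: cmeasM; [exact: cmeas_rc|exact: cmeas_evolved].
have : ccvg (fun n => fint (fun xi => rc (A xi) * evolved (z n).2 xi) (z n).1)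
    (fint (fun xi => rc (A xi) * evolved t xi) x).
  apply: (cint_dominated_cvg _ _ id) => //.
  - move=> n xi; rewrite 3!cmodM cmod_cexpi mulr1 2!cmod_rc mulrA ler_wpM2r ?cmod_ge0//.
    have s0 : 0 < (z n).2 := lt_le_trans t2 (zt2 n).
    apply: le_trans (relax_bound_le rho0 t2 (zt2 n)).
    have := relax_ge0_le1 rho0 rho1 (A_ge0 xi) (ltW s0).
    have := relax_decay rho0 rho1 (A_ge0 xi) s0.
    move: (relax _ _ _) (relax_bound _ _) => y b yb /andP[y0 _].
    by rewrite (ger0_norm (A_ge0 xi)) (ger0_norm y0).
  - apply: aeW => xi; apply: ccvgM; last by apply: ccvg_cexpi; exact: cvg_dotp.
    apply: ccvgM; first exact: ccvg_cst.
    by apply: ccvgM; [apply: ccvg_rc; exact: cvg_relax|exact: ccvg_cst].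
move/ccvg_near => /(_ _ e0) [n _ /(_ n (leqnn n))] /=.
by have [_ _] := hz n; rewrite leNgt => /negP.
Qed.

Lemma fourier_tail (e : R) : 0 < e ->
  exists r0 : R, forall r, r0 <= r -> 2 * \int[nu]_xi ((1 - ball_ind r xi) * cmod (phihat xi)) < e.
Proof.
move=> e0; have ip := integrable_cmod cphi.
have ib r : nu.-integrable setT (fun xi => ((1 - ball_ind r xi) * cmod (phihat xi))%:E).
  apply: (le_integrable measurableT _ _ ip).
    apply/measurable_EFinP; apply: measurable_funM; last exact: measurable_cmod.
    by apply: measurable_funB; [exact: measurable_cst|exact: measurable_ball_ind].
  move=> xi _; rewrite lee_fin normrM ler_piMl//.
  by rewrite ger0_norm ?subr_ge0 ?ball_ind_le1// gerBl ball_ind_ge0.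
have : \int[nu]_xi ((1 - ball_ind n%:R xi) * cmod (phihat xi)) @[n --> \oo] --> \int[nu]_xi (0 : R).
  apply: (Rintegral_dominated_cvg _ _ ip).
  - by move=> n; have /measurable_int/measurable_EFinP := ib n%:R.
  - exact: measurable_cst.
  - move=> n xi; rewrite normrM (ger0_norm (cmod_ge0 _)) ler_piMl ?cmod_ge0//.
    by rewrite ger0_norm ?subr_ge0 ?ball_ind_le1// gerBl ball_ind_ge0.
  - apply: aeW => xi; rewrite -[X in _ --> X](mul0r (cmod (phihat xi))).
    apply: cvgM; last exact: cvg_cst.
    rewrite -[X in _ --> X](subrr (1 : R)); apply: cvgB; [exact: cvg_cst|exact: cvg_ball_ind].
rewrite Rintegral_cst// mul0r => /cvgrPdist_lt /(_ _ (divr_gt0 e0 (ltr0n _ 2))) [n _ /(_ n (leqnn n))] /=.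
rewrite sub0r normrN => hn; exists n%:R => r nr.
rewrite mulrC -ltr_pdivlMr//; apply: le_lt_trans hn; apply: le_trans (ler_norm _).
apply: le_Rintegral => //; [exact: ib|exact: ib|].
move=> xi _; rewrite ler_wpM2r ?cmod_ge0// lerD2l lerN2 /ball_ind.
by case: ifPn => h1; case: ifPn => // h2; have := lt_le_trans h1 nr; rewrite (negbTE h2).
Qed.

(** As 0 <= E_rho <= 1 on the relevant arguments, the error is controlled by the tail of the
    integral of |phihat|, independently of x and of t >= 0. *)
Lemma U_trunc_solution (e : R) : 0 < e -> exists r0 : R, forall r, r0 <= r -> forall x t, 0 <= t ->
  cmod (U_trunc a rho phihat r x t - solution x t) < e.
Proof.
move=> e0; have [r0 h0] := fourier_tail e0; exists r0 => r /h0 hr x t t0.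
pose B xi := rc (ball_ind r xi) * evolved t xi.
have cB : cintegrable nu B.
  apply: (cintegrable_dom _ (integrable_cmod cphi)).
    by apply: cmeasM => //; apply: cmeas_rc; exact: measurable_ball_ind.
  move=> xi; rewrite cmodM cmod_rc ger0_norm ?ball_ind_ge0//.
  apply: le_trans (cmod_evolved xi t0); rewrite ler_piMl ?cmod_ge0//; exact: ball_ind_le1.
have -> : U_trunc a rho phihat r x t = fint B x.
  rewrite /U_trunc cintNE.
    by apply: eq_cint => xi; rewrite /B /evolved rcM !mulrA.
  have := cintegrable_fint x cB; congr cintegrable; apply/funext => xi.
  by rewrite /B /evolved rcM !mulrA.
have cE := cintegrable_evolved t0.
rewrite /solution -fintB//; apply: (le_lt_trans (cmod_fint_le x (cintegrableB cB cE))).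
apply: le_lt_trans hr; rewrite ler_pM2l//; apply: le_Rintegral => //.
- by apply: integrable_cmod; exact: cintegrableB.
- apply: (le_integrable measurableT _ _ (integrable_cmod cphi)).
    apply/measurable_EFinP; apply: measurable_funM; last exact: measurable_cmod.
    by apply: measurable_funB; [exact: measurable_cst|exact: measurable_ball_ind].
  move=> xi _; rewrite lee_fin normrM ler_piMl//.
  by rewrite ger0_norm ?subr_ge0 ?ball_ind_le1// gerBl ball_ind_ge0.
- move=> xi _; rewrite cmod_distC /B -[X in X - _]mul1r -mulrBl cmodM -[1]/(rc 1) -rcB cmod_rc.
  rewrite ger0_norm ?subr_ge0 ?ball_ind_le1// ler_wpM2l ?subr_ge0 ?ball_ind_le1//.
  exact: cmod_evolved.
Qed.

Lemma solution0 x : solution x 0 = fint phihat x.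
Proof. by apply: eq_cint => xi; rewrite /evolved relax0// mul1r. Qed.

End Solution.

Section Strip.
Context {R : realType} (N : nat) (T : R).
Implicit Types F G : N.-tuple R -> R -> R[i].

Lemma eq_cont_strip F G : (forall x t, 0 < t <= T -> F x t = G x t) -> cont_strip T G -> cont_strip T F.
Proof.
move=> FG cG x t t0 e e0; have [d d0 h] := cG x t t0 e e0.
by exists d => // y s s0 ys st; rewrite !FG//; exact: h.
Qed.

Lemma cont_stripN F : cont_strip T F -> cont_strip T (fun x t => - F x t).
Proof.
move=> cF x t t0 e e0; have [d d0 h] := cF x t t0 e e0.
by exists d => // y s s0 ys st; rewrite -opprD cmodN; exact: h.
Qed.

End Strip.

Theorem theorem1 (R : realType) (N l : nat)
  (a : {ffun 'I_N -> 'I_(2 * l).+1} -> R)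
  (tau rho T : R) (phi : N.-tuple R -> R[i]) :
  (0 < N)%N -> (0 < l)%N ->
  (forall xi : N.-tuple R, xi != zero_pt N -> 0 < symbol a xi) ->
  N%:R / 2 < tau -> sobolev_L2 tau phi ->
  0 < rho < 1 -> 0 < T ->
  forall phihat : N.-tuple R -> R[i], is_L2_fourier phi phihat ->
  exists u : N.-tuple R -> R -> R[i],
    [/\ (* u is given by the formula, the integral converging uniformly in x
           for each t in (0,T] ... *)
        (forall t, 0 < t <= T -> forall e : R, 0 < e ->
           exists r0 : R, forall r, r0 <= r -> forall x,
             cmod (U_trunc a rho phihat r x t - u x t) < e),
        (* ... and also (pointwise) at t = 0, *)
        (forall x, forall e : R, 0 < e ->
           exists r0 : R, forall r, r0 <= r ->
             cmod (U_trunc a rho phihat r x 0 - u x 0) < e) &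
        (* and u is a classical solution of the forward problem *)
        classical_solution a rho T phi u].
Proof.
move=> N0 l0 ell tauN sphi /andP[rho0 rho1] T0 phihat FT.
have cphi := cintegrable_phihat N0 tauN sphi FT.
have [[mphi _] _] := sphi; have iphi := L2_integrable sphi; have [_ FTlim] := FT.
have Uu := U_trunc_solution N0 l0 ell rho0 rho1 cphi.
have D := @Dalpha_solution R N l a rho phihat N0 l0 ell rho0 rho1 cphi.
have C x t (t0 : 0 < t) := caputo_solution N0 l0 ell rho0 rho1 cphi x t0.
have AD x t (t0 : 0 < t) := AD_solution N0 l0 ell rho0 rho1 cphi x t0.
have cS := cont_strip_solution N0 l0 ell rho0 rho1 cphi (T := T).
exists (solution a rho phihat); split.
- move=> t /andP[t0 _] e /Uu[r0 h]; exists r0 => r r0r x.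
  exact: (h r r0r x t (ltW t0)).
- by move=> x e /Uu[r0 h]; exists r0 => r r0r; exact: h.
split.
- move=> t /andP[t0 _] alpha al.
  by have [] := D (fun j => nat_of_ord (alpha j)) t t0 (eq_leq al).
- split; first by move=> x t /andP[t0 _]; have [] := C x t t0.
  split.
    (* Continuity of the Caputo derivative and of A(D) u is one statement, since the former is minus
       the latter's integral formula. *)
    apply: (@eq_cont_strip _ _ _ _ (fun x t => - fint (fun xi => rc (symbol a xi) * evolved a rho phihat t xi) x)).
      by move=> x t /andP[t0 _]; have [_] := C x t t0.
    by apply: cont_stripN; exact: cS.
  apply: eq_cont_strip cS => x t /andP[t0 _]; exact: AD.
- move=> x t /andP[t0 _]; have [_ E] := C x t t0.
  exact: etrans (congr2 +%R E (AD x t t0)) (addNr _).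
- move=> alpha al t /andP[t0 _].
  have al2 : (mi_order alpha <= 2 * l)%N.
    by apply: leq_trans al _; apply: leq_trans (leq_pred l) _; rewrite leq_pmull.
  have [ex _] := D alpha t t0 al2; split => //.
  exact: (vanishing_Dalpha_solution N0 l0 ell rho0 rho1 cphi t0 al2).
- have -> : (fun x => solution a rho phihat x 0) = fint phihat.
    by apply/funext => x; exact: solution0.
  exact: (fourier_inversion mphi iphi cphi FTlim).
Qed.
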